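(* Let $\alpha\in(0,1)$ and consider a $\mathcal{CM}$-preserving scheme of order $\alpha$ applied to the test equation $\mathcal D_c^\alpha u=\lambda u$, $u(0)=u_0$, $\lambda\in\mathbb C\setminus\{0\}$. There is $\theta_0\in(0,\frac\pi2)$, depending only on the scheme (namely one for which the numerical stability region contains $\{z\in\mathbb C: z\neq 0,\ |\arg(-z)|<\pi-\theta_0\}$), such that: if $|\arg(\lambda)|>\theta_0$, the scheme is unconditionally stable, i.e. $u_n\to0$ as $n\to\infty$ for every step size $h>0$. If $|\arg(\lambda)|>\frac{\pi\alpha}2$, the scheme is stable for $h$ small enough, i.e. there is $h_0>0$ (depending on $\lambda$) such that $u_n\to0$ as $n\to\infty$ for every $h\in(0,h_0)$.
   Context: A real sequence $v=(v_0,v_1,\dots)$ is completely monotone if $((I-E)^jv)_k\ge 0$ for all $j,k\ge 0$, where $(Ev)_k=v_{k+1}$. Convolution: $(u*v)_n=\sum_{j=0}^n u_jv_{n-j}$, with identity $\delta_d=(1,0,0,\dots)$; $\omega^{(-1)}$ is the sequence with $\omega*\omega^{(-1)}=\delta_d$. For $\alpha\in(0,1)$ and step size $h>0$, a real sequence $\omega$ with $\omega_0\ne0$ (independent of $h$) defines the scheme $h^{-\alpha}\sum_{j=0}^n\omega_j(u_{n-j}-u_0)=f(t_n,u_n)$, $n\ge1$, $t_n=nh$, for the Caputo fractional ODE $\mathcal D_c^\alpha u=f(t,u)$, $u(0)=u_0$; equivalently, with $a=\omega^{(-1)}$, $u_n=u_0+h^\alpha\sum_{j=0}^{n-1}a_jf(t_{n-j},u_{n-j})$,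 $n\ge1$. With $F_a(z)=\sum_{n\ge0}a_nz^n$, the scheme is consistent if $h^\alpha F_a(e^{-h})=1+o(1)$ as $h\to0^+$. A scheme is $\mathcal{CM}$-preserving if it is consistent and $a=\omega^{(-1)}$ is completely monotone. For the test equation the scheme reads $u_n=u_0+\lambda h^\alpha\sum_{j=0}^{n-1}a_ju_{n-j}$, $n\ge1$. The numerical stability region is the set of $\zeta=\lambda h^\alpha\in\mathbb C$ for which (with $u_0\ne 0$) the numerical solution is well defined and $u_n\to0$ as $n\to\infty$. The function $\arg$ has branch cut along the negative real axis and range $(-\pi,\pi]$. *)

(* Defs.v *)
From Stdlib Require Import Reals Lra.
From Coquelicot Require Import Coquelicot.

Open Scope R_scope.

(** * Real sequences *)

(** [I - E], where [E] is the shift [(E v)_k = v_(k+1)]. *)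
Definition I_minus_E (v : nat -> R) : nat -> R := fun k => v k - v (S k).

Definition completely_monotone (v : nat -> R) : Prop :=
  forall j k : nat, 0 <= Nat.iter j I_minus_E v k.

(** Coquelicot's [sum_n F n] has [n + 1] terms, [F 0 + ... + F n]. *)
Definition conv (u v : nat -> R) : nat -> R :=
  fun n => sum_n (fun j => u j * v (n - j)%nat) n.

Definition delta_d : nat -> R := fun n => match n with O => 1 | S _ => 0 end.

Definition conv_inverse (omega a : nat -> R) : Prop :=
  forall n : nat, conv omega a n = delta_d n.

(** * Schemes for the Caputo equation of order [alpha] *)

(** [PSeries] is total; [ex_pseries] says that [F_a (e^(-h))] converges for
    all small [h > 0]. *)
Definition consistent (alpha : R) (a : nat -> R) : Prop :=
  at_right 0 (fun h => ex_pseries a (exp (- h))) /\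
  filterlim (fun h => Rpower h alpha * PSeries a (exp (- h)))
    (at_right 0) (locally 1).

Definition CM_preserving (alpha : R) (omega a : nat -> R) : Prop :=
  omega 0%nat <> 0 /\ conv_inverse omega a /\
  consistent alpha a /\ completely_monotone a.

(** [h^(-alpha) sum_(j=0)^n omega_j (u_(n-j) - u_0) = f(t_n, u_n)], [n >= 1],
    with [t_n = n h]. *)
Definition scheme_solution (alpha : R) (omega : nat -> R) (h : R)
    (f : R -> C -> C) (u0 : C) (u : nat -> C) : Prop :=
  u 0%nat = u0 /\
  forall n : nat, (1 <= n)%nat ->
    (RtoC (Rpower h (- alpha)) *
      sum_n (fun j => RtoC (omega j) * (u (n - j)%nat - u0)) n)%C
    = f (INR n * h) (u n).

(** [u_n = u_0 + zeta sum_(j=0)^(n-1) a_j u_(n-j)], [n >= 1]. *)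
Definition test_solution (a : nat -> R) (zeta u0 : C) (u : nat -> C) : Prop :=
  u 0%nat = u0 /\
  forall n : nat, (1 <= n)%nat ->
    u n = (u0 + zeta * sum_n (fun j => RtoC (a j) * u (n - j)%nat) (n - 1))%C.

(** The relation [sol] has exactly one solution (the numerical solution is
    well defined) and this solution tends to [0]. *)
Definition well_defined_vanishing (sol : (nat -> C) -> Prop) : Prop :=
  exists u : nat -> C,
    sol u /\
    (forall v : nat -> C, sol v -> forall n : nat, v n = u n) /\
    filterlim u eventually (locally (RtoC 0)).

Definition stability_region (a : nat -> R) (zeta : C) : Prop :=
  forall u0 : C, u0 <> RtoC 0 -> well_defined_vanishing (test_solution a zeta u0).

(** The scheme with step [h], applied to [D_c^alpha u = lambda u], is stable. *)
Definition stable (alpha : R) (omega : nat -> R) (lambda : C) (h : R) : Prop :=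
  forall u0 : C,
    well_defined_vanishing
      (scheme_solution alpha omega h (fun _ v => (lambda * v)%C) u0).

(** * Argument of a complex number, with values in [(-PI, PI]] *)

(** Only meaningful for [z <> 0]. *)
Definition Carg (z : C) : R :=
  if Rle_dec 0 (Im z) then acos (Re z / Cmod z) else - acos (Re z / Cmod z).

Lemma Carg_spec (z : C) (hz : z <> RtoC 0) :
  - PI < Carg z <= PI /\ z = (RtoC (Cmod z) * (cos (Carg z), sin (Carg z)))%C.
Proof.
assert (hm : 0 < Cmod z) by now apply Cmod_gt_0.
assert (hq : Cmod z * Cmod z = Re z * Re z + Im z * Im z).
{ unfold Cmod, Re, Im. rewrite sqrt_sqrt; [ring | nra]. }
set (c := Re z / Cmod z).
assert (hc : Re z = Cmod z * c) by (unfold c; field; lra).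
assert (hc2 : Im z * Im z = Cmod z * Cmod z * (1 - c * c)) by (rewrite hc in hq; nra).
assert (hc1 : c * c <= 1).
{ destruct (Rle_dec (c * c) 1) as [|n]; [assumption|].
  assert (0 < Cmod z * Cmod z) by nra. nra. }
assert (hb : -1 <= c <= 1) by nra.
assert (hs : Cmod z * sqrt (1 - c²) = Rabs (Im z)).
{ rewrite <- (sqrt_Rsqr_abs (Im z)). unfold Rsqr at 2. rewrite hc2.
  rewrite sqrt_mult by nra. rewrite sqrt_square by lra. reflexivity. }
pose proof (acos_bound c) as hab.
unfold Carg; fold c.
destruct (Rle_dec 0 (Im z)) as [hi|hi].
- split; [pose proof PI_RGT_0; lra|].
  rewrite cos_acos, sin_acos by assumption.
  rewrite Rabs_pos_eq in hs by assumption.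
  destruct z as [x y]; unfold Re, Im in *; simpl in *.
  unfold Cmult, RtoC; simpl. f_equal; lra.
- assert (hpi : acos c <> PI).
  { intro e. assert (h1 : c = -1) by (rewrite <- (cos_acos c hb), e; apply cos_PI).
    rewrite h1 in hc2. nra. }
  split; [lra|].
  rewrite cos_neg, sin_neg, cos_acos, sin_acos by assumption.
  rewrite Rabs_left in hs by lra.
  destruct z as [x y]; unfold Re, Im in *; simpl in *.
  unfold Cmult, RtoC; simpl. f_equal; lra.
Qed.

(* Main.v *)
Require Import Defs.
From Stdlib Require Import Reals Lra Lia Psatz FunctionalExtensionality.
From Coquelicot Require Import Coquelicot.

(** Write [F (z)] for the power series of [omega] on the unit disk and
    [zeta = lambda h ^ alpha].  With [W_n = omega_0 + ... + omega_n], both forms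
    of the scheme say [(omega - zeta delta) * u = u_0 (W - zeta delta)], a
    convolution equation.  If [|F - zeta|] is bounded below on the open disk,
    the convolution inverse [g] of [omega - zeta delta] is absolutely summable
    ([Wiener_power_series]), so that [u = u_0 (g * W - zeta g)] tends to [0],
    because [W_n] tends to [F (1) = 0].  Stability is therefore the question of
    which [zeta] keep away from the values of [F].

    Complete monotonicity of [a] is used through monotonicity and
    log-convexity ([completely_monotone_log_convex]), which by Kaluza's argument
    make [omega_j <= 0] for [j >= 1] and all [W_n >= 0].  Consistency gives
    [F (1) = 0], whence [F (z) = sum_j |omega_j| (1 - z ^ j)] over [j >= 1].
    Thus [Re F (z) >= |omega_1| |1 - z| ^ 2 / 2], and away from [z = 1] the
    values of [F] are bounded, bounded away from [0], and lie in a sector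
    smaller than the right half plane.

    Near [z = 1] the point is that [F (z)] is asymptotic to [(1 - z) ^ alpha]
    uniformly in the disk, although consistency speaks of real [z] only
    ([tauberian_disk], applied to the difference [e] between [omega] and the
    coefficients of [(1 - z) ^ alpha]).  The binomial expansion of
    [z ^ j = (1 - (1 - q ^ j)) ^ w] for [z = q ^ w], [q = e ^ (- h)], writes
    [F_e (q ^ w)] through the values [F_e (q ^ i)] on the positive axis; this
    settles each ray with [Re w > 1].  The sign of the coefficients yields the
    modulus of continuity [|F (z) - F (z')| <= 4 F (e ^ (- |z - z'|))], of order
    [|z - z'| ^ alpha], and with it the estimate spreads from finitely many
    rays to the whole disk, including directions tangent to the circle.

    Since [|arg (1 - z)| < PI / 2], the values of [F] near [1] lie in sectors of
    angle arbitrarily close to [PI alpha / 2].  Together with the bound away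
    from [1], all values lie in a closed sector of some angle
    [theta_0 < PI / 2], which gives the first two stability claims; and small
    [zeta] with [|arg zeta| > PI alpha / 2] are not approached by [F], which
    gives the third. *)

Open Scope R_scope.

(** * Kaluza's theorem for completely monotone sequences *)

Lemma iter_I_minus_E_shift (v : nat -> R) (j k : nat) :
  Nat.iter j I_minus_E (fun i => v (S i)) k = Nat.iter j I_minus_E v (S k).
Proof.
  revert k; induction j as [|j IH]; intro k; [reflexivity|].
  simpl. unfold I_minus_E at 1 3. now rewrite !IH.
Qed.

Lemma completely_monotone_shift (v : nat -> R) :
  completely_monotone v -> completely_monotone (fun k => v (S k)).
Proof. intros hv j k. rewrite iter_I_minus_E_shift. apply hv. Qed.

Lemma completely_monotone_I_minus_E (v : nat -> R) :
  completely_monotone v -> completely_monotone (I_minus_E v).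
Proof. intros hv j k. rewrite <- Nat.iter_succ_r. apply hv. Qed.

Lemma completely_monotone_scal (c : R) (v : nat -> R) :
  0 <= c -> completely_monotone v -> completely_monotone (fun k => c * v k).
Proof.
  intros hc hv j k.
  replace (Nat.iter j I_minus_E (fun i => c * v i) k)
    with (c * Nat.iter j I_minus_E v k).
  - apply Rmult_le_pos; [assumption|apply hv].
  - revert k; induction j as [|j IH]; intro k; [reflexivity|].
    simpl. unfold I_minus_E at 1 3. rewrite <- !IH. ring.
Qed.

Lemma completely_monotone_nonneg (v : nat -> R) (k : nat) :
  completely_monotone v -> 0 <= v k.
Proof. intros hv. apply (hv 0%nat k). Qed.

Lemma completely_monotone_decr (v : nat -> R) (k : nat) :
  completely_monotone v -> v (S k) <= v k.
Proof. intros hv. generalize (hv 1%nat k). simpl. unfold I_minus_E. lra. Qed.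

(** Log-convexity at [0] up to a defect [c]: a family of weaker statements on
    which to iterate. *)
Definition almost_log_convex (c : R) : Prop :=
  forall v, completely_monotone v ->
    v 1%nat ^ 2 <= v 0%nat * v 2%nat + c * v 0%nat ^ 2.

(** The self-improvement behind log-convexity.  A completely monotone [v] is
    the sum of the completely monotone sequences [E v] and [(I - E) v].  Adding
    the defective inequality for the two summands, with weights [1 - v_1] and
    [v_1] when [v_0 = 1], eliminates [v_3] and gives
    [d + 4 d ^ 2 <= c] for the defect [d = v_1 ^ 2 - v_2]: the defect bound [c]
    cannot be attained. *)
Lemma almost_log_convex_improve (s : R) :
  4 <= s -> almost_log_convex (4 / s) -> almost_log_convex (4 / (s + 1)).
Proof.
  intros hs hP.
  assert (key : forall v, completely_monotone v -> v 0%nat = 1 ->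
            v 1%nat ^ 2 - v 2%nat <= 4 / (s + 1)).
  { intros v hv v0.
    assert (h1 := hP _ (completely_monotone_shift v hv)).
    assert (h2 := hP _ (completely_monotone_I_minus_E v hv)).
    assert (b1 := completely_monotone_decr v 0 hv).
    assert (b2 := completely_monotone_decr v 1 hv).
    assert (b3 := completely_monotone_nonneg v 2 hv).
    unfold I_minus_E in h2. cbv beta in h1. rewrite v0 in *.
    set (x := v 1%nat) in *. set (y := v 2%nat) in *. set (w := v 3%nat) in *.
    set (c := 4 / s) in *.
    assert (hc0 : 0 < c) by (unfold c; apply Rdiv_lt_0_compat; lra).
    assert (hXd : (x - y) * (x ^ 2 - y) <= c * (x * (1 - x))).
    { assert (e1 : (1 - x) * y ^ 2 <= (1 - x) * (x * w + c * x ^ 2))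
        by (apply Rmult_le_compat_l; [lra|exact h1]).
      assert (e2 : x * (x - y) ^ 2 <= x * ((1 - x) * (y - w) + c * (1 - x) ^ 2))
        by (apply Rmult_le_compat_l; [lra|exact h2]).
      nra. }
    set (d := x ^ 2 - y) in *. set (X := x * (1 - x)) in *.
    assert (exy : x - y = X + d) by (unfold X, d; ring).
    rewrite exy in hXd.
    assert (hX : 0 <= X <= 1 / 4).
    { unfold X. split; [apply Rmult_le_pos; lra|]. generalize (pow2_ge_0 (x - 1 / 2)). nra. }
    destruct (Rle_or_lt d (4 / (s + 1))) as [|hd]; [assumption|exfalso].
    assert (hq : 0 < 4 / (s + 1)) by (apply Rdiv_lt_0_compat; lra).
    assert (hcd : c < d + 4 * d ^ 2).
    { apply Rlt_trans with (4 / (s + 1) + 4 * (4 / (s + 1)) ^ 2); [|nra].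
      unfold c. apply Rminus_lt_0.
      replace (4 / (s + 1) + 4 * (4 / (s + 1)) ^ 2 - 4 / s)
        with ((60 * s - 4) / (s * (s + 1) ^ 2)) by (field; lra).
      apply Rdiv_lt_0_compat; [lra|]. apply Rmult_lt_0_compat; [lra|nra]. }
    assert (0 < d) by lra.
    destruct (Req_dec X 0) as [X0|X0]; [rewrite X0 in hXd; nra|].
    assert (c * X < (d + 4 * d ^ 2) * X) by (apply Rmult_lt_compat_r; lra).
    assert (d ^ 2 * X <= d ^ 2 * (1 / 4)) by (apply Rmult_le_compat_l; nra).
    nra. }
  intros v hv.
  assert (b0 := completely_monotone_nonneg v 0 hv).
  assert (b1 := completely_monotone_decr v 0 hv).
  assert (b2 := completely_monotone_nonneg v 1 hv).
  destruct (Req_dec (v 0%nat) 0) as [h0|h0].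
  - rewrite h0 in *. replace (v 1%nat) with 0 by lra. nra.
  - assert (hp : 0 < v 0%nat) by lra.
    assert (hk : completely_monotone (fun k => / v 0%nat * v k)).
    { apply completely_monotone_scal; [|assumption]. left. now apply Rinv_0_lt_compat. }
    assert (hk' := key _ hk (Rinv_l _ h0)). cbv beta in hk'.
    replace (v 1%nat ^ 2) with ((/ v 0%nat * v 1%nat) ^ 2 * v 0%nat ^ 2) by (field; lra).
    replace (v 0%nat * v 2%nat) with ((/ v 0%nat * v 2%nat) * v 0%nat ^ 2) by (field; lra).
    rewrite <- Rmult_plus_distr_r. apply Rmult_le_compat_r; [nra|lra].
Qed.

Lemma almost_log_convex_all (n : nat) : almost_log_convex (4 / (INR n + 4)).
Proof.
  induction n as [|n IH].
  - intros v hv. simpl INR.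
    assert (b1 := completely_monotone_decr v 0 hv).
    assert (b2 := completely_monotone_nonneg v 1 hv).
    assert (b3 := completely_monotone_nonneg v 2 hv).
    replace (4 / (0 + 4)) with 1 by field. nra.
  - rewrite S_INR. replace (INR n + 1 + 4) with (INR n + 4 + 1) by ring.
    apply almost_log_convex_improve; [|assumption].
    generalize (pos_INR n). lra.
Qed.

(** The inequality at [k] is the one at [0] for a shifted sequence, and there
    the defect [4 / (n + 4)] is arbitrarily small. *)
Lemma completely_monotone_log_convex (v : nat -> R) (k : nat) :
  completely_monotone v -> v (S k) ^ 2 <= v k * v (S (S k)).
Proof.
  revert v. induction k as [|k IH]; intros v hv;
    [|exact (IH _ (completely_monotone_shift v hv))].
  apply le_epsilon. intros eps he.
  set (B := v 0%nat ^ 2). assert (hB : 0 <= B) by (unfold B; nra).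
  destruct (nfloor_ex (4 * B / eps)) as [n hn].
  { apply Rmult_le_pos; [lra|left; now apply Rinv_0_lt_compat]. }
  assert (h := almost_log_convex_all n v hv). fold B in h.
  apply Rle_trans with (1 := h), Rplus_le_compat_l.
  assert (hn0 := pos_INR n).
  apply Rmult_le_reg_r with (INR n + 4); [lra|].
  replace (4 / (INR n + 4) * B * (INR n + 4)) with (4 * B / eps * eps) by (field; lra).
  rewrite Rmult_comm. apply Rmult_le_compat_l; lra.
Qed.

(** What Kaluza's theorem says about the convolution inverse of a positive,
    decreasing, log-convex sequence. *)
Definition kaluza_sequence (v : nat -> R) : Prop :=
  (forall n, v (S n) <= 0) /\ (forall n, 0 <= sum_n v n).

Lemma sum_n_Rplus (u v : nat -> R) (n : nat) :
  sum_n (fun k => u k + v k) n = sum_n u n + sum_n v n.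
Proof. exact (sum_n_plus u v n). Qed.

Lemma sum_n_Rmult_l (c : R) (u : nat -> R) (n : nat) :
  sum_n (fun k => c * u k) n = c * sum_n u n.
Proof. exact (sum_n_mult_l (K := R_Ring) c u n). Qed.

Lemma sum_n_Rext (u v : nat -> R) (n : nat) :
  (forall k, (k <= n)%nat -> u k = v k) -> sum_n u n = sum_n v n :> R.
Proof. exact (sum_n_ext_loc u v n). Qed.

Lemma sum_n_Rsucc (u : nat -> R) (n : nat) : sum_n u (S n) = sum_n u n + u (S n).
Proof. exact (sum_Sn u n). Qed.

Lemma sum_n_nonneg (u : nat -> R) (n : nat) :
  (forall k, (k <= n)%nat -> 0 <= u k) -> 0 <= sum_n u n.
Proof.
  induction n as [|n IH]; intro h.
  - rewrite sum_O. now apply h.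
  - rewrite sum_n_Rsucc. apply Rplus_le_le_0_compat; [apply IH; intros; apply h|apply h]; lia.
Qed.

Lemma sum_n_le_loc (u v : nat -> R) (n : nat) :
  (forall k, (k <= n)%nat -> u k <= v k) -> sum_n u n <= sum_n v n.
Proof.
  induction n as [|n IH]; intro h.
  - rewrite !sum_O. now apply h.
  - rewrite !sum_n_Rsucc. apply Rplus_le_compat; [apply IH; intros; apply h|apply h]; lia.
Qed.

Lemma sum_n_mono (u : nat -> R) (n m : nat) :
  (forall k, 0 <= u k) -> (n <= m)%nat -> sum_n u n <= sum_n u m.
Proof.
  intros h0 hnm. induction hnm as [|m _ IH]; [lra|].
  rewrite sum_n_Rsucc. generalize (h0 (S m)). lra.
Qed.

(** Eliminating [w_0] between two consecutive convolution equations expresses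
    [w_(n+1)] through [w_1, ..., w_n] with coefficients of one sign, because the
    ratios [a_(m+1) / a_m] are nondecreasing. *)
Lemma kaluza_of_log_convex (w a : nat -> R) :
  (forall n, 0 < a n) -> (forall n, a (S n) <= a n) ->
  (forall n, a (S n) ^ 2 <= a n * a (S (S n))) ->
  conv_inverse w a -> kaluza_sequence w.
Proof.
  intros hpos hdec hlog hinv.
  assert (hw0 : 0 < w 0%nat).
  { generalize (hinv 0%nat). unfold conv, delta_d. rewrite sum_O. simpl.
    intro e. generalize (hpos 0%nat). intro. destruct (Rlt_or_le 0 (w 0%nat)); nra. }
  assert (ratio : forall m d, a (S m) * a (m + d)%nat <= a (S (m + d)) * a m).
  { intros m d. induction d as [|d IH]; [rewrite Nat.add_0_r; lra|].
    rewrite Nat.add_succ_r.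
    assert (p1 := hpos (m + d)%nat). assert (p2 := hpos (S (m + d))).
    assert (p3 := hpos m). assert (l := hlog (m + d)%nat).
    apply Rmult_le_reg_r with (a (m + d)%nat); [assumption|].
    apply Rle_trans with (a (S (m + d)) * a m * a (S (m + d))); nra. }
  assert (hneg : forall n, w (S n) <= 0).
  { intro n. induction n as [n IH] using (well_founded_induction Wf_nat.lt_wf).
    assert (e1 := hinv (S n)). assert (e2 := hinv n). unfold conv in e1, e2.
    rewrite sum_n_Rsucc, Nat.sub_diag in e1.
    change (delta_d (S n)) with 0 in e1.
    assert (hd : 0 <= delta_d n) by (destruct n; simpl; lra).
    assert (hs : 0 <= sum_n (fun j => a n * (w j * a (S n - j)%nat)
                               + - a (S n) * (w j * a (n - j)%nat)) n).
    { apply sum_n_nonneg. intros [|k] hk.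
      - rewrite !Nat.sub_0_r. lra.
      - assert (hwk : w (S k) <= 0) by (apply IH; lia).
        assert (hr := ratio (n - S k)%nat (S k)).
        replace (n - S k + S k)%nat with n in hr by lia.
        replace (S n - S k)%nat with (S (n - S k)) by lia.
        nra. }
    rewrite sum_n_Rplus, !sum_n_Rmult_l, e2 in hs.
    assert (pn := hpos n). assert (pSn := hpos (S n)). assert (p0 := hpos 0%nat).
    set (S1 := sum_n _ n) in *.
    assert (h : a n * (w (S n) * a 0%nat) <= 0) by nra.
    destruct (Rle_or_lt (w (S n)) 0) as [|hp]; [assumption|].
    assert (0 < a n * (w (S n) * a 0%nat)); [|lra].
    apply Rmult_lt_0_compat; [|apply Rmult_lt_0_compat]; assumption. }
  split; [assumption|]. intro n.
  destruct n as [|n]; [rewrite sum_O; lra|].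
  assert (e := hinv (S n)). unfold conv in e. change (delta_d (S n)) with 0 in e.
  (* the decreasing weights [a] can only make the negative terms heavier *)
  assert (hmono : forall i j, (i <= j)%nat -> a j <= a i).
  { intros i j hij. induction hij; [lra|]. generalize (hdec m). lra. }
  assert (hs : sum_n (fun j => w j * a (S n - j)%nat) (S n)
               <= sum_n (fun j => a (S n) * w j) (S n)).
  { apply sum_n_le_loc. intros [|k] hk.
    - rewrite Nat.sub_0_r. lra.
    - assert (h1 := hneg k). assert (h2 := hmono (S n - S k)%nat (S n) ltac:(lia)).
      nra. }
  rewrite e, sum_n_Rmult_l in hs.
  generalize (hpos (S n)). intro. destruct (Rlt_or_le (sum_n w (S n)) 0); nra.
Qed.

(** * Absolutely convergent real series *)

Lemma ex_series_of_bound (u : nat -> R) (M : R) :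
  (forall n, 0 <= u n) -> (forall n, sum_n u n <= M) -> ex_series u.
Proof.
  intros h0 hM.
  destruct (ex_finite_lim_seq_incr (sum_n u) M) as [l hl].
  - intro n. rewrite sum_n_Rsucc. generalize (h0 (S n)). lra.
  - assumption.
  - exists l. exact hl.
Qed.

Lemma sum_n_le_Series (u : nat -> R) (n : nat) :
  (forall k, 0 <= u k) -> ex_series u -> sum_n u n <= Series u.
Proof.
  intros h0 hu.
  apply is_lim_seq_incr_compare with (u := sum_n u).
  - exact (Series_correct u hu).
  - intro m. rewrite sum_n_Rsucc. generalize (h0 (S m)). lra.
Qed.

Lemma Series_le_of_bound (u : nat -> R) (M : R) :
  ex_series u -> (forall n, sum_n u n <= M) -> Series u <= M.
Proof.
  intros hu hM.
  apply (is_lim_seq_le (sum_n u) (fun _ => M) (Series u) M hM).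
  - exact (Series_correct u hu).
  - apply is_lim_seq_const.
Qed.

Lemma Series_nonneg (u : nat -> R) :
  (forall k, 0 <= u k) -> ex_series u -> 0 <= Series u.
Proof.
  intros h0 hu. apply Rle_trans with (sum_n u 0).
  - rewrite sum_O. apply h0.
  - now apply sum_n_le_Series.
Qed.

Lemma ex_series_dom (u M : nat -> R) :
  (forall k, Rabs (u k) <= M k) -> ex_series M -> ex_series u.
Proof. intros h hM. exact (@ex_series_le R_AbsRing R_CompleteNormedModule u M h hM). Qed.

(** Dominated convergence, in a form that is uniform in whatever the terms
    depend on. *)
Lemma series_dominated_small (M : nat -> R) (eps : R) :
  (forall k, 0 <= M k) -> ex_series M -> 0 < eps ->
  exists (K : nat) (eta : R), 0 < eta /\
    forall t : nat -> R, (forall k, 0 <= t k <= M k) ->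
      (forall k, (k <= K)%nat -> t k <= eta) ->
      Series t <= eps.
Proof.
  intros h0 hM he.
  assert (hl : is_lim_seq (sum_n M) (Series M)) by exact (Series_correct M hM).
  apply is_lim_seq_spec in hl. destruct (hl (mkposreal (eps / 2) ltac:(lra))) as [K hK].
  simpl in hK. exists K, (eps / 2 / INR (S K)).
  assert (hKp : 0 < INR (S K)) by (apply lt_0_INR; lia).
  split; [apply Rdiv_lt_0_compat; lra|].
  intros t ht hsm. apply Series_le_of_bound.
  { apply ex_series_dom with M; [|assumption]. intro k.
    rewrite Rabs_pos_eq; apply ht. }
  assert (hbase : forall n, (n <= K)%nat -> sum_n t n <= eps / 2).
  { intros n hn. apply Rle_trans with (sum_n t K).
    - apply sum_n_mono; [intro; apply ht|assumption].
    - apply Rle_trans with (sum_n (fun _ => eps / 2 / INR (S K)) K).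
      + apply sum_n_le_loc. intros; now apply hsm.
      + rewrite sum_n_const. right. field. lra. }
  intro n. destruct (Nat.le_gt_cases n K) as [hn|hn]; [generalize (hbase n hn); lra|].
  assert (hdiff : sum_n t n - sum_n t K <= sum_n M n - sum_n M K).
  { clear - ht hn. induction n as [|n IH]; [lia|].
    rewrite !sum_n_Rsucc. assert (h := ht (S n)).
    destruct (Nat.eq_dec n K) as [->|]; [lra|].
    assert (sum_n t n - sum_n t K <= sum_n M n - sum_n M K) by (apply IH; lia). lra. }
  assert (hb := hbase K (Nat.le_refl K)).
  assert (hKK := hK K (Nat.le_refl K)). apply Rabs_lt_between in hKK.
  assert (hSn := sum_n_le_Series M n h0 hM).
  lra.
Qed.

(** * The convolution ring of complex sequences *)

Lemma sum_n_Cplus (u v : nat -> C) (n : nat) :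
  sum_n (fun k => u k + v k)%C n = (sum_n u n + sum_n v n)%C :> C.
Proof. exact (sum_n_plus u v n). Qed.

Lemma sum_n_Cmult_l (c : C) (u : nat -> C) (n : nat) :
  sum_n (fun k => c * u k)%C n = (c * sum_n u n)%C :> C.
Proof. exact (sum_n_mult_l (K := C_Ring) c u n). Qed.

Lemma sum_n_Cext (u v : nat -> C) (n : nat) :
  (forall k, (k <= n)%nat -> u k = v k) -> sum_n u n = sum_n v n :> C.
Proof. exact (sum_n_ext_loc u v n). Qed.

Lemma sum_n_Csucc (u : nat -> C) (n : nat) :
  sum_n u (S n) = (sum_n u n + u (S n))%C :> C.
Proof. exact (sum_Sn u n). Qed.

Lemma sum_n_Csucc_l (u : nat -> C) (n : nat) :
  sum_n u (S n) = (u 0%nat + sum_n (fun k => u (S k)) n)%C :> C.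
Proof.
  induction n as [|n IH].
  - rewrite sum_n_Csucc, !sum_O. reflexivity.
  - rewrite sum_n_Csucc, IH, sum_n_Csucc. ring.
Qed.

Lemma Re_sum_n (u : nat -> C) (n : nat) :
  Re (sum_n u n) = sum_n (fun k => Re (u k)) n.
Proof.
  induction n as [|n IH]; [now rewrite !sum_O|].
  rewrite sum_n_Csucc, sum_n_Rsucc, <- IH. reflexivity.
Qed.

Lemma Im_sum_n (u : nat -> C) (n : nat) :
  Im (sum_n u n) = sum_n (fun k => Im (u k)) n.
Proof.
  induction n as [|n IH]; [now rewrite !sum_O|].
  rewrite sum_n_Csucc, sum_n_Rsucc, <- IH. reflexivity.
Qed.

Lemma Cmod_sum_n_le (u : nat -> C) (n : nat) :
  Cmod (sum_n u n) <= sum_n (fun k => Cmod (u k)) n.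
Proof.
  induction n as [|n IH]; [rewrite !sum_O; lra|].
  rewrite sum_n_Csucc, sum_n_Rsucc.
  apply Rle_trans with (1 := Cmod_triangle _ _). lra.
Qed.

Definition sadd (u v : nat -> C) : nat -> C := fun n => (u n + v n)%C.
Definition sopp (u : nat -> C) : nat -> C := fun n => (- u n)%C.
Definition ssub (u v : nat -> C) : nat -> C := fun n => (u n - v n)%C.
Definition szero : nat -> C := fun _ => RtoC 0.
Definition sone : nat -> C := fun n => RtoC (delta_d n).
Definition sscal (c : C) (u : nat -> C) : nat -> C := fun n => (c * u n)%C.
Definition sconv (u v : nat -> C) : nat -> C :=
  fun n => sum_n (fun j => (u j * v (n - j)%nat)%C) n.

Lemma sconv_0 (u v : nat -> C) : sconv u v 0%nat = (u 0%nat * v 0%nat)%C.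
Proof. unfold sconv. now rewrite sum_O. Qed.

Lemma sconv_succ (u v : nat -> C) (n : nat) :
  sconv u v (S n) = (u 0%nat * v (S n) + sconv (fun k => u (S k)) v n)%C.
Proof. unfold sconv. now rewrite sum_n_Csucc_l. Qed.

Lemma sconv_succ_r (u v : nat -> C) (n : nat) :
  sconv u v (S n) = (sconv u (fun k => v (S k)) n + u (S n) * v 0%nat)%C.
Proof.
  unfold sconv. rewrite sum_n_Csucc, Nat.sub_diag. f_equal.
  apply sum_n_Cext. intros k hk. do 2 f_equal. lia.
Qed.

Lemma sconv_comm (u v : nat -> C) : sconv u v = sconv v u.
Proof.
  apply functional_extensionality. intro n. revert u v.
  induction n as [|n IH]; intros u v.
  - rewrite !sconv_0. ring.
  - rewrite sconv_succ, sconv_succ_r, IH. ring.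
Qed.

Lemma sconv_addl (u v w : nat -> C) :
  sconv (sadd u v) w = sadd (sconv u w) (sconv v w).
Proof.
  apply functional_extensionality. intro n. unfold sconv, sadd.
  rewrite <- sum_n_Cplus. apply sum_n_Cext. intros. ring.
Qed.

Lemma sconv_scall (c : C) (u w : nat -> C) :
  sconv (sscal c u) w = sscal c (sconv u w).
Proof.
  apply functional_extensionality. intro n. unfold sconv, sscal.
  rewrite <- sum_n_Cmult_l. apply sum_n_Cext. intros. ring.
Qed.

Lemma sconv_assoc (u v w : nat -> C) : sconv u (sconv v w) = sconv (sconv u v) w.
Proof.
  apply functional_extensionality. intro n. revert u.
  induction n as [|n IH]; intro u.
  - rewrite !sconv_0. ring.
  - rewrite !(sconv_succ _ _ n).
    replace (fun k => sconv u v (S k))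
      with (sadd (sscal (u 0%nat) (fun k => v (S k))) (sconv (fun k => u (S k)) v)).
    + rewrite sconv_addl, sconv_scall. unfold sadd, sscal. rewrite IH, sconv_0. ring.
    + apply functional_extensionality. intro k. now rewrite sconv_succ.
Qed.

Lemma sconv_1l (u : nat -> C) : sconv sone u = u.
Proof.
  apply functional_extensionality. intros [|n].
  - rewrite sconv_0. unfold sone, delta_d. ring.
  - rewrite sconv_succ.
    replace (sconv (fun k => sone (S k)) u n) with (RtoC 0).
    + unfold sone, delta_d. ring.
    + unfold sconv. rewrite (sum_n_ext _ (fun k => RtoC 0 * u (n - k)%nat)%C) by reflexivity.
      rewrite sum_n_Cmult_l. ring.
Qed.

Lemma sequence_ring_theory :
  ring_theory szero sone sadd sconv ssub sopp eq.
Proof.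
  split; intros; try (apply functional_extensionality; intro n;
    unfold sadd, szero, sopp, ssub; ring).
  - apply sconv_1l.
  - apply sconv_comm.
  - apply sconv_assoc.
  - apply sconv_addl.
Qed.

Add Ring sequence_ring : sequence_ring_theory.

Fixpoint spow (u : nat -> C) (n : nat) : nat -> C :=
  match n with O => sone | S m => sconv u (spow u m) end.

Lemma spow_sconv (u v : nat -> C) (n : nat) :
  spow (sconv u v) n = sconv (spow u n) (spow v n).
Proof. induction n as [|n IH]; simpl; [ring|]. rewrite IH. ring. Qed.

(** On generating functions this is [U |-> U (z x)]; it turns evaluation at [z]
    into summation, and is a ring morphism. *)
Definition dilate (z : C) (u : nat -> C) : nat -> C := fun n => (u n * z ^ n)%C.

Lemma dilate_sconv (z : C) (u v : nat -> C) :
  dilate z (sconv u v) = sconv (dilate z u) (dilate z v).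
Proof.
  apply functional_extensionality. intro n. unfold dilate, sconv.
  rewrite Cmult_comm, <- sum_n_Cmult_l. apply sum_n_Cext. intros k hk.
  replace n with (k + (n - k))%nat at 1 by lia. rewrite Cpow_add_r. ring.
Qed.

Lemma dilate_sone (z : C) : dilate z sone = sone.
Proof.
  apply functional_extensionality. intros [|n]; unfold dilate, sone, delta_d.
  - simpl. ring.
  - ring.
Qed.

Lemma dilate_spow (z : C) (u : nat -> C) (n : nat) :
  dilate z (spow u n) = spow (dilate z u) n.
Proof.
  induction n as [|n IH]; [apply dilate_sone|].
  simpl. now rewrite dilate_sconv, IH.
Qed.

Lemma dilate_dilate (y z : C) (u : nat -> C) :
  dilate y (dilate z u) = dilate (z * y) u.
Proof.
  apply functional_extensionality. intro n. unfold dilate. rewrite Cpow_mult_l. ring.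
Qed.

(** Convolution inverses are built by course-of-values recursion: stage [n]
    fixes the first [n + 1] entries. *)
Fixpoint sinv_upto (f : nat -> C) (n : nat) : nat -> C :=
  match n with
  | O => fun _ => (/ f 0%nat)%C
  | S m => fun k =>
      if Nat.leb k m then sinv_upto f m k
      else (- / f 0%nat * sconv (fun j => f (S j)) (sinv_upto f m) m)%C
  end.

Lemma sconv_inverse_exists (f : nat -> C) :
  f 0%nat <> RtoC 0 -> exists g, sconv f g = sone.
Proof.
  intro h0. exists (fun n => sinv_upto f n n).
  assert (stab : forall n k, (k <= n)%nat -> sinv_upto f n k = sinv_upto f k k).
  { induction n as [|n IH]; intros k hk.
    - now replace k with 0%nat by lia.
    - destruct (Nat.eq_dec k (S n)) as [->|hne]; [reflexivity|].
      simpl. rewrite (proj2 (Nat.leb_le k n)) by lia. apply IH. lia. }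
  apply functional_extensionality. intros [|n].
  - rewrite sconv_0. unfold sone, delta_d. simpl. now field.
  - rewrite sconv_succ.
    replace (sconv (fun j => f (S j)) (fun n0 => sinv_upto f n0 n0) n)
      with (sconv (fun j => f (S j)) (sinv_upto f n) n).
    + cbn -[Nat.leb]. rewrite (proj2 (Nat.leb_gt (S n) n)) by lia.
      unfold sone, delta_d. now field.
    + apply sum_n_Cext. intros k hk. f_equal. apply stab. lia.
Qed.

(** * Truncated and full l1 norms *)

(** Truncation keeps the norm of a formal inverse finite before its
    summability is known, and it is still submultiplicative. *)
Definition norm_upto (u : nat -> C) (K : nat) : R := sum_n (fun k => Cmod (u k)) K.

Definition abs_summable (u : nat -> C) : Prop := ex_series (fun k => Cmod (u k)).

Lemma norm_upto_nonneg (u : nat -> C) (K : nat) : 0 <= norm_upto u K.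
Proof. apply sum_n_nonneg. intros; apply Cmod_ge_0. Qed.

Lemma norm_upto_sadd (u v : nat -> C) (K : nat) :
  norm_upto (sadd u v) K <= norm_upto u K + norm_upto v K.
Proof.
  unfold norm_upto. rewrite <- sum_n_Rplus. apply sum_n_le_loc.
  intros. apply Cmod_triangle.
Qed.

Lemma norm_upto_sone (K : nat) : norm_upto sone K = 1.
Proof.
  induction K as [|K IH]; unfold norm_upto in *.
  - rewrite sum_O. unfold sone, delta_d. apply Cmod_1.
  - rewrite sum_n_Rsucc, IH. unfold sone, delta_d. rewrite Cmod_0. ring.
Qed.

Lemma sum_n_convolution (x y : nat -> R) (K : nat) :
  sum_n (fun n => sum_n (fun j => x j * y (n - j)%nat) n) K
  = sum_n (fun j => x j * sum_n y (K - j)) K.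
Proof.
  induction K as [|K IH]; [now rewrite !sum_O|].
  rewrite sum_n_Rsucc, IH, !sum_n_Rsucc, Nat.sub_diag, sum_O, <- Rplus_assoc.
  f_equal. rewrite <- sum_n_Rplus. apply sum_n_Rext. intros j hj.
  replace (S K - j)%nat with (S (K - j)) by lia. rewrite sum_n_Rsucc. ring.
Qed.

Lemma norm_upto_sconv (u v : nat -> C) (K : nat) :
  norm_upto (sconv u v) K <= norm_upto u K * norm_upto v K.
Proof.
  unfold norm_upto.
  apply Rle_trans with
    (sum_n (fun n => sum_n (fun j => Cmod (u j) * Cmod (v (n - j)%nat)) n) K).
  - apply sum_n_le_loc. intros n _. apply Rle_trans with (1 := Cmod_sum_n_le _ _).
    right. apply sum_n_Rext. intros. apply Cmod_mult.
  - rewrite (sum_n_convolution (fun j => Cmod (u j)) (fun j => Cmod (v j))).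
    rewrite Rmult_comm, <- sum_n_Rmult_l. apply sum_n_le_loc. intros k hk.
    rewrite Rmult_comm. apply Rmult_le_compat_r; [apply Cmod_ge_0|].
    apply sum_n_mono; [intro; apply Cmod_ge_0|lia].
Qed.

Lemma norm_upto_spow (u : nat -> C) (B : R) (n K : nat) :
  norm_upto u K <= B -> norm_upto (spow u n) K <= B ^ n.
Proof.
  intro h. induction n as [|n IH]; simpl.
  - rewrite norm_upto_sone. lra.
  - apply Rle_trans with (1 := norm_upto_sconv _ _ _).
    apply Rmult_le_compat; auto using norm_upto_nonneg.
Qed.

Lemma abs_summable_of_bound (u : nat -> C) (B : R) :
  (forall K, norm_upto u K <= B) -> abs_summable u.
Proof. intro h. apply ex_series_of_bound with B; [intro; apply Cmod_ge_0|exact h]. Qed.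

Lemma norm_upto_le_Series (u : nat -> C) (K : nat) :
  abs_summable u -> norm_upto u K <= Series (fun k => Cmod (u k)).
Proof. intro h. apply sum_n_le_Series; [intro; apply Cmod_ge_0|exact h]. Qed.

Lemma summable_term_le (u : nat -> C) (k : nat) :
  abs_summable u -> Cmod (u k) <= Series (fun k => Cmod (u k)).
Proof.
  intro hu. apply Rle_trans with (norm_upto u k); [|now apply norm_upto_le_Series].
  destruct k as [|k]; unfold norm_upto; [rewrite sum_O; lra|].
  rewrite sum_n_Rsucc. generalize (norm_upto_nonneg u k). unfold norm_upto. lra.
Qed.

Lemma abs_summable_spow (u : nat -> C) (n : nat) :
  abs_summable u -> abs_summable (spow u n).
Proof.
  intro hu. eapply abs_summable_of_bound. intro K.
  apply norm_upto_spow, norm_upto_le_Series, hu.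
Qed.

Lemma abs_summable_dom (u : nat -> C) (M : nat -> R) :
  (forall k, Cmod (u k) <= M k) -> ex_series M -> abs_summable u.
Proof.
  intros h hM. apply ex_series_dom with M; [|assumption].
  intro k. rewrite Rabs_pos_eq; [apply h|apply Cmod_ge_0].
Qed.

Lemma abs_summable_sadd (u v : nat -> C) :
  abs_summable u -> abs_summable v -> abs_summable (sadd u v).
Proof.
  intros hu hv. apply abs_summable_dom with (fun k => Cmod (u k) + Cmod (v k)).
  - intro. apply Cmod_triangle.
  - exact (ex_series_plus _ _ hu hv).
Qed.

Lemma abs_summable_sscal (c : C) (u : nat -> C) :
  abs_summable u -> abs_summable (sscal c u).
Proof.
  intros hu. apply abs_summable_dom with (fun k => Cmod c * Cmod (u k)).
  - intro. unfold sscal. rewrite Cmod_mult. lra.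
  - exact (ex_series_scal_l (Cmod c) _ hu).
Qed.

Lemma pow_le_1 (x : R) (n : nat) : 0 <= x <= 1 -> 0 <= x ^ n <= 1.
Proof.
  intro hx. split; [now apply pow_le|].
  rewrite <- (pow1 n). now apply pow_incr.
Qed.

Lemma abs_summable_dilate (u : nat -> C) (z : C) :
  Cmod z <= 1 -> abs_summable u -> abs_summable (dilate z u).
Proof.
  intros hz hu. apply abs_summable_dom with (2 := hu).
  intro k. unfold dilate. rewrite Cmod_mult, Cmod_pow.
  rewrite <- (Rmult_1_r (Cmod (u k))) at 2.
  apply Rmult_le_compat_l; [apply Cmod_ge_0|].
  apply pow_le_1. split; [apply Cmod_ge_0|assumption].
Qed.

(** * Sums of absolutely convergent complex series *)

Definition CSeries (u : nat -> C) : C :=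
  (Series (fun k => Re (u k)), Series (fun k => Im (u k))).

Lemma im_le_Cmod (z : C) : Rabs (Im z) <= Cmod z.
Proof. apply Rle_trans with (2 := Rmax_Cmod z). apply Rmax_r. Qed.

Lemma abs_summable_Re_abs (u : nat -> C) :
  abs_summable u -> ex_series (fun k => Rabs (Re (u k))).
Proof.
  apply ex_series_dom. intro k. rewrite Rabs_Rabsolu. apply re_le_Cmod.
Qed.

Lemma abs_summable_Im_abs (u : nat -> C) :
  abs_summable u -> ex_series (fun k => Rabs (Im (u k))).
Proof.
  apply ex_series_dom. intro k. rewrite Rabs_Rabsolu. apply im_le_Cmod.
Qed.

Lemma abs_summable_Re (u : nat -> C) :
  abs_summable u -> ex_series (fun k => Re (u k)).
Proof. intro h. now apply ex_series_Rabs, abs_summable_Re_abs. Qed.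

Lemma abs_summable_Im (u : nat -> C) :
  abs_summable u -> ex_series (fun k => Im (u k)).
Proof. intro h. now apply ex_series_Rabs, abs_summable_Im_abs. Qed.

Lemma CSeries_sadd (u v : nat -> C) :
  abs_summable u -> abs_summable v ->
  CSeries (sadd u v) = (CSeries u + CSeries v)%C.
Proof.
  intros hu hv. unfold CSeries, Cplus. simpl.
  rewrite <- !Series_plus by auto using abs_summable_Re, abs_summable_Im.
  reflexivity.
Qed.

Lemma CSeries_sscal (c : C) (u : nat -> C) :
  abs_summable u -> CSeries (sscal c u) = (c * CSeries u)%C.
Proof.
  intros hu. assert (h1 := abs_summable_Re u hu). assert (h2 := abs_summable_Im u hu).
  destruct c as [a b]. unfold CSeries, Cmult. simpl.
  assert (hs : forall (r : R) x, ex_series x -> ex_series (fun k => r * x k))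
    by (intros r x; exact (ex_series_scal_l r x)).
  rewrite <- !Series_scal_l, <- Series_minus, <- Series_plus by auto.
  reflexivity.
Qed.

Lemma Cmod_CSeries_le (u : nat -> C) :
  abs_summable u -> Cmod (CSeries u) <= Series (fun k => Cmod (u k)).
Proof.
  intro hu. set (s := CSeries u). set (A := Series _).
  assert (hA : 0 <= A) by (apply Series_nonneg; [intro; apply Cmod_ge_0|exact hu]).
  destruct (Req_dec (Cmod s) 0) as [h0|h0]; [lra|].
  assert (hs : 0 < Cmod s) by (generalize (Cmod_ge_0 s); lra).
  apply Rmult_le_reg_l with (1 := hs).
  (* rotate so that the sum becomes real: conj s * s = |s|^2 *)
  assert (hrot : Re (CSeries (sscal (Cconj s) u)) = Cmod s * Cmod s).
  { rewrite CSeries_sscal by assumption. fold s.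
    replace (Cmod s * Cmod s) with (Cmod s ^ 2) by ring. rewrite Cmod2_alt.
    destruct s as [x y]. unfold Cconj, Cmult, Re, Im. simpl. ring. }
  rewrite <- hrot. unfold A.
  change (Re (CSeries (sscal (Cconj s) u)))
    with (Series (fun k => Re (sscal (Cconj s) u k))).
  rewrite <- Series_scal_l.
  apply Rle_trans with (1 := Rle_abs _).
  apply Rle_trans with (1 := Series_Rabs _ (abs_summable_Re_abs _ (abs_summable_sscal _ _ hu))).
  apply Series_le; [|exact (ex_series_scal_l (Cmod s) _ hu)].
  intro k. split; [apply Rabs_pos|]. apply Rle_trans with (1 := re_le_Cmod _).
  unfold sscal. rewrite Cmod_mult, Cmod_conj. lra.
Qed.

Lemma CSeries_sconv (u v : nat -> C) :
  abs_summable u -> abs_summable v ->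
  CSeries (sconv u v) = (CSeries u * CSeries v)%C.
Proof.
  intros hu hv.
  assert (P : forall x y : nat -> R,
    ex_series (fun k => Rabs (x k)) -> ex_series (fun k => Rabs (y k)) ->
    is_series (conv x y) (Series x * Series y)).
  { intros x y hx hy.
    apply is_series_ext with (fun n => sum_f_R0 (fun k => x k * y (n - k)%nat) n).
    - intro n. unfold conv. now rewrite sum_n_Reals.
    - apply is_series_mult; auto using Series_correct, ex_series_Rabs. }
  assert (r1 := abs_summable_Re_abs u hu). assert (i1 := abs_summable_Im_abs u hu).
  assert (r2 := abs_summable_Re_abs v hv). assert (i2 := abs_summable_Im_abs v hv).
  assert (eR : forall n, Re (sconv u v n)
    = conv (fun k => Re (u k)) (fun k => Re (v k)) n
      - conv (fun k => Im (u k)) (fun k => Im (v k)) n).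
  { intro n. unfold sconv, conv. rewrite Re_sum_n. unfold Rminus.
    replace (- sum_n (fun j => Im (u j) * Im (v (n - j)%nat)) n)
      with (-1 * sum_n (fun j => Im (u j) * Im (v (n - j)%nat)) n) by ring.
    rewrite <- sum_n_Rmult_l, <- sum_n_Rplus. apply sum_n_Rext. intros j _. unfold Re, Im. simpl. ring. }
  assert (eI : forall n, Im (sconv u v n)
    = conv (fun k => Re (u k)) (fun k => Im (v k)) n
      + conv (fun k => Im (u k)) (fun k => Re (v k)) n).
  { intro n. unfold sconv, conv. rewrite Im_sum_n.
    rewrite <- sum_n_Rplus. apply sum_n_Rext. intros j _. unfold Re, Im. simpl. ring. }
  apply injective_projections; apply is_series_unique.
  - apply is_series_ext with (2 := is_series_minus _ _ _ _ (P _ _ r1 r2) (P _ _ i1 i2)).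
    intro n. symmetry. apply eR.
  - apply is_series_ext with (2 := is_series_plus _ _ _ _ (P _ _ r1 i2) (P _ _ i1 r2)).
    intro n. symmetry. apply eI.
Qed.

Lemma CSeries_sone : CSeries sone = RtoC 1.
Proof.
  assert (h : forall x : R, is_series (fun k => match k with O => x | S _ => 0 end) x).
  { intro x. apply filterlim_ext with (fun _ : nat => x); [|apply filterlim_const].
    assert (e : forall n, x = sum_n (fun k => match k with O => x | S _ => 0 end) n :> R).
    { induction n as [|n IH]; [now rewrite sum_O|]. rewrite sum_n_Rsucc, <- IH. ring. }
    exact e. }
  unfold CSeries, RtoC. f_equal; apply is_series_unique.
  - apply is_series_ext with (2 := h 1). intros [|k]; reflexivity.
  - apply is_series_ext with (2 := h 0). intros [|k]; reflexivity.
Qed.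

Lemma CSeries_spow (u : nat -> C) (n : nat) :
  abs_summable u -> CSeries (spow u n) = (CSeries u ^ n)%C.
Proof.
  intro hu. induction n as [|n IH]; [apply CSeries_sone|].
  simpl. rewrite CSeries_sconv, IH; auto using abs_summable_spow.
Qed.

Lemma Cmod_CSeries_tail (u : nat -> C) (K : nat) :
  abs_summable u ->
  Cmod (CSeries u - sum_n u K) <= Series (fun k => Cmod (u k)) - norm_upto u K.
Proof.
  intro hu.
  assert (hsh : abs_summable (fun k => u (S K + k)%nat)).
  { unfold abs_summable in *.
    exact (proj1 (ex_series_incr_n (fun k => Cmod (u k)) (S K)) hu). }
  assert (e : CSeries u = (sum_n u K + CSeries (fun k => u (S K + k)%nat))%C).
  { unfold CSeries at 1.
    rewrite (Series_incr_n (fun k => Re (u k)) (S K)), (Series_incr_n (fun k => Im (u k)) (S K))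
      by (lia || auto using abs_summable_Re, abs_summable_Im).
    simpl Init.Nat.pred. rewrite <- !sum_n_Reals, <- Re_sum_n, <- Im_sum_n. reflexivity. }
  rewrite e. unfold norm_upto.
  rewrite (Series_incr_n (fun k => Cmod (u k)) (S K)) by (lia || exact hu).
  simpl Init.Nat.pred. rewrite <- sum_n_Reals.
  replace (sum_n u K + _ - sum_n u K)%C with (CSeries (fun k => u (S K + k)%nat)) by ring.
  apply Rle_trans with (1 := Cmod_CSeries_le _ hsh). right. ring.
Qed.

(** * Cauchy's coefficient estimate on the unit circle *)

Definition cis (x : R) : C := (cos x, sin x).

Lemma cis_plus (x y : R) : cis (x + y) = (cis x * cis y)%C.
Proof.
  unfold cis, Cmult. simpl. rewrite cos_plus, sin_plus. f_equal; ring.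
Qed.

Lemma cis_0 : cis 0 = RtoC 1.
Proof. unfold cis. now rewrite cos_0, sin_0. Qed.

Lemma cis_pow (x : R) (n : nat) : (cis x ^ n)%C = cis (INR n * x).
Proof.
  induction n as [|n IH].
  - simpl. now rewrite Rmult_0_l, cis_0.
  - rewrite S_INR, Rmult_plus_distr_r, Rmult_1_l, Rplus_comm, cis_plus, <- IH.
    reflexivity.
Qed.

Lemma Cmod_cis (x : R) : Cmod (cis x) = 1.
Proof.
  unfold Cmod, cis, fst, snd.
  replace (cos x ^ 2 + sin x ^ 2) with 1; [apply sqrt_1|].
  generalize (sin2_cos2 x). unfold Rsqr. lra.
Qed.

Lemma cis_2PI : cis (2 * PI) = RtoC 1.
Proof. unfold cis. now rewrite cos_2PI, sin_2PI. Qed.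

Lemma cis_eq_1 (x : R) : cis (2 * x) = RtoC 1 -> exists k : Z, x = IZR k * PI.
Proof.
  intro h. apply sin_eq_0_0.
  assert (hc : cos (2 * x) = 1) by (injection h; auto).
  rewrite cos_2a_sin in hc. nra.
Qed.

Lemma sum_n_geometric (x : C) (n : nat) :
  ((x - 1) * sum_n (fun j => x ^ j) n)%C = (x ^ S n - 1)%C.
Proof.
  induction n as [|n IH]; [rewrite sum_O; simpl; ring|].
  rewrite sum_n_Csucc, Cmult_plus_distr_l, IH. simpl. ring.
Qed.

Lemma sum_n_single (u : nat -> C) (k n : nat) :
  (k <= n)%nat -> (forall m, (m <= n)%nat -> m <> k -> u m = RtoC 0) ->
  sum_n u n = u k :> C.
Proof.
  assert (zeros : forall m, (forall i, (i <= m)%nat -> u i = RtoC 0) ->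
            sum_n u m = RtoC 0 :> C).
  { intros m h. rewrite (sum_n_Cext _ (fun i => RtoC 0 * u i)%C).
    - rewrite sum_n_Cmult_l. ring.
    - intros i hi. rewrite (h i hi). ring. }
  intros hk h. induction n as [|n IH].
  - replace k with 0%nat by lia. apply sum_O.
  - rewrite sum_n_Csucc. destruct (Nat.eq_dec k (S n)) as [->|hne].
    + rewrite zeros; [ring|]. intros i hi. apply h; lia.
    + rewrite IH, (h (S n)); [ring|lia|lia|lia|]. intros; apply h; lia.
Qed.

(** Orthogonality of the characters [j |-> x ^ (j m)]: with [S K] roots of unity
    no other exponent below [S K] is congruent to [k], so a polynomial needs no
    limit of Riemann sums. *)
Lemma roots_of_unity_average (u : nat -> C) (k K : nat) :
  (k <= K)%nat ->
  let th := 2 * PI / INR (S K) in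
  (INR (S K) * u k)%C =
  sum_n (fun j => cis (INR j * th) ^ (S K - k)
                  * sum_n (fun m => u m * cis (INR j * th) ^ m) K)%C K.
Proof.
  intros hk th.
  assert (hN : 0 < INR (S K)) by (apply lt_0_INR; lia).
  rewrite (sum_n_Cext _ (fun j => sum_n (fun m =>
      u m * cis (INR (m + (S K - k)) * th) ^ j)%C K)).
  2:{ intros j _. rewrite <- sum_n_Cmult_l. apply sum_n_Cext. intros m _.
      rewrite !cis_pow. rewrite Cmult_comm, <- Cmult_assoc, <- cis_plus.
      do 2 f_equal. rewrite plus_INR. ring. }
  rewrite sum_n_switch.
  rewrite (sum_n_Cext _ (fun m =>
      u m * sum_n (fun j => cis (INR (m + (S K - k)) * th) ^ j) K)%C).
  2:{ intros m _. apply sum_n_Cmult_l. }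
  rewrite (sum_n_single _ k K hk).
  - replace (k + (S K - k))%nat with (S K) by lia.
    replace (INR (S K) * th) with (2 * PI) by (unfold th; field; lra).
    rewrite cis_2PI, (sum_n_Cext _ (fun j => RtoC 1)).
    2:{ intros j _. apply Cpow_1_l. }
    assert (e : forall n, sum_n (fun _ => RtoC 1) n = RtoC (INR (S n)) :> C).
    { induction n as [|n IH]; [now rewrite sum_O|].
      rewrite sum_n_Csucc, IH, (S_INR (S n)), RtoC_plus. reflexivity. }
    rewrite e. ring.
  - intros m hm hne. set (l := (m + (S K - k))%nat).
    assert (hx1 : (cis (INR l * th) - 1)%C <> RtoC 0).
    { intro e. assert (e1 : cis (INR l * th) = RtoC 1).
      { replace (cis (INR l * th)) with (cis (INR l * th) - 1 + 1)%C by ring. rewrite e. ring. }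
      replace (INR l * th) with (2 * (INR l * PI / INR (S K))) in e1
        by (unfold th; field; lra).
      destruct (cis_eq_1 _ e1) as [z hz].
      assert (hp := PI_RGT_0).
      assert (hl : INR l = IZR z * INR (S K)).
      { apply Rmult_eq_reg_r with PI; [|lra].
        replace (INR l * PI) with (INR l * PI / INR (S K) * INR (S K)) by (field; lra).
        rewrite hz. ring. }
      rewrite !INR_IZR_INZ, <- mult_IZR in hl. apply eq_IZR in hl.
      assert (hl0 : (0 < l < 2 * S K)%nat) by (unfold l; lia).
      assert (hl1 : l <> S K) by (unfold l; lia).
      destruct (Z.lt_trichotomy z 1) as [hz1|[->|hz1]]; nia. }
    assert (hg := sum_n_geometric (cis (INR l * th)) K).
    assert (hpow : (cis (INR l * th) ^ S K)%C = RtoC 1).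
    { rewrite cis_pow. replace (INR (S K) * (INR l * th)) with (INR l * (2 * PI))
        by (unfold th; field; lra).
      rewrite <- cis_pow, cis_2PI. apply Cpow_1_l. }
    rewrite hpow in hg.
    replace (sum_n (fun j => (cis (INR l * th) ^ j)%C) K) with (RtoC 0); [ring|].
    transitivity (/ (cis (INR l * th) - 1) * (1 - 1))%C; [ring|].
    rewrite <- hg. now field.
Qed.

Lemma Cauchy_coefficient_bound (u : nat -> C) (M : R) (k : nat) :
  abs_summable u ->
  (forall x : R, Cmod (CSeries (dilate (cis x) u)) <= M) ->
  Cmod (u k) <= M.
Proof.
  intros hu hM. apply le_epsilon. intros eps he.
  (* truncate so far out that the polynomial is within eps of the series *)
  assert (htail : exists K, (k <= K)%nat /\
            Series (fun k => Cmod (u k)) - norm_upto u K <= eps).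
  { assert (hl : is_lim_seq (norm_upto u) (Series (fun k => Cmod (u k))))
      by exact (Series_correct _ hu).
    apply is_lim_seq_spec in hl. destruct (hl (mkposreal eps he)) as [K0 hK0].
    exists (Nat.max k K0). split; [lia|].
    assert (h := hK0 (Nat.max k K0) ltac:(lia)). simpl in h.
    apply Rabs_lt_between in h. lra. }
  destruct htail as [K [hk htail]].
  assert (hN : 0 < INR (S K)) by (apply lt_0_INR; lia).
  apply Rmult_le_reg_l with (1 := hN).
  replace (INR (S K) * Cmod (u k)) with (Cmod (INR (S K) * u k)%C).
  2:{ rewrite Cmod_mult, Cmod_R, Rabs_pos_eq; lra. }
  rewrite (roots_of_unity_average u k K hk).
  apply Rle_trans with (1 := Cmod_sum_n_le _ _).
  rewrite <- sum_n_const. apply sum_n_le_loc. intros j _.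
  rewrite Cmod_mult, Cmod_pow, Cmod_cis, pow1, Rmult_1_l.
  set (x := INR j * _). set (T := sum_n _ _).
  assert (hd : abs_summable (dilate (cis x) u)).
  { apply abs_summable_dilate; [rewrite Cmod_cis; lra|assumption]. }
  assert (hdiff := Cmod_CSeries_tail (dilate (cis x) u) K hd).
  assert (hmod : forall n, Cmod (dilate (cis x) u n) = Cmod (u n)).
  { intro n. unfold dilate. rewrite Cmod_mult, Cmod_pow, Cmod_cis, pow1. ring. }
  rewrite (Series_ext _ _ hmod) in hdiff.
  assert (en : norm_upto (dilate (cis x) u) K = norm_upto u K).
  { apply sum_n_Rext. intros; apply hmod. }
  rewrite en in hdiff. change (sum_n (dilate (cis x) u) K) with T in hdiff.
  replace T with (CSeries (dilate (cis x) u) - (CSeries (dilate (cis x) u) - T))%C by ring.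
  apply Rle_trans with (1 := Cmod_triangle _ _). rewrite Cmod_opp.
  generalize (hM x). lra.
Qed.

(** * Wiener's lemma for power series on the closed disk *)

(** The finite Neumann expansion [X = G + T G + ... + T ^ m X]: with [T ^ m] of
    norm at most [1 / 2], the remainder can be absorbed on the left even though
    [T] itself may be large. *)
Lemma geometric_iterate (X G T : nat -> C) (m : nat) :
  X = sadd G (sconv T X) ->
  exists S, X = sadd S (sconv (spow T m) X) /\
    forall (K : nat) (B : R), (forall n, norm_upto (spow T n) K <= B) ->
      norm_upto S K <= INR m * (B * norm_upto G K).
Proof.
  intro h. induction m as [|m [S [e hS]]].
  - exists szero. split; [simpl; ring|]. intros K B _. simpl INR. rewrite Rmult_0_l.
    unfold norm_upto, szero. rewrite Cmod_0, sum_n_const. lra.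
  - exists (sadd S (sconv (spow T m) G)). split.
    + rewrite e at 1. rewrite h at 1. simpl. ring.
    + intros K B hB. rewrite S_INR, Rmult_plus_distr_r, Rmult_1_l.
      apply Rle_trans with (1 := norm_upto_sadd _ _ _).
      apply Rplus_le_compat; [now apply hS|].
      apply Rle_trans with (1 := norm_upto_sconv _ _ _).
      apply Rmult_le_compat_r; [apply norm_upto_nonneg|apply hB].
Qed.

(** The constant [B] may be huge; what matters is the ratio [1 / d], which does
    not degrade when the radius [s] grows. *)
Definition bounded_powers (g : nat -> C) (d s : R) : Prop :=
  exists B, 0 <= B /\ forall n K, norm_upto (dilate s (spow g n)) K <= B * / d ^ n.

(** Where [1 / f] is absolutely summable, the Cauchy estimate turns the lower
    bound [d] for [|f|] into geometric growth of the powers of [1 / f], with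
    the sharp ratio [1 / d], on every smaller circle. *)
Lemma bounded_powers_of_summable (f g : nat -> C) (d s r : R) :
  abs_summable f -> sconv f g = sone -> 0 < d ->
  (forall z, Cmod z < 1 -> d <= Cmod (CSeries (dilate z f))) ->
  0 <= s < r -> r < 1 -> abs_summable (dilate r g) ->
  bounded_powers g d s.
Proof.
  intros hf hfg hd hlow hs hr hg.
  set (q := s / r).
  assert (hq : 0 <= q < 1).
  { unfold q. split; [apply Rmult_le_pos; [lra|left; apply Rinv_0_lt_compat; lra]|].
    apply Rmult_lt_reg_r with r; [lra|]. unfold Rdiv. rewrite Rmult_assoc, Rinv_l; lra. }
  assert (hcoef : forall n k, Cmod (dilate r (spow g n) k) <= / d ^ n).
  { intros n k. rewrite dilate_spow. apply Cauchy_coefficient_bound.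
    - now apply abs_summable_spow.
    - intro x. assert (hx : Cmod (cis x) <= 1) by (rewrite Cmod_cis; lra).
      rewrite dilate_spow, CSeries_spow, Cmod_pow, <- pow_inv by now apply abs_summable_dilate.
      apply pow_incr. split; [apply Cmod_ge_0|].
      rewrite dilate_dilate. set (z := (r * cis x)%C).
      assert (hz : Cmod z < 1).
      { unfold z. rewrite Cmod_mult, Cmod_cis, Cmod_R, Rabs_pos_eq; lra. }
      assert (hgz : abs_summable (dilate z g)).
      { unfold z. rewrite <- dilate_dilate. now apply abs_summable_dilate. }
      assert (hprod : (CSeries (dilate z f) * CSeries (dilate z g))%C = RtoC 1).
      { rewrite <- CSeries_sconv, <- dilate_sconv, hfg, dilate_sone; [apply CSeries_sone| |exact hgz].
        apply abs_summable_dilate; [lra|assumption]. }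
      assert (hm : Cmod (CSeries (dilate z f)) * Cmod (CSeries (dilate z g)) = 1).
      { rewrite <- Cmod_mult, hprod. apply Cmod_1. }
      assert (hl := hlow z hz). assert (h0 := Cmod_ge_0 (CSeries (dilate z g))).
      apply Rmult_le_reg_l with (1 := hd). rewrite Rinv_r by lra. nra. }
  exists (/ (1 - q)). split; [left; apply Rinv_0_lt_compat; lra|].
  intros n K.
  assert (hd' : 0 < / d ^ n) by (apply Rinv_0_lt_compat, pow_lt; assumption).
  apply Rle_trans with (sum_n (fun k => / d ^ n * q ^ k) K).
  - apply sum_n_le_loc. intros k _.
    replace (dilate s (spow g n) k) with (dilate r (spow g n) k * RtoC (q ^ k))%C.
    + rewrite Cmod_mult, Cmod_R, Rabs_pos_eq by (apply pow_le; lra).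
      apply Rmult_le_compat_r; [apply pow_le; lra|apply hcoef].
    + unfold dilate. rewrite <- !RtoC_pow, <- Cmult_assoc, <- RtoC_mult, <- Rpow_mult_distr.
      do 3 f_equal. unfold q. field. lra.
  - rewrite sum_n_Rmult_l, Rmult_comm. apply Rmult_le_compat_r; [lra|].
    rewrite <- Series_geom by (rewrite Rabs_pos_eq; lra).
    apply sum_n_le_Series; [intro; apply pow_le; lra|].
    exists (/ (1 - q)). apply is_series_geom. rewrite Rabs_pos_eq; lra.
Qed.

(** Newman's step: near the circle of radius [s], [1 / f] is a Neumann series
    in the powers of [1 / f] on that circle, whose terms [(G E) ^ m] decay
    because [|E| <= d / 2] beats the growth [d ^ (- m)] of [G ^ m].  The
    constant [B] has no influence on how far the radius may grow. *)
Lemma summable_of_bounded_powers (f g : nat -> C) (d s r : R) :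
  sconv f g = sone -> 0 < d -> bounded_powers g d s ->
  (forall K, norm_upto (ssub (dilate s f) (dilate r f)) K <= d / 2) ->
  abs_summable (dilate r g).
Proof.
  intros hfg hd [B [hB0 hB]] hE.
  set (G := dilate s g). set (X := dilate r g).
  set (E := ssub (dilate s f) (dilate r f)) in *. set (T := sconv G E).
  assert (e1 : sconv (dilate s f) G = sone).
  { unfold G. now rewrite <- dilate_sconv, hfg, dilate_sone. }
  assert (e2 : sconv (dilate r f) X = sone).
  { unfold X. now rewrite <- dilate_sconv, hfg, dilate_sone. }
  assert (hX : X = sadd G (sconv T X)).
  { transitivity (sconv (sconv (dilate s f) G) X); [rewrite e1; ring|].
    transitivity (sadd (sconv G (sconv (dilate r f) X)) (sconv T X)).
    - unfold T, E. ring.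
    - rewrite e2. ring. }
  assert (hT : forall n K, norm_upto (spow T n) K <= B * (/ 2) ^ n).
  { intros n K. unfold T. rewrite spow_sconv.
    apply Rle_trans with (1 := norm_upto_sconv _ _ _).
    unfold G. rewrite <- dilate_spow.
    apply Rle_trans with ((B * / d ^ n) * (d / 2) ^ n).
    - apply Rmult_le_compat; try apply norm_upto_nonneg; [apply hB|].
      apply norm_upto_spow, hE.
    - right. unfold Rdiv. rewrite Rpow_mult_distr. field. apply pow_nonzero. lra. }
  assert (hm : exists m, B * (/ 2) ^ m <= / 2).
  { destruct (pow_lt_1_zero (/ 2) ltac:(rewrite Rabs_pos_eq; lra) (/ (2 * (B + 1)))
      ltac:(apply Rinv_0_lt_compat; lra)) as [m hm].
    exists m. assert (h := hm m (Nat.le_refl m)).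
    rewrite Rabs_pos_eq in h by (apply pow_le; lra).
    apply Rle_trans with ((B + 1) * / (2 * (B + 1))).
    - apply Rmult_le_compat; try lra. apply pow_le; lra.
    - right. field. lra. }
  destruct hm as [m hm].
  destruct (geometric_iterate X G T m hX) as [S [eS hS]].
  apply abs_summable_of_bound with (2 * (INR m * (B * (B * / d ^ 1)))).
  intro K.
  assert (hTB : forall n, norm_upto (spow T n) K <= B).
  { intro n. apply Rle_trans with (1 := hT n K).
    rewrite <- (Rmult_1_r B) at 2. apply Rmult_le_compat_l; [assumption|].
    apply pow_le_1. lra. }
  assert (hGK : norm_upto G K <= B * / d ^ 1).
  { replace G with (dilate s (spow g 1)); [apply hB|].
    unfold G. simpl. f_equal. ring. }
  assert (hSK : norm_upto S K <= INR m * (B * (B * / d ^ 1))).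
  { apply Rle_trans with (1 := hS K B hTB).
    apply Rmult_le_compat_l; [apply pos_INR|]. now apply Rmult_le_compat_l. }
  assert (hXK : norm_upto X K <= norm_upto S K + / 2 * norm_upto X K).
  { rewrite eS at 1. apply Rle_trans with (1 := norm_upto_sadd _ _ _).
    apply Rplus_le_compat_l. apply Rle_trans with (1 := norm_upto_sconv _ _ _).
    apply Rmult_le_compat_r; [apply norm_upto_nonneg|].
    apply Rle_trans with (2 := hm). apply hT. }
  fold X. lra.
Qed.

Lemma pow_diff_bound (s r : R) (k : nat) :
  0 <= s <= r -> r <= 1 -> 0 <= r ^ k - s ^ k <= INR k * (r - s).
Proof.
  intros hs hr. induction k as [|k IH]; [simpl; lra|].
  rewrite S_INR. simpl.
  assert (h1 := pow_le_1 s k ltac:(lra)). assert (h2 := pow_le_1 r k ltac:(lra)).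
  replace (r * r ^ k - s * s ^ k) with (r * (r ^ k - s ^ k) + (r - s) * s ^ k) by ring.
  split; [apply Rplus_le_le_0_compat; apply Rmult_le_pos; lra|].
  rewrite Rmult_plus_distr_r, Rmult_1_l. apply Rplus_le_compat; nra.
Qed.

(** Provides a radius increment that is the same at every radius, so that
    finitely many of the steps above lead from [0] to [1]. *)
Lemma dilate_uniformly_continuous (f : nat -> C) (eta : R) :
  abs_summable f -> 0 < eta ->
  exists eps, 0 < eps /\ forall s r, 0 <= s <= r -> r <= 1 -> r - s <= eps ->
    forall K, norm_upto (ssub (dilate s f) (dilate r f)) K <= eta.
Proof.
  intros hf he.
  destruct (series_dominated_small (fun k => Cmod (f k)) eta
    ltac:(intro; apply Cmod_ge_0) hf he) as [K [e' [he' hdom]]].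
  set (F := Series (fun k => Cmod (f k))).
  assert (hF : 0 <= F) by (apply Series_nonneg; [intro; apply Cmod_ge_0|exact hf]).
  assert (hFk : forall k, Cmod (f k) <= F) by (intro; now apply summable_term_le).
  assert (hK := pos_INR K).
  assert (hden : 0 < (F + 1) * (INR K + 1)) by (apply Rmult_lt_0_compat; lra).
  exists (e' / ((F + 1) * (INR K + 1))). split; [now apply Rdiv_lt_0_compat|].
  intros s r hs hr hsr.
  assert (et : forall k, Cmod (ssub (dilate s f) (dilate r f) k)
                         = Cmod (f k) * (r ^ k - s ^ k)).
  { intro k. unfold ssub, dilate. rewrite <- !RtoC_pow.
    replace (f k * RtoC (s ^ k) - f k * RtoC (r ^ k))%C
      with (f k * RtoC (s ^ k - r ^ k))%C by (rewrite RtoC_minus; ring).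
    rewrite Cmod_mult, Cmod_R, Rabs_minus_sym, Rabs_pos_eq; [reflexivity|].
    now apply pow_diff_bound. }
  assert (hb : forall k, 0 <= Cmod (ssub (dilate s f) (dilate r f) k) <= Cmod (f k)).
  { intro k. rewrite et. assert (h1 := Cmod_ge_0 (f k)).
    assert (h2 := pow_diff_bound s r k hs hr).
    assert (h3 := pow_le_1 s k ltac:(lra)). assert (h4 := pow_le_1 r k ltac:(lra)).
    split; [apply Rmult_le_pos; lra|]. nra. }
  assert (hsum : abs_summable (ssub (dilate s f) (dilate r f)))
    by (apply abs_summable_dom with (2 := hf); intro; apply hb).
  intro N. apply Rle_trans with (1 := norm_upto_le_Series _ N hsum).
  apply hdom; [assumption|]. intros k hk. rewrite et.
  assert (h2 := pow_diff_bound s r k hs hr).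
  assert (hkK : INR k <= INR K) by (apply le_INR; lia).
  apply Rle_trans with ((F + 1) * ((INR K + 1) * (e' / ((F + 1) * (INR K + 1))))).
  - apply Rmult_le_compat; [apply Cmod_ge_0|lra|generalize (hFk k); lra|].
    apply Rle_trans with (1 := proj2 h2). apply Rmult_le_compat; try lra. apply pos_INR.
  - right. field. lra.
Qed.

(** Summability of the inverse propagates outwards from the radius [0] in steps
    of a fixed length: [bounded_powers] at a radius gives summability a little
    further out, which gives back [bounded_powers] just inside. *)
Theorem Wiener_power_series (f g : nat -> C) (d : R) :
  abs_summable f -> sconv f g = sone -> 0 < d ->
  (forall z, Cmod z < 1 -> d <= Cmod (CSeries (dilate z f))) ->
  abs_summable g.
Proof.
  intros hf hfg hd hlow.
  destruct (dilate_uniformly_continuous f (d / 2) hf ltac:(lra)) as [eps [he hE]].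
  assert (h0 : bounded_powers g d 0).
  { exists 1. split; [lra|]. intros n K. rewrite Rmult_1_l.
    assert (hf0 : d <= Cmod (f 0%nat)).
    { assert (h := hlow (RtoC 0) ltac:(rewrite Cmod_0; lra)).
      replace (dilate 0 f) with (sscal (f 0%nat) sone) in h.
      - rewrite CSeries_sscal, CSeries_sone, Cmult_1_r in h; [assumption|].
        apply abs_summable_of_bound with 1. intro. rewrite norm_upto_sone. lra.
      - apply functional_extensionality. intros [|k];
          unfold sscal, sone, dilate, delta_d; simpl; ring. }
    assert (hg0 : Cmod (g 0%nat) <= / d).
    { assert (e : Cmod (f 0%nat) * Cmod (g 0%nat) = 1).
      { rewrite <- Cmod_mult, <- sconv_0, hfg. unfold sone, delta_d. apply Cmod_1. }
      apply Rmult_le_reg_l with (1 := hd). rewrite Rinv_r by lra.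
      generalize (Cmod_ge_0 (g 0%nat)). nra. }
    apply Rle_trans with (norm_upto (sscal (g 0%nat ^ n)%C sone) K).
    - right. apply sum_n_Rext. intros [|k] _; unfold dilate, sscal, sone, delta_d.
      + f_equal. rewrite Cmult_1_r. simpl Cpow at 1. rewrite Cmult_1_r.
        induction n as [|n IH]; [reflexivity|]. simpl. now rewrite sconv_0, IH.
      + f_equal. simpl. ring.
    - apply Rle_trans with (Cmod (g 0%nat ^ n)%C * norm_upto sone K).
      + unfold norm_upto. rewrite <- sum_n_Rmult_l. apply sum_n_le_loc. intros.
        unfold sscal. rewrite Cmod_mult. lra.
      + rewrite norm_upto_sone, Rmult_1_r, Cmod_pow, <- pow_inv.
        apply pow_incr. split; [apply Cmod_ge_0|assumption]. }
  assert (step : forall s r, 0 <= s <= r -> r <= 1 -> r - s <= eps ->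
            bounded_powers g d s -> abs_summable (dilate r g)).
  { intros s r hs hr hsr hb. apply summable_of_bounded_powers with (f := f) (d := d) (s := s); auto. }
  assert (chain : forall i : nat, INR i * (eps / 2) < 1 -> bounded_powers g d (INR i * (eps / 2))).
  { induction i as [|i IH]; intro hi.
    - simpl INR. now rewrite Rmult_0_l.
    - rewrite S_INR in *. assert (hi0 := pos_INR i).
      assert (0 <= INR i * (eps / 2)) by (apply Rmult_le_pos; lra).
      set (s := INR i * (eps / 2)) in *.
      replace ((INR i + 1) * (eps / 2)) with (s + eps / 2) in * by (unfold s; ring).
      (* a radius strictly between the new one and min(1, s + eps) *)
      set (r := s + eps / 2 + Rmin (eps / 2) ((1 - (s + eps / 2)) / 2)).
      assert (hr1 := Rmin_l (eps / 2) ((1 - (s + eps / 2)) / 2)).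
      assert (hr2 := Rmin_r (eps / 2) ((1 - (s + eps / 2)) / 2)).
      assert (hr3 : 0 < Rmin (eps / 2) ((1 - (s + eps / 2)) / 2))
        by (apply Rmin_glb_lt; lra).
      apply bounded_powers_of_summable with (f := f) (r := r); auto; try (unfold r; lra).
      apply step with s; try (unfold r; lra). apply IH. lra. }
  destruct (nfloor_ex (1 / (eps / 2))) as [n [hn1 hn2]].
  { left. apply Rdiv_lt_0_compat; lra. }
  assert (hn3 : 1 < (INR n + 1) * (eps / 2)).
  { apply Rmult_lt_compat_r with (r := eps / 2) in hn2; [|lra].
    replace (1 / (eps / 2) * (eps / 2)) with 1 in hn2 by (field; lra). lra. }
  assert (hn4 : INR n * (eps / 2) <= 1).
  { apply Rmult_le_compat_r with (r := eps / 2) in hn1; [|lra].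
    replace (1 / (eps / 2) * (eps / 2)) with 1 in hn1 by (field; lra). lra. }
  assert (hlast : exists s, 0 <= s < 1 /\ 1 - s <= eps /\ bounded_powers g d s).
  { destruct (Req_dec (INR n * (eps / 2)) 1) as [e|e].
    - destruct n as [|n]; [simpl in e; lra|]. rewrite S_INR in e.
      exists (INR n * (eps / 2)). assert (hn0 := pos_INR n).
      repeat split; [apply Rmult_le_pos; lra|lra|lra|]. apply chain. lra.
    - exists (INR n * (eps / 2)). assert (hn0 := pos_INR n).
      repeat split; [apply Rmult_le_pos; lra|lra|lra|]. apply chain. lra. }
  destruct hlast as [s [hs [hs' hb]]].
  replace g with (dilate 1 g); [apply step with s; auto; lra|].
  apply functional_extensionality. intro k. unfold dilate. rewrite Cpow_1_l. ring.
Qed.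

(** * The binomial series *)

Fixpoint binomial_coef (w : C) (k : nat) : C :=
  match k with
  | O => RtoC 1
  | S m => (binomial_coef w m * ((INR m - w) / INR (S m)))%C
  end.

Lemma binomial_coef_succ (w : C) (k : nat) :
  (INR (S k) * binomial_coef w (S k) = (INR k - w) * binomial_coef w k)%C.
Proof.
  assert (h : RtoC (INR (S k)) <> RtoC 0).
  { intro e. apply RtoC_inj in e. revert e. apply not_0_INR. lia. }
  cbn [binomial_coef]. now field.
Qed.

(** Variation of constants for [X' = (p + i s) X] in real coordinates: the
    product with [exp (- P - i S)] has zero derivative. *)
Lemma polar_ode (X1 X2 P S p s : R -> R) :
  (forall t, 0 <= t <= 1 -> is_derive X1 t (p t * X1 t - s t * X2 t)) ->
  (forall t, 0 <= t <= 1 -> is_derive X2 t (s t * X1 t + p t * X2 t)) ->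
  (forall t, 0 <= t <= 1 -> is_derive P t (p t)) ->
  (forall t, 0 <= t <= 1 -> is_derive S t (s t)) ->
  P 0 = 0 -> S 0 = 0 -> X1 0 = 1 -> X2 0 = 0 ->
  X1 1 = exp (P 1) * cos (S 1) /\ X2 1 = exp (P 1) * sin (S 1).
Proof.
  intros h1 h2 hP hS p0 s0 x0 y0.
  set (Z1 := fun t => exp (- P t) * (X1 t * cos (S t) + X2 t * sin (S t))).
  set (Z2 := fun t => exp (- P t) * (X2 t * cos (S t) - X1 t * sin (S t))).
  assert (d1 : forall t, 0 <= t <= 1 -> is_derive Z1 t 0).
  { intros t ht. unfold Z1.
    assert (a1 := h1 t ht). assert (a2 := h2 t ht).
    assert (a3 := hP t ht). assert (a4 := hS t ht).
    auto_derive.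
    - repeat split; eexists; eassumption.
    - replace (Derive (fun x => X1 x) t) with (p t * X1 t - s t * X2 t)
        by (symmetry; now apply is_derive_unique).
      replace (Derive (fun x => X2 x) t) with (s t * X1 t + p t * X2 t)
        by (symmetry; now apply is_derive_unique).
      replace (Derive (fun x => P x) t) with (p t) by (symmetry; now apply is_derive_unique).
      replace (Derive (fun x => S x) t) with (s t) by (symmetry; now apply is_derive_unique).
      ring. }
  assert (d2 : forall t, 0 <= t <= 1 -> is_derive Z2 t 0).
  { intros t ht. unfold Z2.
    assert (a1 := h1 t ht). assert (a2 := h2 t ht).
    assert (a3 := hP t ht). assert (a4 := hS t ht).
    auto_derive.
    - repeat split; eexists; eassumption.
    - replace (Derive (fun x => X1 x) t) with (p t * X1 t - s t * X2 t)
        by (symmetry; now apply is_derive_unique).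
      replace (Derive (fun x => X2 x) t) with (s t * X1 t + p t * X2 t)
        by (symmetry; now apply is_derive_unique).
      replace (Derive (fun x => P x) t) with (p t) by (symmetry; now apply is_derive_unique).
      replace (Derive (fun x => S x) t) with (s t) by (symmetry; now apply is_derive_unique).
      ring. }
  assert (e1 : 1 = Z1 1).
  { rewrite <- (eq_is_derive Z1 0 1 d1 Rlt_0_1). unfold Z1.
    rewrite p0, s0, x0, y0, cos_0, sin_0, Ropp_0, exp_0. ring. }
  assert (e2 : 0 = Z2 1).
  { rewrite <- (eq_is_derive Z2 0 1 d2 Rlt_0_1). unfold Z2.
    rewrite p0, s0, x0, y0, cos_0, sin_0, Ropp_0, exp_0. ring. }
  unfold Z1 in e1. unfold Z2 in e2. rewrite exp_Ropp in e1, e2.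
  assert (hE := exp_pos (P 1)). assert (hcs := sin2_cos2 (S 1)). unfold Rsqr in hcs.
  set (E := exp (P 1)) in *. set (c := cos (S 1)) in *. set (q := sin (S 1)) in *.
  assert (f1 : X1 1 * c + X2 1 * q = E).
  { apply Rmult_eq_reg_l with (/ E); [rewrite <- e1; field; lra|].
    apply Rinv_neq_0_compat; lra. }
  assert (f2 : X2 1 * c - X1 1 * q = 0).
  { apply Rmult_eq_reg_l with (/ E); [rewrite <- e2; ring|].
    apply Rinv_neq_0_compat; lra. }
  split.
  - transitivity (X1 1 * (q * q + c * c)); [rewrite hcs; ring|].
    transitivity ((X1 1 * c + X2 1 * q) * c - (X2 1 * c - X1 1 * q) * q); [ring|].
    rewrite f1, f2. ring.
  - transitivity (X2 1 * (q * q + c * c)); [rewrite hcs; ring|].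
    transitivity ((X1 1 * c + X2 1 * q) * q + (X2 1 * c - X1 1 * q) * c); [ring|].
    rewrite f1, f2. ring.
Qed.

(** The room beyond [1] makes termwise differentiation available on all of
    [0 <= t <= 1]. *)
Lemma CV_radius_gt_1 (x : nat -> R) (M r t : R) :
  0 <= r < 1 -> (forall k, Rabs (x k) <= M * r ^ k) -> 0 <= t <= 1 ->
  Rbar_lt (Rabs t) (CV_radius x).
Proof.
  intros hr hx ht. rewrite Rabs_pos_eq by lra.
  apply Rbar_lt_le_trans with (Finite (2 / (1 + r))).
  - simpl. apply Rle_lt_trans with 1; [lra|].
    apply Rmult_lt_reg_r with (1 + r); [lra|]. unfold Rdiv.
    rewrite Rmult_assoc, Rinv_l; lra.
  - apply (CV_radius_bounded x). exists M. intro n.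
    assert (hp : 0 < 2 / (1 + r)) by (apply Rdiv_lt_0_compat; lra).
    rewrite Rabs_mult, (Rabs_pos_eq ((2 / (1 + r)) ^ n)) by (apply pow_le; lra).
    apply Rle_trans with (M * r ^ n * (2 / (1 + r)) ^ n).
    + apply Rmult_le_compat_r; [apply pow_le; lra|apply hx].
    + assert (hM : 0 <= M).
      { assert (h := hx 0%nat). generalize (Rabs_pos (x 0%nat)). simpl in h. lra. }
      rewrite Rmult_assoc, <- Rpow_mult_distr.
      apply Rle_trans with (M * 1); [|lra].
      apply Rmult_le_compat_l; [assumption|]. apply pow_le_1.
      split; [apply Rmult_le_pos; lra|].
      apply Rmult_le_reg_r with (1 + r); [lra|].
      replace (r * (2 / (1 + r)) * (1 + r)) with (2 * r) by (field; lra). lra.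
Qed.

Lemma abs_summable_of_parts (u : nat -> C) :
  ex_series (fun k => Rabs (Re (u k))) -> ex_series (fun k => Rabs (Im (u k))) ->
  abs_summable u.
Proof.
  intros h1 h2.
  apply abs_summable_dom with (fun k => Rabs (Re (u k)) + Rabs (Im (u k))).
  - intro k. replace (Cmod (u k)) with (Cmod (RtoC (Re (u k)) + Ci * RtoC (Im (u k)))%C).
    + apply Rle_trans with (1 := Cmod_triangle _ _).
      rewrite Cmod_mult, Cmod_Ci, !Cmod_R. lra.
    + f_equal. destruct (u k) as [x y]. unfold Ci, RtoC, Cplus, Cmult, Re, Im. simpl.
      f_equal; ring.
  - exact (ex_series_plus _ _ h1 h2).
Qed.

Lemma dilate_R_parts (t : R) (u : nat -> C) :
  CSeries (dilate t u)
  = (PSeries (fun k => Re (u k)) t, PSeries (fun k => Im (u k)) t).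
Proof.
  unfold CSeries, PSeries. f_equal; apply Series_ext; intro k;
    unfold dilate; rewrite <- RtoC_pow; destruct (u k) as [x y]; unfold Re, Im; simpl; ring.
Qed.

(** The generating function [Y] of the binomial coefficients satisfies
    [(1 - x) Y' = - w Y].  Along the segment from [0] to [z] this is a linear
    system with the solution [exp (w Log (1 - z))], [Log] the principal branch. *)
Lemma binomial_series (w z : C) (M : R) :
  (forall k, Cmod (binomial_coef w k) <= M) -> Cmod z < 1 ->
  let L := ln (Cmod (1 - z)) in
  let A := atan (Im (1 - z) / Re (1 - z)) in
  CSeries (dilate z (binomial_coef w))
  = (exp (Re w * L - Im w * A) * cis (Re w * A + Im w * L))%C.
Proof.
  intros hM hz.
  set (y := dilate z (binomial_coef w)).
  assert (hy : forall k, Cmod (y k) <= M * Cmod z ^ k).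
  { intro k. unfold y, dilate. rewrite Cmod_mult, Cmod_pow.
    apply Rmult_le_compat_r; [apply pow_le, Cmod_ge_0|apply hM]. }
  set (xr := fun k => Re (y k)). set (xi := fun k => Im (y k)).
  assert (hz0 := Cmod_ge_0 z).
  assert (hR : forall t, 0 <= t <= 1 -> Rbar_lt (Rabs t) (CV_radius xr)).
  { intros t ht. apply CV_radius_gt_1 with M (Cmod z); [lra| |assumption].
    intro k. apply Rle_trans with (2 := hy k). apply re_le_Cmod. }
  assert (hI : forall t, 0 <= t <= 1 -> Rbar_lt (Rabs t) (CV_radius xi)).
  { intros t ht. apply CV_radius_gt_1 with M (Cmod z); [lra| |assumption].
    intro k. apply Rle_trans with (2 := hy k). apply im_le_Cmod. }
  assert (hsum : forall (u : nat -> C) t,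
    Rbar_lt (Rabs t) (CV_radius (fun k => Re (u k))) ->
    Rbar_lt (Rabs t) (CV_radius (fun k => Im (u k))) -> abs_summable (dilate t u)).
  { intros u t h1 h2. apply abs_summable_of_parts.
    - eapply ex_series_ext; [|exact (CV_disk_inside _ _ h1)].
      intro k. unfold dilate. rewrite <- RtoC_pow. f_equal. unfold Re; simpl. ring.
    - eapply ex_series_ext; [|exact (CV_disk_inside _ _ h2)].
      intro k. unfold dilate. rewrite <- RtoC_pow. f_equal. unfold Im; simpl. ring. }
  set (dy := fun k => (INR (S k) * y (S k))%C).
  set (ky := fun k => (INR k * y k)%C).
  assert (edr : (fun k => Re (dy k)) = PS_derive xr).
  { apply functional_extensionality. intro k. unfold dy, PS_derive, xr, Re. simpl. ring. }
  assert (edi : (fun k => Im (dy k)) = PS_derive xi).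
  { apply functional_extensionality. intro k. unfold dy, PS_derive, xi, Im. simpl. ring. }
  assert (ekr : (fun k => Re (ky k)) = PS_incr_1 (PS_derive xr)).
  { apply functional_extensionality. intros [|k]; unfold ky, PS_incr_1, PS_derive, xr, Re; simpl.
    - unfold zero; simpl. ring.
    - ring. }
  assert (eki : (fun k => Im (ky k)) = PS_incr_1 (PS_derive xi)).
  { apply functional_extensionality. intros [|k]; unfold ky, PS_incr_1, PS_derive, xi, Im; simpl.
    - unfold zero; simpl. ring.
    - ring. }
  assert (hode : forall t : R, 0 <= t <= 1 ->
    ((1 - t * z) * CSeries (dilate t dy) = - (w * z) * CSeries (dilate t y))%C).
  { intros t ht.
    assert (sy : abs_summable (dilate t y)) by (apply hsum; [now apply hR|now apply hI]).
    assert (sk : abs_summable (dilate t ky)).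
    { apply hsum; [rewrite ekr|rewrite eki]; rewrite CV_radius_incr_1, CV_radius_derive;
        [now apply hR|now apply hI]. }
    assert (ek : CSeries (dilate t ky) = (t * CSeries (dilate t dy))%C).
    { rewrite !dilate_R_parts, ekr, eki, edr, edi, !PSeries_incr_1.
      unfold Cmult, RtoC. simpl. f_equal; ring. }
    assert (e : dilate t dy = sadd (sscal z (dilate t ky)) (sscal (- (w * z))%C (dilate t y))).
    { apply functional_extensionality. intro k. unfold dilate at 1, dy, sadd, sscal.
      unfold y at 1, dilate at 1. rewrite Cmult_assoc, binomial_coef_succ.
      unfold ky, y, dilate. simpl. ring. }
    assert (e' := CSeries_sadd _ _ (abs_summable_sscal z _ sk) (abs_summable_sscal (- (w * z))%C _ sy)).
    rewrite <- e, !CSeries_sscal, ek in e' by assumption.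
    set (dY := CSeries (dilate t dy)) in *. set (Y := CSeries (dilate t y)) in *.
    transitivity (dY - z * (t * dY))%C; [ring|]. rewrite e' at 1. ring. }
  destruct w as [u v]. destruct z as [a b].
  assert (hab : a * a + b * b < 1).
  { unfold Cmod in hz. simpl in hz.
    apply Rsqr_incrst_1 in hz; [|apply sqrt_pos|lra].
    rewrite Rsqr_sqrt in hz by nra. unfold Rsqr in hz. nra. }
  assert (ha : a < 1) by nra.
  set (D := fun t => (1 - t * a) ^ 2 + (t * b) ^ 2).
  assert (h1ta : forall t, 0 <= t <= 1 -> 0 < 1 - t * a).
  { intros t ht. assert (0 <= t * (1 - a)) by (apply Rmult_le_pos; lra).
    destruct (Req_dec t 1) as [->|]; lra. }
  assert (hD : forall t, 0 <= t <= 1 -> 0 < D t).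
  { intros t ht. unfold D. assert (h := h1ta t ht).
    apply Rplus_lt_le_0_compat; [now apply pow_lt|apply pow2_ge_0]. }
  set (l := fun t => ln (D t) / 2). set (th := fun t => atan (- (t * b) / (1 - t * a))).
  set (l' := fun t => (t * (a * a + b * b) - a) / D t). set (th' := fun t => - b / D t).
  assert (hl : forall t, 0 <= t <= 1 -> is_derive l t (l' t)).
  { intros t ht. assert (h := hD t ht). unfold l, l', D in *. auto_derive; [nra|].
    field. nra. }
  assert (hth : forall t, 0 <= t <= 1 -> is_derive th t (th' t)).
  { intros t ht. assert (h := h1ta t ht). assert (h' := hD t ht).
    unfold th, th', D in *. auto_derive; [lra|]. unfold Rsqr. field. split; [|lra]. nra. }
  destruct (polar_ode (PSeries xr) (PSeries xi)
    (fun t => u * l t - v * th t) (fun t => u * th t + v * l t)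
    (fun t => u * l' t - v * th' t) (fun t => u * th' t + v * l' t)) as [e1 e2].
  - intros t ht. assert (hd := is_derive_PSeries xr t (hR t ht)).
    assert (ho := hode t ht). rewrite !dilate_R_parts, edr, edi in ho.
    fold xr in ho. fold xi in ho.
    set (D1 := PSeries (PS_derive xr) t) in *. set (D2 := PSeries (PS_derive xi) t) in *.
    set (Y1 := PSeries xr t) in *. set (Y2 := PSeries xi t) in *.
    unfold Cmult, Cminus, Cplus, Copp, RtoC in ho. simpl in ho. injection ho as ho1 ho2.
    replace ((u * l' t - v * th' t) * Y1 - (u * th' t + v * l' t) * Y2) with D1; [exact hd|].
    assert (h := hD t ht). apply Rmult_eq_reg_r with (D t); [|lra].
    replace (((u * l' t - v * th' t) * Y1 - (u * th' t + v * l' t) * Y2) * D t)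
      with ((u * (t * (a * a + b * b) - a) + v * b) * Y1
            - (- u * b + v * (t * (a * a + b * b) - a)) * Y2)
      by (unfold l', th'; field; lra).
    unfold D.
    transitivity ((1 - t * a) * ((1 - t * a) * D1 + t * b * D2)
                  - t * b * ((1 - t * a) * D2 - t * b * D1)); [ring|].
    replace ((1 - t * a) * D1 + t * b * D2) with (- (u * a - v * b) * Y1 + (u * b + v * a) * Y2) by lra.
    replace ((1 - t * a) * D2 - t * b * D1) with (- (u * a - v * b) * Y2 - (u * b + v * a) * Y1) by lra.
    ring.
  - intros t ht. assert (hd := is_derive_PSeries xi t (hI t ht)).
    assert (ho := hode t ht). rewrite !dilate_R_parts, edr, edi in ho.
    fold xr in ho. fold xi in ho.
    set (D1 := PSeries (PS_derive xr) t) in *. set (D2 := PSeries (PS_derive xi) t) in *.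
    set (Y1 := PSeries xr t) in *. set (Y2 := PSeries xi t) in *.
    unfold Cmult, Cminus, Cplus, Copp, RtoC in ho. simpl in ho. injection ho as ho1 ho2.
    replace ((u * th' t + v * l' t) * Y1 + (u * l' t - v * th' t) * Y2) with D2; [exact hd|].
    assert (h := hD t ht). apply Rmult_eq_reg_r with (D t); [|lra].
    replace (((u * th' t + v * l' t) * Y1 + (u * l' t - v * th' t) * Y2) * D t)
      with ((- u * b + v * (t * (a * a + b * b) - a)) * Y1
            + (u * (t * (a * a + b * b) - a) + v * b) * Y2)
      by (unfold l', th'; field; lra).
    unfold D.
    transitivity ((1 - t * a) * ((1 - t * a) * D2 - t * b * D1)
                  + t * b * ((1 - t * a) * D1 + t * b * D2)); [ring|].
    replace ((1 - t * a) * D1 + t * b * D2) with (- (u * a - v * b) * Y1 + (u * b + v * a) * Y2) by lra.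
    replace ((1 - t * a) * D2 - t * b * D1) with (- (u * a - v * b) * Y2 - (u * b + v * a) * Y1) by lra.
    ring.
  - intros t ht. assert (g1 := hl t ht). assert (g2 := hth t ht).
    apply (is_derive_minus (fun t => u * l t) (fun t => v * th t)); now apply is_derive_scal.
  - intros t ht. assert (g1 := hl t ht). assert (g2 := hth t ht).
    apply (is_derive_plus (fun t => u * th t) (fun t => v * l t)); now apply is_derive_scal.
  - unfold l, th, D. replace ((1 - 0 * a) ^ 2 + (0 * b) ^ 2) with 1 by ring.
    replace (- (0 * b) / (1 - 0 * a)) with 0 by (field; lra).
    rewrite ln_1, atan_0. field.
  - unfold l, th, D. replace ((1 - 0 * a) ^ 2 + (0 * b) ^ 2) with 1 by ring.
    replace (- (0 * b) / (1 - 0 * a)) with 0 by (field; lra).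
    rewrite ln_1, atan_0. field.
  - rewrite PSeries_0. unfold xr, y, dilate, Re. simpl. ring.
  - rewrite PSeries_0. unfold xi, y, dilate, Im. simpl. ring.
  - intros L A.
    assert (eL : l 1 = L).
    { unfold l, L, D, Cmod. simpl. 
      replace ((1 - 1 * a) * ((1 - 1 * a) * 1) + 1 * b * (1 * b * 1))
        with ((1 + - a) * ((1 + - a) * 1) + (0 + - b) * ((0 + - b) * 1)) by ring.
      set (d := (1 + - a) * ((1 + - a) * 1) + (0 + - b) * ((0 + - b) * 1)).
      assert (hd : 0 < d) by (unfold d; nra).
      rewrite <- (sqrt_sqrt d) at 1 by lra.
      rewrite ln_mult by now apply sqrt_lt_R0. field. }
    assert (eA : th 1 = A).
    { unfold th, A, Re, Im. simpl. f_equal. f_equal; ring. }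
    cbv beta in e1, e2. rewrite eL, eA in e1, e2.
    replace (CSeries y) with (CSeries (dilate 1 y)).
    2:{ f_equal. apply functional_extensionality. intro k. unfold dilate at 1.
        rewrite Cpow_1_l. ring. }
    rewrite dilate_R_parts. fold xr xi. rewrite e1, e2.
    unfold cis, RtoC, Cmult, Re, Im. simpl. f_equal; ring.
Qed.

(** For [Re w > 1] the ratio [|k - w| / (k + 1)] is eventually at most
    [(k - 1) / (k + 1)], which makes [k |binomial_coef w k|] decrease by at
    least [|binomial_coef w k|] at each step: the series telescopes. *)
Lemma binomial_coef_abs_summable (w : C) :
  1 < Re w -> abs_summable (binomial_coef w).
Proof.
  intro hw. set (x := fun k => Cmod (binomial_coef w k)).
  assert (hx : forall k, 0 <= x k) by (intro; apply Cmod_ge_0).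
  destruct (nfloor_ex (Cmod w ^ 2 / (2 * (Re w - 1)))) as [K0 [_ hK0]].
  { apply Rmult_le_pos; [apply pow2_ge_0|]. left. apply Rinv_0_lt_compat. lra. }
  set (K := S K0).
  assert (hrec : forall k, (K <= k)%nat -> INR (S k) * x (S k) <= (INR k - 1) * x k).
  { intros k hk. unfold x.
    replace (INR (S k) * Cmod (binomial_coef w (S k)))
      with (Cmod (INR (S k) * binomial_coef w (S k))%C)
      by (rewrite Cmod_mult, Cmod_R, Rabs_pos_eq by apply pos_INR; reflexivity).
    rewrite binomial_coef_succ, Cmod_mult. apply Rmult_le_compat_r; [apply Cmod_ge_0|].
    assert (hk1 : INR K <= INR k) by (apply le_INR; assumption).
    unfold K in hk1. rewrite S_INR in hk1. assert (h0 := pos_INR K0).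
    assert (hq : Cmod w ^ 2 < INR k * (2 * (Re w - 1))).
    { apply Rmult_lt_reg_r with (/ (2 * (Re w - 1))); [apply Rinv_0_lt_compat; lra|].
      rewrite Rmult_assoc, Rinv_r by lra. unfold Rdiv in hK0. lra. }
    apply Rsqr_incr_0; [|apply Cmod_ge_0|lra]. unfold Rsqr.
    replace (Cmod (INR k - w) * Cmod (INR k - w)) with (Cmod (INR k - w) ^ 2) by ring.
    rewrite Cmod2_alt in *. destruct w as [u v]. unfold Re, Im in *. simpl in *. nra. }
  assert (hsum : forall n, sum_n (fun k => x (K + k)%nat) n
                           <= INR K * x K - INR (K + S n) * x (K + S n)%nat).
  { induction n as [|n IH].
    - rewrite sum_O, Nat.add_0_r, Nat.add_1_r. generalize (hrec K (Nat.le_refl K)). lra.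
    - rewrite sum_n_Rsucc. generalize (hrec (K + S n)%nat ltac:(lia)).
      rewrite (Nat.add_succ_r K (S n)). lra. }
  apply (ex_series_incr_n (fun k => Cmod (binomial_coef w k)) K).
  apply ex_series_of_bound with (INR K * x K); [intro; apply hx|].
  intro n. apply Rle_trans with (1 := hsum n).
  assert (0 <= INR (K + S n) * x (K + S n)%nat) by (apply Rmult_le_pos; [apply pos_INR|apply hx]).
  lra.
Qed.

(** * Kaluza sequences: boundary behaviour on the positive axis *)

Lemma kaluza_abs_sum (v : nat -> R) (n : nat) :
  kaluza_sequence v -> sum_n (fun k => Rabs (v k)) n <= 2 * v 0%nat.
Proof.
  intros [hneg hsum].
  assert (h0 : 0 <= v 0%nat) by (generalize (hsum 0%nat); rewrite sum_O; auto).
  assert (e : forall m, sum_n (fun k => Rabs (v k)) m = 2 * v 0%nat - sum_n v m :> R).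
  { induction m as [|m IH]; [rewrite !sum_O, Rabs_pos_eq by assumption; ring|].
    rewrite !sum_n_Rsucc, IH, Rabs_left1 by apply hneg. ring. }
  rewrite e. generalize (hsum n). lra.
Qed.

Lemma kaluza_abs_summable (v : nat -> R) :
  kaluza_sequence v -> ex_series (fun k => Rabs (v k)).
Proof.
  intro hv. apply ex_series_of_bound with (2 * v 0%nat); [intro; apply Rabs_pos|].
  intro n. now apply kaluza_abs_sum.
Qed.

Definition small_o (alpha : R) (phi : R -> R) : Prop :=
  forall eps, 0 < eps -> exists eta, 0 < eta /\
    forall h, 0 < h < eta -> Rabs (phi h) <= eps * Rpower h alpha.

Lemma Rpower_small (alpha eps : R) :
  0 < alpha -> 0 < eps -> exists eta, 0 < eta /\
    forall h, 0 < h < eta -> Rpower h alpha <= eps.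
Proof.
  intros ha he. exists (Rpower eps (/ alpha)). split; [apply exp_pos|].
  intros h [h0 h1].
  replace eps with (Rpower (Rpower eps (/ alpha)) alpha).
  - apply Rle_Rpower_l; lra.
  - rewrite Rpower_mult, Rinv_l, Rpower_1; lra.
Qed.

Lemma exp_neg_lt_1 (h : R) : 0 < h -> 0 < exp (- h) < 1.
Proof.
  intro hh. split; [apply exp_pos|]. rewrite <- exp_0. apply exp_increasing. lra.
Qed.

(** Abel's theorem at [1], in the stronger form for absolute values. *)
Lemma deficit_small (v : nat -> R) (eps : R) :
  ex_series (fun k => Rabs (v k)) -> 0 < eps -> exists eta, 0 < eta /\
    forall h, 0 < h < eta -> Series (fun j => Rabs (v j) * (1 - exp (- h) ^ j)) <= eps.
Proof.
  intros hv he.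
  destruct (series_dominated_small _ eps (fun k => Rabs_pos (v k)) hv he)
    as [K [e' [he' hdom]]].
  set (F := Series (fun k => Rabs (v k))).
  assert (hF : forall k, Rabs (v k) <= F).
  { intro k. assert (hu : abs_summable (fun k => RtoC (v k))).
    { unfold abs_summable. apply ex_series_ext with (2 := hv). intro; now rewrite Cmod_R. }
    assert (h := summable_term_le _ k hu). cbv beta in h. rewrite Cmod_R in h.
    apply Rle_trans with (1 := h). right. apply Series_ext. intro; now rewrite Cmod_R. }
  assert (hF0 : 0 <= F) by (apply Rle_trans with (2 := hF 0%nat); apply Rabs_pos).
  assert (hK := pos_INR K).
  assert (hden : 0 < (F + 1) * (INR K + 1)) by (apply Rmult_lt_0_compat; lra).
  exists (e' / ((F + 1) * (INR K + 1))). split; [now apply Rdiv_lt_0_compat|].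
  intros h [h0 h1]. assert (hx := exp_neg_lt_1 h h0). set (x := exp (- h)) in *.
  assert (hx1 : 1 - x <= h).
  { unfold x. generalize (exp_ineq1_le (- h)). lra. }
  apply hdom.
  - intro k. assert (hp := pow_le_1 x k ltac:(lra)). assert (ha := Rabs_pos (v k)).
    split; [apply Rmult_le_pos; lra|]. nra.
  - intros k hk.
    assert (hd := pow_diff_bound x 1 k ltac:(lra) ltac:(lra)). rewrite pow1 in hd.
    assert (hkK : INR k <= INR K) by (apply le_INR; lia).
    apply Rle_trans with ((F + 1) * ((INR K + 1) * (e' / ((F + 1) * (INR K + 1))))).
    + apply Rmult_le_compat; [apply Rabs_pos|lra|generalize (hF k); lra|].
      apply Rle_trans with (1 := proj2 hd). apply Rmult_le_compat; try lra. apply pos_INR.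
    + right. field. lra.
Qed.

Lemma Series_deficit (v : nat -> R) (x : R) :
  ex_series (fun k => Rabs (v k)) -> 0 <= x <= 1 ->
  Series (fun j => v j * (1 - x ^ j)) = Series v - PSeries v x /\
  ex_series (fun j => Rabs (v j) * (1 - x ^ j)).
Proof.
  intros hv hx.
  assert (hp : forall k, 0 <= x ^ k <= 1) by (intro; now apply pow_le_1).
  assert (h1 : ex_series (fun k => v k * x ^ k)).
  { apply ex_series_dom with (2 := hv). intro k. rewrite Rabs_mult.
    rewrite (Rabs_pos_eq (x ^ k)) by apply hp.
    assert (h := hp k). assert (h' := Rabs_pos (v k)). nra. }
  split.
  - unfold PSeries. rewrite <- Series_minus; [|now apply ex_series_Rabs|assumption].
    apply Series_ext. intro. ring.
  - apply ex_series_dom with (2 := hv). intro k.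
    assert (h := hp k). assert (h' := Rabs_pos (v k)).
    rewrite Rabs_pos_eq; nra.
Qed.

(** By Abel's theorem the sum is the limit of the generating function at [1],
    which is that of [h ^ alpha]. *)
Lemma kaluza_Series_0 (v : nat -> R) (alpha : R) :
  0 < alpha -> kaluza_sequence v ->
  small_o alpha (fun h => PSeries v (exp (- h)) - Rpower h alpha) ->
  Series v = 0.
Proof.
  intros ha hv ho. assert (hs := kaluza_abs_summable v hv).
  destruct (Req_dec (Series v) 0) as [|hne]; [assumption|exfalso].
  assert (hp : 0 < Rabs (Series v)) by now apply Rabs_pos_lt.
  set (e := Rabs (Series v) / 4).
  destruct (deficit_small v e hs ltac:(unfold e; lra)) as [e1 [he1 h1]].
  destruct (ho 1 Rlt_0_1) as [e2 [he2 h2]].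
  destruct (Rpower_small alpha e ha ltac:(unfold e; lra)) as [e3 [he3 h3]].
  set (h := Rmin e1 (Rmin e2 e3) / 2).
  assert (hm : 0 < Rmin e1 (Rmin e2 e3)) by (repeat apply Rmin_glb_lt; assumption).
  assert (m1 := Rmin_l e1 (Rmin e2 e3)). assert (m2 := Rmin_r e1 (Rmin e2 e3)).
  assert (m3 := Rmin_l e2 e3). assert (m4 := Rmin_r e2 e3).
  assert (hx := exp_neg_lt_1 h ltac:(unfold h; lra)).
  destruct (Series_deficit v (exp (- h)) hs ltac:(lra)) as [ed hd].
  assert (b1 := h1 h ltac:(unfold h; lra)). assert (b2 := h2 h ltac:(unfold h; lra)).
  assert (b3 := h3 h ltac:(unfold h; lra)).
  assert (b4 : Rabs (Series v - PSeries v (exp (- h))) <= e).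
  { rewrite <- ed. apply Rle_trans with (2 := b1).
    assert (ee : forall j, Rabs (v j * (1 - exp (- h) ^ j)) = Rabs (v j) * (1 - exp (- h) ^ j)).
    { intro j. rewrite Rabs_mult, (Rabs_pos_eq (1 - _)); [reflexivity|].
      generalize (pow_le_1 (exp (- h)) j ltac:(lra)). lra. }
    rewrite <- (Series_ext _ _ ee). apply Series_Rabs.
    apply ex_series_ext with (2 := hd). intro; symmetry; apply ee. }
  assert (hpow : 0 < Rpower h alpha) by apply exp_pos.
  assert (t : Rabs (Series v) <= Rabs (Series v - PSeries v (exp (- h)))
     + (Rabs (PSeries v (exp (- h)) - Rpower h alpha) + Rabs (Rpower h alpha))).
  { replace (Series v) with (Series v - PSeries v (exp (- h))
      + ((PSeries v (exp (- h)) - Rpower h alpha) + Rpower h alpha)) at 1 by ring.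
    apply Rle_trans with (1 := Rabs_triang _ _). apply Rplus_le_compat_l, Rabs_triang. }
  rewrite (Rabs_pos_eq (Rpower h alpha)) in t by lra.
  unfold e in *. lra.
Qed.

(** All the nonconstant terms have the same sign, so that the modulus of
    continuity at [1] is the generating function itself. *)
Lemma kaluza_deficit (v : nat -> R) (x : R) :
  kaluza_sequence v -> Series v = 0 -> 0 <= x <= 1 ->
  Series (fun j => Rabs (v j) * (1 - x ^ j)) = PSeries v x.
Proof.
  intros hv h0 hx. destruct (Series_deficit v x (kaluza_abs_summable v hv) hx) as [e _].
  rewrite h0 in e. replace (PSeries v x) with (- (0 - PSeries v x)) by ring.
  rewrite <- e, <- Series_opp. apply Series_ext. intros [|j].
  - simpl. ring.
  - rewrite Rabs_left1 by apply hv. ring.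
Qed.

(** * The coefficients of [(1 - z) ^ alpha] *)

Fixpoint real_binomial_coef (alpha : R) (k : nat) : R :=
  match k with
  | O => 1
  | S m => real_binomial_coef alpha m * (INR m - alpha) / INR (S m)
  end.

Lemma RtoC_real_binomial_coef (alpha : R) (k : nat) :
  RtoC (real_binomial_coef alpha k) = binomial_coef alpha k.
Proof.
  induction k as [|k IH]; [reflexivity|].
  cbn [real_binomial_coef binomial_coef]. rewrite <- IH.
  assert (INR (S k) <> 0) by (apply not_0_INR; lia).
  unfold Rdiv. rewrite !RtoC_mult, RtoC_inv, RtoC_minus by assumption. unfold Cdiv. ring.
Qed.

(** The partial sums are explicit: [alpha (b_0 + ... + b_n) = - (n + 1) b_(n+1)]. *)
Lemma real_binomial_coef_kaluza (alpha : R) :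
  0 < alpha < 1 -> kaluza_sequence (real_binomial_coef alpha).
Proof.
  intro ha.
  assert (hS : forall n, 0 < INR (S n)) by (intro; apply lt_0_INR; lia).
  assert (hneg : forall n, real_binomial_coef alpha (S n) <= 0).
  { induction n as [|n IH].
    - simpl. lra.
    - change (real_binomial_coef alpha (S (S n))) with
        (real_binomial_coef alpha (S n) * (INR (S n) - alpha) / INR (S (S n))).
      assert (h1 := hS (S n)).
      assert (h2 : 0 <= INR (S n) - alpha) by (rewrite S_INR; generalize (pos_INR n); lra).
      assert (h3 : 0 <= / INR (S (S n))) by (left; now apply Rinv_0_lt_compat).
      unfold Rdiv. assert (0 <= - real_binomial_coef alpha (S n) * (INR (S n) - alpha) * / INR (S (S n))).
      { repeat apply Rmult_le_pos; lra. }
      lra. }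
  split; [assumption|]. intro n.
  assert (e : forall m, alpha * sum_n (real_binomial_coef alpha) m
                        = - (INR (S m) * real_binomial_coef alpha (S m))).
  { induction m as [|m IH].
    - rewrite sum_O. simpl. field.
    - rewrite sum_n_Rsucc, Rmult_plus_distr_l, IH.
      change (real_binomial_coef alpha (S (S m))) with
        (real_binomial_coef alpha (S m) * (INR (S m) - alpha) / INR (S (S m))).
      field. generalize (hS (S m)). lra. }
  apply Rmult_le_reg_l with alpha; [lra|]. rewrite e, Rmult_0_r.
  assert (0 <= INR (S n) * - real_binomial_coef alpha (S n)); [|lra].
  apply Rmult_le_pos; [left; apply hS|generalize (hneg n); lra].
Qed.

Lemma real_binomial_coef_bound (alpha : R) (k : nat) :
  0 < alpha < 1 -> Cmod (binomial_coef alpha k) <= 2.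
Proof.
  intro ha. rewrite <- RtoC_real_binomial_coef, Cmod_R.
  assert (h := kaluza_abs_sum _ k (real_binomial_coef_kaluza alpha ha)).
  apply Rle_trans with (2 * real_binomial_coef alpha 0); [|simpl; lra].
  apply Rle_trans with (2 := h). destruct k as [|k].
  - rewrite sum_O. lra.
  - rewrite sum_n_Rsucc.
    assert (0 <= sum_n (fun j => Rabs (real_binomial_coef alpha j)) k)
      by (apply sum_n_nonneg; intros; apply Rabs_pos).
    lra.
Qed.

Lemma real_binomial_series (alpha : R) (z : C) :
  0 < alpha < 1 -> Cmod z < 1 ->
  CSeries (dilate z (fun k => RtoC (real_binomial_coef alpha k)))
  = (Rpower (Cmod (1 - z)) alpha * cis (alpha * atan (Im (1 - z) / Re (1 - z))))%C.
Proof.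
  intros ha hz.
  replace (fun k => RtoC (real_binomial_coef alpha k)) with (binomial_coef alpha)
    by (apply functional_extensionality; intro; now rewrite RtoC_real_binomial_coef).
  rewrite (binomial_series alpha z 2 (fun k => real_binomial_coef_bound alpha k ha) hz).
  unfold Rpower. change (Re alpha) with alpha. change (Im alpha) with 0.
  f_equal.
  - do 2 f_equal. ring.
  - f_equal. ring.
Qed.

Lemma CSeries_RtoC_real (v : nat -> R) (x : R) :
  CSeries (dilate x (fun k => RtoC (v k))) = RtoC (PSeries v x).
Proof.
  rewrite dilate_R_parts. simpl. unfold RtoC. f_equal. apply PSeries_const_0.
Qed.

Lemma Cmod_1_minus_RtoC (x : R) : x <= 1 -> Cmod (1 - x) = 1 - x.
Proof. intro h. rewrite <- RtoC_minus, Cmod_R, Rabs_pos_eq; lra. Qed.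

Lemma real_binomial_PSeries (alpha x : R) :
  0 < alpha < 1 -> 0 <= x < 1 ->
  PSeries (real_binomial_coef alpha) x = Rpower (1 - x) alpha.
Proof.
  intros ha hx.
  assert (hz : Cmod x < 1) by (rewrite Cmod_R, Rabs_pos_eq; lra).
  assert (h := real_binomial_series alpha x ha hz).
  rewrite CSeries_RtoC_real, Cmod_1_minus_RtoC in h by lra.
  replace (Im (1 - x)) with 0 in h by (unfold Im; simpl; ring).
  unfold Rdiv in h. rewrite Rmult_0_l, atan_0, Rmult_0_r, cis_0, Cmult_1_r in h.
  now apply RtoC_inj in h.
Qed.

(** This instance expands [z ^ j] for [z = e ^ (- h w)], with [t = j h], in
    powers of [1 - e ^ (- j h)]. *)
Lemma complex_exponent_series (u v t : R) :
  1 < u -> 0 <= t ->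
  CSeries (dilate (1 - exp (- t))%R (binomial_coef (u, v)))
  = (exp (- (t * u)) * cis (- (t * v)))%C.
Proof.
  intros hu ht. assert (hp := exp_pos (- t)).
  assert (he : exp (- t) <= 1).
  { destruct ht as [ht|<-]; [left; now apply exp_neg_lt_1|]. rewrite Ropp_0, exp_0. lra. }
  assert (hs := binomial_coef_abs_summable (u, v) hu).
  set (s := 1 - exp (- t)).
  assert (hz : Cmod s < 1) by (rewrite Cmod_R, Rabs_pos_eq; unfold s; lra).
  rewrite (binomial_series (u, v) s _ (fun k => summable_term_le _ k hs) hz).
  rewrite Cmod_1_minus_RtoC by (unfold s; lra).
  replace (1 - s) with (exp (- t)) by (unfold s; ring). rewrite ln_exp.
  replace (Im (1 - s)) with 0 by (unfold Im; simpl; ring).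
  unfold Rdiv. rewrite Rmult_0_l, atan_0. unfold Re, Im; simpl fst; simpl snd.
  f_equal; f_equal; [f_equal|]; ring.
Qed.

(** * From the positive axis to the whole disk: a Tauberian theorem *)

Lemma eventually_forall_le (P : nat -> R -> Prop) (N : nat) :
  (forall n, (n <= N)%nat -> exists eta, 0 < eta /\ forall h, 0 < h < eta -> P n h) ->
  exists eta, 0 < eta /\ forall h, 0 < h < eta -> forall n, (n <= N)%nat -> P n h.
Proof.
  induction N as [|N IH]; intro hP.
  - destruct (hP 0%nat (Nat.le_refl 0)) as [e [he h]]. exists e. split; [assumption|].
    intros t ht n hn. replace n with 0%nat by lia. now apply h.
  - destruct IH as [e1 [he1 h1]]; [intros; apply hP; lia|].
    destruct (hP (S N) (Nat.le_refl _)) as [e2 [he2 h2]].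
    exists (Rmin e1 e2). split; [now apply Rmin_glb_lt|].
    intros t ht n hn. assert (m1 := Rmin_l e1 e2). assert (m2 := Rmin_r e1 e2).
    destruct (Nat.eq_dec n (S N)) as [->|]; [apply h2; lra|apply h1; [lra|lia]].
Qed.

Lemma small_o_minus (alpha : R) (phi psi : R -> R) :
  small_o alpha phi -> small_o alpha psi -> small_o alpha (fun h => phi h - psi h).
Proof.
  intros h1 h2 eps he.
  destruct (h1 (eps / 2) ltac:(lra)) as [e1 [he1 H1]].
  destruct (h2 (eps / 2) ltac:(lra)) as [e2 [he2 H2]].
  exists (Rmin e1 e2). split; [now apply Rmin_glb_lt|].
  intros h hh. assert (m1 := Rmin_l e1 e2). assert (m2 := Rmin_r e1 e2).
  assert (a1 := H1 h ltac:(lra)). assert (a2 := H2 h ltac:(lra)).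
  apply Rle_trans with (1 := Rabs_triang _ _). rewrite Rabs_Ropp. lra.
Qed.

Lemma small_o_ext (alpha : R) (phi psi : R -> R) :
  (forall h, 0 < h -> phi h = psi h) -> small_o alpha phi -> small_o alpha psi.
Proof.
  intros e h1 eps he. destruct (h1 eps he) as [e1 [he1 H1]].
  exists e1. split; [assumption|]. intros h hh. rewrite <- e; [now apply H1|lra].
Qed.

Lemma small_o_scale (alpha c : R) (phi : R -> R) :
  0 < c -> small_o alpha phi -> small_o alpha (fun h => phi (c * h)).
Proof.
  intros hc h1 eps he.
  assert (hp : 0 < Rpower c alpha) by apply exp_pos.
  destruct (h1 (eps / Rpower c alpha) ltac:(now apply Rdiv_lt_0_compat)) as [e1 [he1 H1]].
  exists (e1 / c). split; [now apply Rdiv_lt_0_compat|].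
  intros h [hh1 hh2].
  assert (hch : c * h < e1).
  { apply Rmult_lt_compat_l with (r := c) in hh2; [|assumption].
    replace (c * (e1 / c)) with e1 in hh2 by (field; lra). assumption. }
  assert (0 < c * h) by now apply Rmult_lt_0_compat.
  apply Rle_trans with (1 := H1 (c * h) ltac:(lra)).
  rewrite <- Rpower_mult_distr by assumption. right. field. lra.
Qed.

Lemma exp_pow (x : R) (n : nat) : exp (INR n * x) = exp x ^ n.
Proof.
  induction n as [|n IH]; [simpl; now rewrite Rmult_0_l, exp_0|].
  rewrite S_INR, Rmult_plus_distr_r, Rmult_1_l, exp_plus, IH. simpl. ring.
Qed.

Lemma ex_series_times_unit (e t : nat -> R) :
  ex_series (fun k => Rabs (e k)) -> (forall k, 0 <= t k <= 1) ->
  ex_series (fun k => Rabs (e k * t k)).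
Proof.
  intros he ht. apply ex_series_dom with (2 := he). intro k.
  rewrite Rabs_Rabsolu, Rabs_mult, (Rabs_pos_eq (t k)) by apply ht.
  assert (h := ht k). assert (h' := Rabs_pos (e k)). nra.
Qed.

(** Moments of [e] against powers of [1 - q ^ j], [q = e ^ (- h)], are finite
    combinations of the values [F_e (q ^ i)] on the positive axis. *)
Lemma small_o_moments (alpha : R) (e : nat -> R) (k i : nat) :
  ex_series (fun j => Rabs (e j)) -> Series e = 0 ->
  small_o alpha (fun h => PSeries e (exp (- h))) ->
  small_o alpha (fun h =>
    Series (fun j => e j * ((1 - exp (- h) ^ j) ^ k * (exp (- h) ^ i) ^ j))).
Proof.
  intros he h0 ho. revert i. induction k as [|k IH]; intro i.
  - destruct i as [|i].
    + intros eps heps. exists 1. split; [lra|]. intros h _.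
      rewrite (Series_ext _ e), h0, Rabs_R0.
      * apply Rmult_le_pos; [lra|left; apply exp_pos].
      * intro j. simpl. rewrite pow1. ring.
    + apply small_o_ext with (fun h => PSeries e (exp (- (INR (S i) * h)))).
      * intros h _. unfold PSeries. apply Series_ext. intro j.
        replace (exp (- (INR (S i) * h))) with (exp (- h) ^ S i); [simpl; ring|].
        rewrite <- exp_pow. f_equal. ring.
      * apply (small_o_scale alpha (INR (S i)) (fun h => PSeries e (exp (- h)))); [|assumption].
        apply lt_0_INR; lia.
  - apply small_o_ext with (2 := small_o_minus _ _ _ (IH i) (IH (S i))).
    intros h hh. assert (hx := exp_neg_lt_1 h hh). set (x := exp (- h)) in *.
    assert (hu : forall i j, 0 <= (1 - x ^ j) ^ k * (x ^ i) ^ j <= 1).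
    { intros i' j. assert (a1 := pow_le_1 x j ltac:(lra)).
      assert (a2 := pow_le_1 (1 - x ^ j) k ltac:(lra)).
      assert (a3 := pow_le_1 (x ^ i') j (pow_le_1 x i' ltac:(lra))).
      split; [apply Rmult_le_pos; lra|nra]. }
    rewrite <- Series_minus by (apply ex_series_Rabs, ex_series_times_unit; auto).
    apply Series_ext. intro j. simpl. rewrite Rpow_mult_distr. ring.
Qed.

(** The factor [s] is what keeps the truncation error proportional to the
    deficit [1 - q ^ j], whose weighted sum is [O (h ^ alpha)]. *)
Lemma Series_pow_tail (x : nat -> R) (s : R) (K : nat) :
  (forall k, 0 <= x k) -> ex_series x -> 0 <= s <= 1 ->
  Series (fun k => x k * s ^ k) - sum_n (fun k => x k * s ^ k) K
  <= s * (Series x - sum_n x K).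
Proof.
  intros hx hs h01.
  assert (hp : forall k, 0 <= s ^ k <= 1) by (intro; now apply pow_le_1).
  assert (hnn : forall k, 0 <= x k * s ^ k) by (intro; apply Rmult_le_pos; [apply hx|apply hp]).
  assert (hsum : ex_series (fun k => x k * s ^ k)).
  { apply ex_series_dom with (2 := hs). intro k. rewrite Rabs_pos_eq by apply hnn.
    assert (a := hp k). assert (b := hx k). nra. }
  assert (hn : forall n, (K <= n)%nat ->
    sum_n (fun k => x k * s ^ k) n - sum_n (fun k => x k * s ^ k) K
    <= s * (sum_n x n - sum_n x K)).
  { intros n hn. induction hn as [|n hn IH]; [lra|]. rewrite !sum_n_Rsucc.
    assert (x (S n) * s ^ S n <= s * x (S n)); [|lra].
    simpl. assert (a := hp n). assert (b := hx (S n)).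
    assert (0 <= s * x (S n)) by (apply Rmult_le_pos; lra). nra. }
  assert (hall : Series (fun k => x k * s ^ k) <=
    sum_n (fun k => x k * s ^ k) K + s * (Series x - sum_n x K)); [|lra].
  apply Series_le_of_bound; [assumption|]. intro n.
  assert (hKS := sum_n_le_Series x K hx hs).
  destruct (Nat.le_gt_cases K n) as [h|h].
  - assert (a := hn n h). assert (b := sum_n_le_Series x n hx hs). nra.
  - assert (a := sum_n_mono (fun k => x k * s ^ k) n K hnn ltac:(lia)). nra.
Qed.

(** The point [e ^ (- h w)], [w = u + i v], on the logarithmic spiral that leaves
    [1] in the direction [- w]. *)
Definition Cray (u v h : R) : C := (exp (- (h * u)) * cis (- (h * v)))%C.

Lemma Cray_pow (u v h : R) (j : nat) : (Cray u v h ^ j)%C = Cray u v (INR j * h).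
Proof.
  unfold Cray. rewrite Cpow_mult_l, <- RtoC_pow, <- exp_pow, cis_pow.
  do 2 f_equal; [f_equal|]; ring.
Qed.

Lemma Cpow_diff_bound (z z' : C) (j : nat) :
  Cmod z <= 1 -> Cmod z' <= 1 -> Cmod (z ^ j - z' ^ j) <= INR j * Cmod (z - z').
Proof.
  intros hz hz'. induction j as [|j IH].
  - simpl. replace (1 - 1)%C with (RtoC 0) by ring. rewrite Cmod_0. lra.
  - rewrite S_INR. simpl.
    replace (z * z ^ j - z' * z' ^ j)%C with (z * (z ^ j - z' ^ j) + (z - z') * z' ^ j)%C by ring.
    apply Rle_trans with (1 := Cmod_triangle _ _). rewrite !Cmod_mult, Cmod_pow.
    assert (h1 := Cmod_ge_0 (z ^ j - z' ^ j)). assert (h2 := Cmod_ge_0 (z - z')).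
    assert (h3 := Cmod_ge_0 z).
    assert (h4 := pow_le_1 (Cmod z') j (conj (Cmod_ge_0 z') hz')). nra.
Qed.

Lemma one_minus_exp_lower (x : R) : 0 <= x -> Rmin 2 x <= 4 * (1 - exp (- x)).
Proof.
  intro hx. rewrite exp_Ropp. assert (h := exp_ineq1_le x).
  assert (hi : / exp x <= / (1 + x)) by (apply Rinv_le_contravar; lra).
  apply Rle_trans with (4 * (1 - / (1 + x))); [|lra].
  replace (4 * (1 - / (1 + x))) with (4 * x / (1 + x)) by (field; lra).
  apply Rmult_le_reg_r with (1 + x); [lra|].
  replace (4 * x / (1 + x) * (1 + x)) with (4 * x) by (field; lra).
  unfold Rmin. destruct (Rle_dec 2 x); nra.
Qed.

Lemma cis_lipschitz (x y : R) : Cmod (cis x - cis y) <= Rabs (x - y).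
Proof.
  (* the chord is 2 |sin ((x - y) / 2)| *)
  assert (e : Cmod (cis x - cis y) ^ 2 = (2 * sin ((x - y) / 2)) ^ 2).
  { rewrite Cmod2_alt. unfold cis, Re, Im. simpl fst; simpl snd.
    assert (hc : cos (x - y) = 1 - 2 * sin ((x - y) / 2) * sin ((x - y) / 2)).
    { rewrite <- cos_2a_sin. f_equal. field. }
    rewrite cos_minus in hc.
    assert (h1 := sin2_cos2 x). assert (h2 := sin2_cos2 y). unfold Rsqr in h1, h2. simpl. nra. }
  apply Rsqr_incr_0; [|apply Cmod_ge_0|apply Rabs_pos].
  rewrite <- Rsqr_abs, !Rsqr_pow2, e. set (t := (x - y) / 2).
  replace (x - y) with (2 * t) by (unfold t; field).
  assert (ht : sin t ^ 2 <= t ^ 2).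
  { rewrite <- !Rsqr_pow2. apply Rsqr_le_abs_1.
    destruct (Rle_or_lt 0 t) as [h|h].
    - rewrite (Rabs_pos_eq t) by assumption. destruct h as [h|<-].
      + apply Rabs_le. assert (a := sin_lt_x t h).
        split; [|lra]. destruct (Rle_or_lt t PI) as [hp|hp].
        * assert (0 <= sin t) by (apply sin_ge_0; lra). lra.
        * generalize (SIN_bound t) PI2_1. lra.
      + rewrite sin_0, Rabs_R0. lra.
    - rewrite (Rabs_left t) by assumption. rewrite <- (Ropp_involutive t) at 1.
      rewrite sin_neg, Rabs_Ropp. assert (a := sin_lt_x (- t) ltac:(lra)).
      apply Rabs_le. split; [|lra]. destruct (Rle_or_lt (- t) PI) as [hp|hp].
      + assert (0 <= sin (- t)) by (apply sin_ge_0; lra). lra.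
      + generalize (SIN_bound (- t)) PI2_1. lra. }
  nra.
Qed.

Lemma exp_neg_lipschitz (x y : R) :
  0 <= x -> 0 <= y -> Rabs (exp (- x) - exp (- y)) <= Rabs (x - y).
Proof.
  assert (h : forall x y, 0 <= x -> x <= y -> Rabs (exp (- x) - exp (- y)) <= Rabs (x - y)).
  { intros a b ha hab.
    assert (h1 : exp (- b) <= exp (- a)).
    { destruct hab as [hab|<-]; [left; apply exp_increasing; lra|lra]. }
    assert (h2 : exp (- a) <= 1).
    { rewrite <- exp_0. destruct ha as [ha|<-]; [left; apply exp_increasing; lra|].
      rewrite Ropp_0. lra. }
    rewrite Rabs_pos_eq, Rabs_left1 by lra.
    replace (exp (- b)) with (exp (- a) * exp (- (b - a)))
      by (rewrite <- exp_plus; f_equal; ring).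
    assert (h3 := exp_ineq1_le (- (b - a))). assert (h4 := exp_pos (- a)).
    assert (h5 : exp (- a) * (1 - exp (- (b - a))) <= 1 * (b - a)).
    { apply Rle_trans with (exp (- a) * (b - a)); [apply Rmult_le_compat_l; lra|].
      apply Rmult_le_compat_r; lra. }
    lra. }
  intros hx hy. destruct (Rle_or_lt x y) as [hxy|hxy]; [now apply h|].
  rewrite Rabs_minus_sym, (Rabs_minus_sym x y). apply h; lra.
Qed.

(** Logarithmic coordinates, comparable to [|1 - z|], in which the points
    [Cray u v h] form a rectangular grid. *)
Lemma Cpolar_near_1 (z : C) :
  Cmod z < 1 -> Cmod (1 - z) <= 1 / 2 ->
  exists x phi, z = (exp (- x) * cis phi)%C /\
    0 <= x <= 2 * Cmod (1 - z) /\ Rabs phi <= 2 * Cmod (1 - z).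
Proof.
  intros hz hP. set (P := Cmod (1 - z)) in *.
  assert (hr : 1 - P <= Re z).
  { assert (h := re_le_Cmod (1 - z)). fold P in h.
    replace (Re (1 - z)) with (1 - Re z) in h by (unfold Re; simpl; ring).
    generalize (Rle_abs (1 - Re z)). lra. }
  assert (hi : Rabs (Im z) <= P).
  { assert (h := im_le_Cmod (1 - z)). fold P in h.
    replace (Im (1 - z)) with (- Im z) in h by (unfold Im; simpl; ring).
    now rewrite Rabs_Ropp in h. }
  assert (hP0 : 0 <= P) by apply Cmod_ge_0.
  assert (hm : 1 - P <= Cmod z).
  { apply Rle_trans with (1 := hr). apply Rle_trans with (2 := re_le_Cmod z). apply Rle_abs. }
  exists (- ln (Cmod z)), (atan (Im z / Re z)).
  assert (hre : 0 < Re z) by lra.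
  assert (hmod : 0 < Cmod z) by lra.
  split; [|split; [split|]].
  - rewrite Ropp_involutive, exp_ln by assumption.
    assert (hsq : Cmod z = Re z * sqrt (1 + (Im z / Re z)²)).
    { rewrite <- (sqrt_square (Re z)) at 1 by lra.
      rewrite <- sqrt_mult by (try apply Rle_0_sqr; try nra; generalize (Rle_0_sqr (Im z / Re z)); lra).
      unfold Cmod. f_equal. unfold Rsqr, Re, Im in *. field. lra. }
    set (w := sqrt (1 + (Im z / Re z)²)) in *.
    assert (hw : 0 < w) by (apply sqrt_lt_R0; generalize (Rle_0_sqr (Im z / Re z)); lra).
    assert (hc : cos (atan (Im z / Re z)) = / w).
    { rewrite cos_atan. fold w. unfold Rdiv. ring. }
    assert (hsn : sin (atan (Im z / Re z)) = Im z / Re z / w).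
    { rewrite sin_atan. fold w. reflexivity. }
    unfold cis. rewrite hc, hsn, hsq.
    destruct z as [a b]. unfold Re, Im, RtoC, Cmult in *. simpl in *. f_equal; field; lra.
  - assert (h := ln_increasing (Cmod z) 1 hmod hz). rewrite ln_1 in h. lra.
  - (* - ln m <= 1 / m - 1 *)
    rewrite <- ln_Rinv by assumption.
    assert (h := exp_ineq1_le (ln (/ Cmod z))).
    rewrite exp_ln in h by now apply Rinv_0_lt_compat.
    assert (h2 : / Cmod z <= / (1 - P)) by (apply Rinv_le_contravar; lra).
    assert (h3 : / (1 - P) <= 1 + 2 * P).
    { apply Rmult_le_reg_l with (1 - P); [lra|]. rewrite Rinv_r by lra. nra. }
    lra.
  - assert (ha : forall t, Rabs (atan t) <= Rabs t).
    { assert (hpos : forall t, 0 <= t -> atan t <= t).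
      { intros t [ht|<-]; [|rewrite atan_0; lra].
        destruct (MVT_gen atan 0 t (fun y => / (1 + y²))) as [c [hc1 hc2]].
        - intros y _. apply is_derive_atan.
        - intros y _. apply derivable_continuous_pt, derivable_pt_atan.
        - rewrite atan_0 in hc2.
          assert (hinv : / (1 + c²) <= 1).
          { rewrite <- Rinv_1 at 2. apply Rinv_le_contravar; [lra|].
            generalize (Rle_0_sqr c). lra. }
          nra. }
      intro t. destruct (Rle_or_lt 0 t) as [h|h].
      - rewrite !Rabs_pos_eq; [now apply hpos|assumption|].
        destruct h as [h|<-]; [left; rewrite <- atan_0; now apply atan_increasing|].
        rewrite atan_0; lra.
      - rewrite <- (Rabs_Ropp (atan t)), <- (Rabs_Ropp t), <- atan_opp.
        rewrite !Rabs_pos_eq; [apply hpos; lra|lra|].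
        left. rewrite <- atan_0. apply atan_increasing. lra. }
    apply Rle_trans with (1 := ha _).
    unfold Rdiv. rewrite Rabs_mult, (Rabs_pos_eq (/ Re z)) by (left; now apply Rinv_0_lt_compat).
    apply Rle_trans with (P * / (1 - P)).
    + apply Rmult_le_compat; [apply Rabs_pos|left; now apply Rinv_0_lt_compat|assumption|].
      apply Rinv_le_contravar; lra.
    + rewrite Rmult_comm. apply Rmult_le_compat_r; [assumption|].
      apply Rmult_le_reg_l with (1 - P); [lra|]. rewrite Rinv_r by lra. lra.
Qed.

Lemma Cray_lipschitz (x phi u v h : R) :
  0 <= x -> 0 <= h * u ->
  Cmod (exp (- x) * cis phi - Cray u v h) <= Rabs (x - h * u) + Rabs (phi + h * v).
Proof.
  intros hx hu. unfold Cray.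
  replace (exp (- x) * cis phi - exp (- (h * u)) * cis (- (h * v)))%C
    with ((exp (- x) - exp (- (h * u)))%R * cis phi
          + exp (- (h * u)) * (cis phi - cis (- (h * v))))%C
    by (rewrite RtoC_minus; ring).
  apply Rle_trans with (1 := Cmod_triangle _ _). rewrite !Cmod_mult, !Cmod_R, Cmod_cis, Rmult_1_r.
  apply Rplus_le_compat; [now apply exp_neg_lipschitz|].
  replace (phi + h * v) with (phi - - (h * v)) by ring.
  rewrite <- (Rmult_1_l (Rabs (phi - - (h * v)))).
  apply Rmult_le_compat; [apply Rabs_pos|apply Cmod_ge_0| |apply cis_lipschitz].
  rewrite Rabs_pos_eq by (left; apply exp_pos).
  rewrite <- exp_0. destruct hu as [hu|<-]; [left; apply exp_increasing; lra|].
  rewrite Ropp_0. lra.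
Qed.

Section Tauberian.

Variables (alpha : R) (e : nat -> R) (B eta0 : R).
Hypothesis (halpha : 0 < alpha).
Hypothesis (he : ex_series (fun j => Rabs (e j))).
Hypothesis (he0 : Series e = 0).
Hypothesis (hsmall : small_o alpha (fun h => PSeries e (exp (- h)))).
Hypothesis (hB : 0 <= B) (heta0 : 0 < eta0).
Hypothesis (hmod : forall h, 0 < h < eta0 ->
  Series (fun j => Rabs (e j) * (1 - exp (- h) ^ j)) <= B * Rpower h alpha).

Lemma abs_summable_times (t : nat -> C) (T : R) :
  (forall j, Cmod (t j) <= T) -> abs_summable (fun j => e j * t j)%C.
Proof.
  intro ht. apply abs_summable_dom with (fun j => T * Rabs (e j)).
  - intro j. rewrite Cmod_mult, Cmod_R, Rmult_comm.
    apply Rmult_le_compat_r; [apply Rabs_pos|apply ht].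
  - exact (ex_series_scal_l T _ he).
Qed.

(** The series of [F_e] along [z = e ^ (- h w)] is expanded in the powers of
    [1 - q ^ j], [q = e ^ (- h)], by [z ^ j = (1 - (1 - q ^ j)) ^ w]; finitely
    many moments are [o (h ^ alpha)] and the rest is uniformly small. *)
Lemma small_o_ray (u v : R) :
  1 < u -> small_o alpha (fun h => Cmod (CSeries (dilate (Cray u v h) (fun j => RtoC (e j))))).
Proof.
  intros hu eps heps.
  set (beta := binomial_coef (u, v)).
  assert (hbeta : abs_summable beta) by now apply binomial_coef_abs_summable.
  set (x := fun k => Cmod (beta k)).
  assert (hx : forall k, 0 <= x k) by (intro; apply Cmod_ge_0).
  assert (htail : exists K, Series x - sum_n x K <= eps / (2 * (B + 1))).
  { assert (hl : is_lim_seq (sum_n x) (Series x)) by exact (Series_correct _ hbeta).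
    apply is_lim_seq_spec in hl.
    assert (hp : 0 < eps / (2 * (B + 1))) by (apply Rdiv_lt_0_compat; lra).
    destruct (hl (mkposreal _ hp)) as [K hK]. exists K.
    assert (h := hK K (Nat.le_refl K)). simpl in h. apply Rabs_lt_between in h. lra. }
  destruct htail as [K hK].
  set (tau := Series x - sum_n x K) in *.
  assert (htau : 0 <= tau) by (generalize (sum_n_le_Series x K hx hbeta); unfold tau; lra).
  set (Xs := Series x).
  assert (hXs : 0 <= Xs) by now apply Series_nonneg.
  destruct (eventually_forall_le (fun k h =>
    Rabs (Series (fun j => e j * ((1 - exp (- h) ^ j) ^ k * (exp (- h) ^ 0) ^ j)))
      <= eps / (2 * (Xs + 1)) * Rpower h alpha) K) as [eta [heta hmom]].
  { intros k _. apply (small_o_moments alpha e k 0 he he0 hsmall).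
    apply Rdiv_lt_0_compat; lra. }
  exists (Rmin eta eta0). split; [now apply Rmin_glb_lt|].
  intros h hh. assert (m1 := Rmin_l eta eta0). assert (m2 := Rmin_r eta eta0).
  rewrite Rabs_pos_eq by apply Cmod_ge_0.
  assert (hq := exp_neg_lt_1 h ltac:(lra)). set (q := exp (- h)) in *.
  set (s := fun j => 1 - q ^ j).
  assert (hs : forall j, 0 <= s j <= 1).
  { intro j. unfold s. generalize (pow_le_1 q j ltac:(lra)). lra. }
  assert (hpow : forall j, (Cray u v h ^ j)%C = CSeries (dilate (s j) beta)).
  { intro j. rewrite Cray_pow. unfold s.
    replace (q ^ j) with (exp (- (INR j * h)))
      by (unfold q; rewrite <- exp_pow; f_equal; ring).
    unfold beta. rewrite complex_exponent_series.
    - reflexivity.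
    - assumption.
    - apply Rmult_le_pos; [apply pos_INR|lra]. }
  set (T := fun n j => sum_n (dilate (s j) beta) n : C).
  assert (hdil : forall j, abs_summable (dilate (s j) beta)).
  { intro j. apply abs_summable_dilate; [|assumption].
    rewrite Cmod_R, Rabs_pos_eq; apply hs. }
  assert (hrem : forall j, Cmod (Cray u v h ^ j - T K j) <= tau * s j).
  { intro j. rewrite hpow. apply Rle_trans with (1 := Cmod_CSeries_tail _ K (hdil j)).
    assert (em : forall k, Cmod (dilate (s j) beta k) = x k * s j ^ k).
    { intro k. unfold dilate. rewrite Cmod_mult, Cmod_pow, Cmod_R, Rabs_pos_eq by apply hs.
      reflexivity. }
    rewrite (Series_ext _ _ em). unfold norm_upto. rewrite (sum_n_Rext _ _ K (fun k _ => em k)).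
    rewrite Rmult_comm. now apply Series_pow_tail. }
  set (mom := fun k => Series (fun j => e j * s j ^ k)).
  assert (hsum1 : forall k, abs_summable (fun j => e j * RtoC (s j ^ k))%C).
  { intro k. apply abs_summable_times with 1. intro j.
    rewrite Cmod_R, Rabs_pos_eq by (apply pow_le, hs). now apply pow_le_1. }
  assert (hsplit : forall n, abs_summable (fun j => e j * T n j)%C /\
    CSeries (fun j => e j * T n j)%C = sum_n (fun k => beta k * mom k)%C n).
  { assert (hterm : forall n, abs_summable (sscal (beta n) (fun j => e j * RtoC (s j ^ n))%C) /\
      CSeries (sscal (beta n) (fun j => e j * RtoC (s j ^ n))%C) = (beta n * mom n)%C).
    { intro n. split; [now apply abs_summable_sscal|].
      rewrite CSeries_sscal by apply hsum1. f_equal. unfold CSeries, mom, RtoC. f_equal.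
      - apply Series_ext. intro j. unfold Re. simpl. ring.
      - transitivity (PSeries (fun _ => 0) 0); [|apply PSeries_const_0].
        apply Series_ext. intro j. unfold Im. simpl. ring. }
    induction n as [|n [IH1 IH2]].
    - replace (fun j => e j * T 0%nat j)%C with (sscal (beta 0%nat) (fun j => e j * RtoC (s j ^ 0))%C).
      + rewrite sum_O. apply hterm.
      + apply functional_extensionality. intro j. unfold T, sscal, dilate.
        rewrite sum_O. simpl. ring.
    - replace (fun j => e j * T (S n) j)%C with
        (sadd (fun j => e j * T n j)%C (sscal (beta (S n)) (fun j => e j * RtoC (s j ^ S n))%C)).
      + destruct (hterm (S n)) as [t1 t2]. split; [now apply abs_summable_sadd|].
        rewrite CSeries_sadd, IH2, t2, sum_n_Csucc by assumption. reflexivity.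
      + apply functional_extensionality. intro j. unfold T, sscal, sadd.
        rewrite sum_n_Csucc. unfold dilate at 3. rewrite RtoC_pow. ring. }
  destruct (hsplit K) as [hTK eTK].
  set (R := fun j => (e j * (Cray u v h ^ j - T K j))%C).
  assert (hdef := proj2 (Series_deficit e q he ltac:(lra))).
  assert (hRle : forall j, Cmod (R j) <= tau * (Rabs (e j) * (1 - q ^ j))).
  { intro j. unfold R. rewrite Cmod_mult, Cmod_R.
    replace (tau * (Rabs (e j) * (1 - q ^ j))) with (Rabs (e j) * (tau * s j))
      by (unfold s; ring).
    apply Rmult_le_compat_l; [apply Rabs_pos|apply hrem]. }
  assert (hRs : abs_summable R).
  { apply abs_summable_dom with (1 := hRle). exact (ex_series_scal_l tau _ hdef). }
  replace (dilate (Cray u v h) (fun j => RtoC (e j))) with (sadd (fun j => e j * T K j)%C R).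
  2:{ apply functional_extensionality. intro j. unfold sadd, R, dilate. ring. }
  rewrite CSeries_sadd, eTK by assumption.
  apply Rle_trans with (1 := Cmod_triangle _ _).
  assert (hpw : 0 < Rpower h alpha) by apply exp_pos.
  assert (part1 : Cmod (sum_n (fun k => (beta k * mom k)%C) K) <= eps / 2 * Rpower h alpha).
  { apply Rle_trans with (1 := Cmod_sum_n_le _ _).
    apply Rle_trans with (sum_n (fun k => eps / (2 * (Xs + 1)) * Rpower h alpha * x k) K).
    - apply sum_n_le_loc. intros k hk. rewrite Cmod_mult, Cmod_R, Rmult_comm.
      apply Rmult_le_compat_r; [apply hx|].
      replace (mom k) with
        (Series (fun j => e j * ((1 - q ^ j) ^ k * (q ^ 0) ^ j))).
      + apply hmom; [lra|assumption].
      + apply Series_ext. intro j. simpl. rewrite pow1. unfold s. ring.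
    - rewrite sum_n_Rmult_l.
      assert (hb := sum_n_le_Series x K hx hbeta). fold Xs in hb.
      apply Rle_trans with (eps / (2 * (Xs + 1)) * Rpower h alpha * (Xs + 1)).
      + apply Rmult_le_compat_l; [|lra]. apply Rmult_le_pos; [|lra].
        left. apply Rdiv_lt_0_compat; lra.
      + right. field. lra. }
  assert (part2 : Cmod (CSeries R) <= eps / 2 * Rpower h alpha).
  { apply Rle_trans with (1 := Cmod_CSeries_le _ hRs).
    apply Rle_trans with (tau * Series (fun j => Rabs (e j) * (1 - q ^ j))).
    - rewrite <- Series_scal_l. apply Series_le; [|exact (ex_series_scal_l tau _ hdef)].
      intro j. split; [apply Cmod_ge_0|apply hRle].
    - apply Rle_trans with (eps / (2 * (B + 1)) * ((B + 1) * Rpower h alpha)).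
      + apply Rmult_le_compat; try assumption.
        * apply Series_nonneg; [|assumption]. intro j.
          apply Rmult_le_pos; [apply Rabs_pos|apply hs].
        * assert (hm := hmod h ltac:(lra)). fold q in hm. lra.
      + right. field. lra. }
  lra.
Qed.

(** The smaller of the bounds [2] and [j d] for [|z ^ j - z' ^ j|] is at most
    the deficit [4 (1 - e ^ (- j d))], whose weighted sum is the behaviour at [1]. *)
Lemma generating_function_modulus (z z' : C) (d : R) :
  Cmod z <= 1 -> Cmod z' <= 1 -> Cmod (z - z') <= d -> 0 < d < eta0 ->
  Cmod (CSeries (dilate z (fun j => RtoC (e j)))
        - CSeries (dilate z' (fun j => RtoC (e j)))) <= 4 * B * Rpower d alpha.
Proof.
  intros hz hz' hd hd0.
  assert (hec : abs_summable (fun j => RtoC (e j))).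
  { unfold abs_summable. apply ex_series_ext with (2 := he). intro; now rewrite Cmod_R. }
  assert (hs1 := abs_summable_dilate _ z hz hec).
  assert (hs2 := abs_summable_dilate _ z' hz' hec).
  set (D := sadd (dilate z (fun j => RtoC (e j))) (sscal (- (1))%C (dilate z' (fun j => RtoC (e j))))).
  assert (hD : abs_summable D) by (apply abs_summable_sadd; [|apply abs_summable_sscal]; assumption).
  replace (CSeries _ - CSeries _)%C with (CSeries D).
  2:{ unfold D. rewrite CSeries_sadd, CSeries_sscal; [ring|assumption|assumption|].
      now apply abs_summable_sscal. }
  apply Rle_trans with (1 := Cmod_CSeries_le _ hD).
  assert (hq := exp_neg_lt_1 d ltac:(lra)).
  assert (hdef := proj2 (Series_deficit e (exp (- d)) he ltac:(lra))).
  apply Rle_trans with (4 * Series (fun j => Rabs (e j) * (1 - exp (- d) ^ j))).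
  - rewrite <- Series_scal_l. apply Series_le; [|exact (ex_series_scal_l 4 _ hdef)].
    intro j. split; [apply Cmod_ge_0|].
    replace (D j) with (e j * (z ^ j - z' ^ j))%C by (unfold D, sadd, sscal, dilate; ring).
    rewrite Cmod_mult, Cmod_R.
    replace (4 * (Rabs (e j) * (1 - exp (- d) ^ j)))
      with (Rabs (e j) * (4 * (1 - exp (- d) ^ j))) by ring.
    apply Rmult_le_compat_l; [apply Rabs_pos|].
    rewrite <- exp_pow. replace (INR j * - d) with (- (INR j * d)) by ring.
    apply Rle_trans with (Rmin 2 (INR j * d)).
    + apply Rmin_glb.
      * apply Rle_trans with (1 := Cmod_triangle _ _). rewrite Cmod_opp, !Cmod_pow.
        assert (a1 := pow_le_1 (Cmod z) j (conj (Cmod_ge_0 z) hz)).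
        assert (a2 := pow_le_1 (Cmod z') j (conj (Cmod_ge_0 z') hz')). lra.
      * apply Rle_trans with (1 := Cpow_diff_bound z z' j hz hz').
        apply Rmult_le_compat_l; [apply pos_INR|assumption].
    + apply one_minus_exp_lower. apply Rmult_le_pos; [apply pos_INR|lra].
  - assert (h := hmod d hd0). lra.
Qed.

(** With the step [h = |1 - z| / N], the points [Cray u v h] of finitely many
    rays, [u] and [v] running through integers with [u >= 2], form a grid in
    logarithmic coordinates with a point within [3 h] of [z].  At that point
    [small_o_ray] applies, and passing from it to [z] costs
    [O (N ^ (- alpha)) |1 - z| ^ alpha] by the modulus of continuity. *)
Theorem tauberian_disk (eps : R) :
  0 < eps -> exists r, 0 < r /\ forall z, Cmod z < 1 -> 0 < Cmod (1 - z) < r ->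
    Cmod (CSeries (dilate z (fun j => RtoC (e j)))) <= eps * Rpower (Cmod (1 - z)) alpha.
Proof.
  intro heps.
  assert (hc : 0 < eps / (8 * (B + 1))) by (apply Rdiv_lt_0_compat; lra).
  destruct (Rpower_small alpha (eps / (8 * (B + 1))) halpha hc) as [e1 [he1 h1]].
  destruct (nfloor_ex (3 / e1)) as [N0 [_ hN0]].
  { left. apply Rdiv_lt_0_compat; lra. }
  set (N := S N0).
  assert (hN : 0 < INR N) by (apply lt_0_INR; unfold N; lia).
  assert (hN1 : 1 <= INR N) by (change 1 with (INR 1); apply le_INR; unfold N; lia).
  assert (h3N : 3 / INR N < e1).
  { unfold N. rewrite S_INR. apply Rmult_lt_reg_r with (INR N0 + 1); [generalize (pos_INR N0); lra|].
    unfold Rdiv. rewrite Rmult_assoc, Rinv_l, Rmult_1_r by (generalize (pos_INR N0); lra).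
    apply Rmult_lt_reg_r with (/ e1); [now apply Rinv_0_lt_compat|].
    replace (e1 * (INR N0 + 1) * / e1) with (INR N0 + 1) by (field; lra).
    exact hN0. }
  destruct (eventually_forall_le (fun i h => forall j, (j <= 4 * N)%nat ->
      Cmod (CSeries (dilate (Cray (INR i + 2) (INR j - INR (2 * N)) h) (fun j => RtoC (e j))))
      <= eps / 2 * Rpower h alpha) (2 * N)) as [e2 [he2 h2]].
  { intros i _. apply (eventually_forall_le (fun j h =>
      Cmod (CSeries (dilate (Cray (INR i + 2) (INR j - INR (2 * N)) h) (fun j => RtoC (e j))))
      <= eps / 2 * Rpower h alpha) (4 * N)).
    intros j _.
    destruct (small_o_ray (INR i + 2) (INR j - INR (2 * N)) ltac:(generalize (pos_INR i); lra)
      (eps / 2) ltac:(lra)) as [e3 [he3 h3]].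
    exists e3. split; [assumption|]. intros h hh. assert (a := h3 h hh).
    now rewrite Rabs_pos_eq in a by apply Cmod_ge_0. }
  set (r := Rmin (1 / 2) (Rmin e2 (eta0 / 3))).
  assert (hr : 0 < r) by (unfold r; repeat apply Rmin_glb_lt; lra).
  assert (r1 : r <= 1 / 2) by apply Rmin_l.
  assert (r2 : r <= e2) by (apply Rle_trans with (1 := Rmin_r _ _); apply Rmin_l).
  assert (r3 : r <= eta0 / 3) by (apply Rle_trans with (1 := Rmin_r _ _); apply Rmin_r).
  exists r. split; [assumption|]. intros z hz hP.
  set (P := Cmod (1 - z)) in *.
  destruct (Cpolar_near_1 z hz ltac:(fold P; lra)) as [x [phi [ez [hx hphi]]]].
  fold P in hx, hphi.
  set (h := P / INR N).
  assert (hh : 0 < h) by (apply Rdiv_lt_0_compat; lra).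
  assert (hhP : h <= P).
  { unfold h. apply Rmult_le_reg_r with (INR N); [assumption|].
    replace (P / INR N * INR N) with P by (field; lra). nra. }
  assert (hhN : h * INR N = P) by (unfold h; field; lra).
  destruct (nfloor_ex (x / h)) as [i [hi1 hi2]].
  { apply Rmult_le_pos; [lra|left; now apply Rinv_0_lt_compat]. }
  assert (hxh : x / h * h = x) by (field; lra).
  assert (hphi' := proj1 (Rabs_le_between _ _) hphi).
  assert (h2N : INR (2 * N) = 2 * INR N) by (rewrite mult_INR; reflexivity).
  assert (h4N : INR (4 * N) = 4 * INR N) by (rewrite mult_INR; simpl INR; ring).
  assert (hph : phi / h * h = phi) by (field; lra).
  destruct (nfloor_ex (2 * INR N - phi / h)) as [j [hj1 hj2]].
  { apply Rmult_le_reg_r with h; [assumption|]. rewrite Rmult_minus_distr_r, hph. lra. }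
  assert (hi : (i <= 2 * N)%nat).
  { apply INR_le. rewrite h2N. apply Rle_trans with (1 := hi1).
    apply Rmult_le_reg_r with h; [assumption|]. rewrite hxh. lra. }
  assert (hj : (j <= 4 * N)%nat).
  { apply INR_le. rewrite h4N. apply Rle_trans with (1 := hj1).
    apply Rmult_le_reg_r with h; [assumption|]. rewrite Rmult_minus_distr_r, hph. lra. }
  set (z' := Cray (INR i + 2) (INR j - INR (2 * N)) h).
  assert (hi0 := pos_INR i).
  assert (hdist : Cmod (z - z') <= 3 * h).
  { rewrite ez. apply Rle_trans with (1 := Cray_lipschitz x phi (INR i + 2) (INR j - INR (2 * N)) h
      (proj1 hx) ltac:(apply Rmult_le_pos; lra)).
    assert (a1 : Rabs (x - h * (INR i + 2)) <= 2 * h).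
    { apply Rmult_le_compat_r with (r := h) in hi1; [|lra].
      apply Rmult_lt_compat_r with (r := h) in hi2; [|lra].
      rewrite hxh in hi1, hi2. apply Rabs_le. lra. }
    assert (a2 : Rabs (phi + h * (INR j - INR (2 * N))) <= h).
    { apply Rmult_le_compat_r with (r := h) in hj1; [|lra].
      apply Rmult_lt_compat_r with (r := h) in hj2; [|lra].
      rewrite Rmult_minus_distr_r, hph in hj1, hj2. rewrite h2N. apply Rabs_le. lra. }
    lra. }
  assert (hz' : Cmod z' <= 1).
  { unfold z', Cray. rewrite Cmod_mult, Cmod_cis, Cmod_R, Rmult_1_r, Rabs_pos_eq
      by (left; apply exp_pos).
    rewrite <- exp_0. left. apply exp_increasing.
    assert (0 < h * (INR i + 2)) by (apply Rmult_lt_0_compat; lra). lra. }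
  assert (hmodz := generating_function_modulus z z' (3 * h) ltac:(lra) hz' hdist ltac:(lra)).
  assert (hgrid := h2 h ltac:(lra) i hi j hj). fold z' in hgrid.
  assert (hhp : Rpower h alpha <= Rpower P alpha) by (apply Rle_Rpower_l; lra).
  assert (hPp : 0 < Rpower P alpha) by apply exp_pos.
  assert (h3h : 4 * B * Rpower (3 * h) alpha <= eps / 2 * Rpower P alpha).
  { replace (3 * h) with (3 / INR N * P) by (unfold h; field; lra).
    rewrite <- Rpower_mult_distr by (try apply Rdiv_lt_0_compat; lra).
    assert (a := h1 (3 / INR N) ltac:(split; [apply Rdiv_lt_0_compat; lra|assumption])).
    assert (a0 : 0 < Rpower (3 / INR N) alpha) by apply exp_pos.
    rewrite <- Rmult_assoc. apply Rmult_le_compat_r; [lra|].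
    apply Rle_trans with (4 * (B + 1) * (eps / (8 * (B + 1)))).
    - apply Rmult_le_compat; lra.
    - right. field. lra. }
  replace (CSeries (dilate z (fun j => RtoC (e j)))) with
    (CSeries (dilate z (fun j => RtoC (e j))) - CSeries (dilate z' (fun j => RtoC (e j)))
     + CSeries (dilate z' (fun j => RtoC (e j))))%C by ring.
  apply Rle_trans with (1 := Cmod_triangle _ _). nra.
Qed.

End Tauberian.

(** * Generating functions of a scheme *)

Lemma CV_radius_of_bounded (v : nat -> R) (M x : R) :
  (forall k, Rabs (v k) <= M) -> 0 <= x < 1 -> Rbar_lt (Rabs x) (CV_radius v).
Proof.
  intros hv hx. apply Rbar_lt_le_trans with (Finite 1).
  - simpl. rewrite Rabs_pos_eq; lra.
  - apply (CV_radius_bounded v). exists M. intro n. rewrite pow1, Rmult_1_r. apply hv.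
Qed.

Lemma PSeries_conv_inverse (w a : nat -> R) (M x : R) :
  conv_inverse w a -> (forall k, Rabs (w k) <= M) -> (forall k, Rabs (a k) <= M) ->
  0 <= x < 1 -> PSeries w x * PSeries a x = 1.
Proof.
  intros hinv hw ha hx.
  rewrite <- PSeries_mult by (apply CV_radius_of_bounded with M; assumption).
  rewrite (PSeries_ext _ delta_d).
  - apply RtoC_inj. rewrite <- CSeries_RtoC_real. change (fun k => RtoC (delta_d k)) with sone.
    rewrite dilate_sone. apply CSeries_sone.
  - intro n. rewrite <- (hinv n). unfold PS_mult, conv. now rewrite sum_n_Reals.
Qed.

Lemma consistent_eventually (alpha : R) (a : nat -> R) (eps : R) :
  consistent alpha a -> 0 < eps -> exists eta, 0 < eta /\
    forall h, 0 < h < eta ->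
      Rabs (Rpower h alpha * PSeries a (exp (- h)) - 1) < eps.
Proof.
  intros [_ hl] he.
  destruct (hl (fun y => Rabs (y - 1) < eps)) as [eta heta].
  { exists (mkposreal eps he). intros y hy. exact hy. }
  exists eta. split; [apply cond_pos|]. intros h hh. apply heta; [|lra].
  unfold ball; simpl. unfold AbsRing_ball, abs, minus, plus, opp; simpl.
  rewrite Ropp_0, Rplus_0_r, Rabs_pos_eq; lra.
Qed.

Lemma completely_monotone_le (a : nat -> R) (i j : nat) :
  completely_monotone a -> (i <= j)%nat -> a j <= a i.
Proof.
  intros ha hij. induction hij as [|j _ IH]; [lra|].
  generalize (completely_monotone_decr a j ha). lra.
Qed.

(** A vanishing entry would leave a polynomial [F_a], whereas consistency
    makes [F_a] unbounded near [1]. *)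
Lemma scheme_weights_positive (alpha : R) (omega a : nat -> R) :
  0 < alpha < 1 -> CM_preserving alpha omega a -> forall n, 0 < a n.
Proof.
  intros halpha [_ [_ [hcons hcm]]] n.
  destruct (completely_monotone_nonneg a n hcm) as [|h0]; [assumption|exfalso].
  assert (hz : forall k, (n <= k)%nat -> a k = 0).
  { intros k hk. assert (b1 := completely_monotone_le a n k hcm hk).
    assert (b2 := completely_monotone_nonneg a k hcm). lra. }
  set (M := sum_n a n).
  assert (hM : forall m, sum_n a m <= M).
  { intro m. destruct (Nat.le_gt_cases m n) as [h|h].
    - apply sum_n_mono; [intro; now apply completely_monotone_nonneg|assumption].
    - right. unfold M. induction h as [|m h IH]; [rewrite sum_n_Rsucc, hz by lia; ring|].
      rewrite sum_n_Rsucc, IH, hz by lia. ring. }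
  assert (hM0 : 0 <= M) by (apply sum_n_nonneg; intros; now apply completely_monotone_nonneg).
  assert (hPS : forall x, 0 <= x <= 1 -> 0 <= PSeries a x <= M).
  { intros x hx. assert (hp : forall k, 0 <= x ^ k <= 1) by (intro; now apply pow_le_1).
    assert (ht : forall k, 0 <= a k * x ^ k <= a k).
    { intro k. assert (b := completely_monotone_nonneg a k hcm). assert (c := hp k).
      split; [apply Rmult_le_pos; lra|nra]. }
    assert (hb : forall m, sum_n (fun k => a k * x ^ k) m <= M).
    { intro m. apply Rle_trans with (2 := hM m). apply sum_n_le_loc. intros; apply ht. }
    assert (hs : ex_series (fun k => a k * x ^ k))
      by (apply ex_series_of_bound with M; [intro; apply ht|assumption]).
    split; [apply Series_nonneg; [intro; apply ht|assumption]|now apply Series_le_of_bound]. }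
  destruct (consistent_eventually alpha a (1 / 2) hcons ltac:(lra)) as [e1 [he1 h1]].
  destruct (Rpower_small alpha (/ (2 * (M + 1))) ltac:(lra)) as [e2 [he2 h2]].
  { apply Rinv_0_lt_compat. lra. }
  set (h := Rmin e1 e2 / 2).
  assert (hm : 0 < Rmin e1 e2) by now apply Rmin_glb_lt.
  assert (m1 := Rmin_l e1 e2). assert (m2 := Rmin_r e1 e2).
  assert (b1 := h1 h ltac:(unfold h; lra)). assert (b2 := h2 h ltac:(unfold h; lra)).
  assert (hx := exp_neg_lt_1 h ltac:(unfold h; lra)).
  assert (b3 := hPS (exp (- h)) ltac:(lra)).
  assert (b4 : Rpower h alpha * PSeries a (exp (- h)) <= / (2 * (M + 1)) * (M + 1)).
  { apply Rmult_le_compat; try lra. left; apply exp_pos. }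
  replace (/ (2 * (M + 1)) * (M + 1)) with (1 / 2) in b4 by (field; lra).
  apply Rabs_lt_between in b1. lra.
Qed.

Lemma scheme_kaluza (alpha : R) (omega a : nat -> R) :
  0 < alpha < 1 -> CM_preserving alpha omega a -> kaluza_sequence omega.
Proof.
  intros halpha hs. assert (hpos := scheme_weights_positive alpha omega a halpha hs).
  destruct hs as [_ [hinv [_ hcm]]].
  apply kaluza_of_log_convex with a; try assumption.
  - intro n. now apply completely_monotone_decr.
  - intro n. now apply completely_monotone_log_convex.
Qed.

Lemma kaluza_bound (v : nat -> R) (k : nat) :
  kaluza_sequence v -> Rabs (v k) <= 2 * v 0%nat.
Proof.
  intro hv. assert (h := kaluza_abs_sum v k hv). apply Rle_trans with (2 := h).
  destruct k as [|k]; [rewrite sum_O; lra|]. rewrite sum_n_Rsucc.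
  assert (0 <= sum_n (fun j => Rabs (v j)) k) by (apply sum_n_nonneg; intros; apply Rabs_pos).
  lra.
Qed.

(** [F] and the generating function of [a] are inverse to each other, so the
    consistency of [a] inverts to one of [omega]. *)
Lemma scheme_small_o (alpha : R) (omega a : nat -> R) :
  0 < alpha < 1 -> CM_preserving alpha omega a ->
  small_o alpha (fun h => PSeries omega (exp (- h)) - Rpower h alpha).
Proof.
  intros halpha hs. assert (hk := scheme_kaluza alpha omega a halpha hs).
  destruct hs as [_ [hinv [hcons hcm]]].
  intros eps heps. set (d := Rmin (1 / 2) (eps / 2)).
  assert (hd : 0 < d) by (apply Rmin_glb_lt; lra).
  assert (d1 : d <= 1 / 2) by apply Rmin_l. assert (d2 : d <= eps / 2) by apply Rmin_r.
  destruct (consistent_eventually alpha a d hcons hd) as [e1 [he1 h1]].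
  exists e1. split; [assumption|]. intros h hh. assert (b1 := h1 h hh).
  assert (hx := exp_neg_lt_1 h ltac:(lra)). set (x := exp (- h)) in *.
  set (M := Rmax (2 * omega 0%nat) (a 0%nat)).
  assert (hprod : PSeries omega x * PSeries a x = 1).
  { apply PSeries_conv_inverse with M; [assumption| | |lra].
    - intro k. apply Rle_trans with (2 := Rmax_l _ _). now apply kaluza_bound.
    - intro k. apply Rle_trans with (2 := Rmax_r _ _).
      rewrite Rabs_pos_eq by now apply completely_monotone_nonneg.
      apply completely_monotone_le; [assumption|lia]. }
  assert (hp : 0 < Rpower h alpha) by apply exp_pos.
  set (t := Rpower h alpha * PSeries a x) in *.
  assert (b2 := proj1 (Rabs_lt_between _ _) b1).
  assert (eo : PSeries omega x - Rpower h alpha = PSeries omega x * (1 - t)).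
  { unfold t. transitivity (PSeries omega x - Rpower h alpha * (PSeries omega x * PSeries a x)); [|ring].
    rewrite hprod. ring. }
  assert (ew : PSeries omega x * t = Rpower h alpha).
  { unfold t. transitivity (Rpower h alpha * (PSeries omega x * PSeries a x)); [ring|].
    rewrite hprod. ring. }
  assert (ow : 0 < PSeries omega x <= 2 * Rpower h alpha).
  { split; [|nra]. destruct (Rlt_or_le 0 (PSeries omega x)); [assumption|nra]. }
  rewrite eo, Rabs_mult, Rabs_pos_eq, Rabs_minus_sym by lra. nra.
Qed.

Lemma real_binomial_small_o (alpha : R) :
  0 < alpha < 1 ->
  small_o alpha (fun h => PSeries (real_binomial_coef alpha) (exp (- h)) - Rpower h alpha).
Proof.
  intros ha eps heps. exists eps. split; [assumption|]. intros h hh.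
  assert (hx := exp_neg_lt_1 h ltac:(lra)).
  rewrite real_binomial_PSeries by lra.
  assert (h1 := exp_ineq1_le (- h)). assert (h2 := exp_ineq1_le h).
  assert (h3 : exp (- h) <= / (1 + h)) by (rewrite exp_Ropp; apply Rinv_le_contravar; lra).
  assert (hp : 0 < Rpower h alpha) by apply exp_pos.
  assert (up : Rpower (1 - exp (- h)) alpha <= Rpower h alpha)
    by (apply Rle_Rpower_l; lra).
  (* 1 - exp (- h) >= h / (1 + h), and a power alpha < 1 of 1 / (1 + h) exceeds 1 - h *)
  assert (lo : (1 - h) * Rpower h alpha <= Rpower (1 - exp (- h)) alpha).
  { assert (hq : 0 < / (1 + h)) by (apply Rinv_0_lt_compat; lra).
    apply Rle_trans with (Rpower (/ (1 + h) * h) alpha).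
    - rewrite <- Rpower_mult_distr by lra. apply Rmult_le_compat_r; [lra|].
      apply Rle_trans with (/ (1 + h)).
      + apply Rmult_le_reg_r with (1 + h); [lra|]. rewrite Rinv_l by lra. nra.
      + unfold Rpower. rewrite ln_Rinv by lra.
        assert (hl : 0 <= ln (1 + h)) by (rewrite <- ln_1; left; apply ln_increasing; lra).
        rewrite <- (exp_ln (/ (1 + h))) at 1 by assumption. rewrite ln_Rinv by lra.
        destruct (Rle_lt_or_eq_dec _ _ hl) as [hl'|hl'].
        * left. apply exp_increasing. nra.
        * rewrite <- hl'. right. f_equal. ring.
    - apply Rle_Rpower_l; [lra|]. split; [apply Rmult_lt_0_compat; lra|].
      replace (/ (1 + h) * h) with (1 - / (1 + h)) by (field; lra). lra. }
  rewrite Rabs_left1 by lra. nra.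
Qed.

(** The argument of [(1 - z) ^ alpha] for [Re (1 - z) > 0]. *)
Lemma atan_half_plane_bound (alpha t : R) :
  0 < alpha < 1 ->
  Rabs (sin (alpha * atan t)) <= sin (PI * alpha / 2) /\
  cos (PI * alpha / 2) <= cos (alpha * atan t).
Proof.
  intro ha. assert (hp := PI_RGT_0). assert (hb := atan_bound t).
  set (x := alpha * atan t). set (th := PI * alpha / 2).
  assert (hth : 0 < th < PI / 2) by (unfold th; nra).
  assert (hx : - th <= x <= th).
  { replace th with (alpha * (PI / 2)) by (unfold th; field).
    replace (- (alpha * (PI / 2))) with (alpha * (- PI / 2)) by field.
    unfold x. split; apply Rmult_le_compat_l; lra. }
  split.
  - apply Rabs_le. rewrite <- sin_neg. split; apply sin_incr_1; lra.
  - destruct (Rle_or_lt 0 x) as [h|h].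
    + apply cos_decr_1; lra.
    + rewrite <- (cos_neg x). apply cos_decr_1; lra.
Qed.

(** * The sector containing the values of a generating function *)

(** For [0 < th < PI / 2], [sector_height th x <= 0] says that [x] lies in the
    closed sector [|arg x| <= th]; outside, this is at most the distance to the sector. *)
Definition sector_height (th : R) (x : C) : R :=
  Rabs (Im x) * cos th - Re x * sin th.

(** The height is the scalar product with a unit normal of the nearer edge of
    the sector. *)
Lemma sector_height_lipschitz (th : R) (x y : C) :
  0 <= cos th -> 0 <= sin th ->
  sector_height th x - sector_height th y <= Cmod (x - y).
Proof.
  intros hc hs. unfold sector_height.
  destruct x as [a b]. destruct y as [c d]. unfold Re, Im; simpl.
  assert (h1 : Rabs b - Rabs d <= Rabs (b - d)) by apply Rabs_triang_inv.
  assert (h2 : c - a <= Rabs (a - c)) by (rewrite Rabs_minus_sym; apply Rle_abs).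
  set (p := Rabs (b - d)) in *. set (q := Rabs (a - c)) in *.
  assert (hp : 0 <= p) by apply Rabs_pos. assert (hq : 0 <= q) by apply Rabs_pos.
  apply Rle_trans with (p * cos th + q * sin th); [nra|].
  assert (e : Cmod ((a, b) - (c, d))%C = sqrt (q * q + p * p)).
  { unfold Cmod. simpl. f_equal.
    replace (q * q) with ((a - c) * (a - c)) by exact (Rsqr_abs (a - c)).
    replace (p * p) with ((b - d) * (b - d)) by exact (Rsqr_abs (b - d)).
    ring. }
  rewrite e. rewrite <- (sqrt_square (p * cos th + q * sin th)) by nra.
  apply sqrt_le_1_alt. assert (h := sin2_cos2 th). unfold Rsqr in h.
  assert (h0 := pow2_ge_0 (p * sin th - q * cos th)).
  assert (hh : (p * cos th + q * sin th) * (p * cos th + q * sin th)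
               = (q * q + p * p) * (sin th * sin th + cos th * cos th)
                 - (p * sin th - q * cos th) ^ 2) by ring.
  rewrite h in hh. lra.
Qed.

Lemma sector_height_polar (th : R) (z : C) :
  z <> RtoC 0 ->
  sector_height th z = Cmod z * sin (acos (Re z / Cmod z) - th).
Proof.
  intro hz. assert (hm : 0 < Cmod z) by now apply Cmod_gt_0.
  set (c := Re z / Cmod z).
  assert (hc : Re z = Cmod z * c) by (unfold c; field; lra).
  assert (hre := re_le_Cmod z). apply Rabs_le_between in hre.
  assert (hb : -1 <= c <= 1) by (rewrite hc in hre; nra).
  assert (hI : Rabs (Im z) = Cmod z * sqrt (1 - c²)).
  { assert (h := Cmod2_alt z). rewrite hc in h.
    rewrite <- (sqrt_square (Cmod z)) at 1 by lra.
    rewrite <- sqrt_mult by (unfold Rsqr; nra).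
    rewrite <- sqrt_Rsqr_abs. f_equal. unfold Rsqr. nra. }
  unfold sector_height. rewrite hI, hc, sin_minus, sin_acos, cos_acos by assumption. ring.
Qed.

Lemma sector_height_mono (th th' : R) (x : C) :
  0 < th -> th <= th' -> th' < PI / 2 ->
  sector_height th x <= 0 -> sector_height th' x <= 0.
Proof.
  intros h0 h1 h2 hx. unfold sector_height in *.
  assert (hp := PI_RGT_0).
  assert (hc : 0 < cos th) by (apply cos_gt_0; lra).
  assert (hs : 0 < sin th) by (apply sin_gt_0; lra).
  assert (hc' : 0 < cos th') by (apply cos_gt_0; lra).
  assert (hd : 0 <= sin (th' - th)) by (apply sin_ge_0; lra).
  rewrite sin_minus in hd. assert (hi := Rabs_pos (Im x)).
  assert (hre : 0 <= Re x).
  { destruct (Rle_or_lt 0 (Re x)); [assumption|nra]. }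
  assert (k : Rabs (Im x) * cos th * cos th' <= Re x * sin th' * cos th) by nra.
  nra.
Qed.

Lemma Rabs_Carg (z : C) : Rabs (Carg z) = acos (Re z / Cmod z).
Proof.
  unfold Carg. assert (h := acos_bound (Re z / Cmod z)).
  destruct (Rle_dec 0 (Im z)); [|rewrite Rabs_Ropp]; apply Rabs_pos_eq; lra.
Qed.

Lemma Rabs_Carg_opp (z : C) : Rabs (Carg (- z)) = PI - acos (Re z / Cmod z).
Proof.
  rewrite Rabs_Carg, Cmod_opp.
  replace (Re (- z) / Cmod z) with (- (Re z / Cmod z)); [apply acos_opp|].
  unfold Re; simpl. unfold Rdiv. ring.
Qed.

Section Sector.

Variables (alpha : R) (omega a : nat -> R).
Hypothesis (halpha : 0 < alpha < 1) (hscheme : CM_preserving alpha omega a).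

Let F (z : C) : C := CSeries (dilate z (fun j => RtoC (omega j))).

Lemma omega_kaluza : kaluza_sequence omega.
Proof. exact (scheme_kaluza alpha omega a halpha hscheme). Qed.

Lemma omega_Series_0 : Series omega = 0.
Proof.
  apply kaluza_Series_0 with alpha; [lra|exact omega_kaluza|].
  exact (scheme_small_o alpha omega a halpha hscheme).
Qed.

Lemma omega_abs_summable : abs_summable (fun j => RtoC (omega j)).
Proof.
  unfold abs_summable. apply ex_series_ext with (2 := kaluza_abs_summable _ omega_kaluza).
  intro; now rewrite Cmod_R.
Qed.

(** [tauberian_disk] for [omega - b], where [b] are the coefficients of
    [(1 - z) ^ alpha]: both sequences have the asymptotics [h ^ alpha] on the
    positive axis, and their moduli of continuity add. *)
Lemma F_omega_near_1 (eps : R) :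
  0 < eps -> exists r, 0 < r /\ forall z, Cmod z < 1 -> Cmod (1 - z) < r ->
    Cmod (F z - Rpower (Cmod (1 - z)) alpha
                * cis (alpha * atan (Im (1 - z) / Re (1 - z))))
    <= eps * Rpower (Cmod (1 - z)) alpha.
Proof.
  intro heps. set (b := real_binomial_coef alpha).
  assert (hb : kaluza_sequence b) by now apply real_binomial_coef_kaluza.
  assert (ho := omega_kaluza).
  set (e := fun j => omega j - b j).
  assert (so := kaluza_abs_summable _ ho). assert (sb := kaluza_abs_summable _ hb).
  assert (oo := scheme_small_o alpha omega a halpha hscheme).
  assert (ob := real_binomial_small_o alpha halpha). fold b in ob.
  assert (b0 : Series b = 0) by (apply kaluza_Series_0 with alpha; [lra| |]; assumption).
  assert (triang : forall j, Rabs (e j) <= Rabs (omega j) + Rabs (b j)).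
  { intro j. unfold e, Rminus. apply Rle_trans with (1 := Rabs_triang _ _).
    rewrite Rabs_Ropp. lra. }
  assert (he : ex_series (fun j => Rabs (e j))).
  { apply ex_series_dom with (fun j => Rabs (omega j) + Rabs (b j)).
    - intro j. rewrite Rabs_Rabsolu. apply triang.
    - exact (ex_series_plus _ _ so sb). }
  assert (he0 : Series e = 0).
  { unfold e. rewrite Series_minus by (now apply ex_series_Rabs).
    rewrite omega_Series_0, b0. ring. }
  assert (hPS : forall x, 0 <= x <= 1 -> PSeries e x = PSeries omega x - PSeries b x).
  { intros x hx. assert (hp : forall k, 0 <= x ^ k <= 1) by (intro; now apply pow_le_1).
    unfold PSeries. rewrite <- Series_minus by
      (apply ex_series_Rabs, ex_series_times_unit; assumption).
    apply Series_ext. intro. unfold e. ring. }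
  assert (hsm : small_o alpha (fun h => PSeries e (exp (- h)))).
  { apply small_o_ext with (2 := small_o_minus _ _ _ oo ob). intros h hh.
    assert (hx := exp_neg_lt_1 h hh). rewrite hPS by lra. ring. }
  destruct (oo 1 Rlt_0_1) as [e1 [he1 h1]]. destruct (ob 1 Rlt_0_1) as [e2 [he2 h2]].
  destruct (tauberian_disk alpha e 4 (Rmin e1 e2) (proj1 halpha) he he0 hsm ltac:(lra)
    ltac:(now apply Rmin_glb_lt)) with (eps := eps) as [r [hr hdisk]]; [|assumption|].
  { intros h hh. assert (m1 := Rmin_l e1 e2). assert (m2 := Rmin_r e1 e2).
    assert (hx := exp_neg_lt_1 h ltac:(lra)). set (x := exp (- h)) in *.
    assert (g1 := proj1 (Rabs_le_between _ _) (h1 h ltac:(lra))).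
    assert (g2 := proj1 (Rabs_le_between _ _) (h2 h ltac:(lra))). fold x in g1, g2.
    assert (hp : forall k, 0 <= x ^ k <= 1) by (intro; apply pow_le_1; lra).
    destruct (Series_deficit omega x so ltac:(lra)) as [_ d1].
    destruct (Series_deficit b x sb ltac:(lra)) as [_ d2].
    apply Rle_trans with (PSeries omega x + PSeries b x); [|lra].
    rewrite <- (kaluza_deficit omega x ho omega_Series_0) by lra.
    rewrite <- (kaluza_deficit b x hb b0) by lra.
    rewrite <- Series_plus by assumption.
    apply Series_le; [|exact (ex_series_plus _ _ d1 d2)].
    intro j. assert (t := triang j). assert (tp := hp j). assert (tn := Rabs_pos (e j)).
    split; [apply Rmult_le_pos; lra|]. nra. }
  exists r. split; [assumption|]. intros z hz hz1.
  assert (h0 : 0 < Cmod (1 - z)).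
  { apply Cmod_gt_0. intro e0. replace z with (1 - (1 - z))%C in hz by ring.
    rewrite e0 in hz. replace (1 - 0)%C with (RtoC 1) in hz by ring.
    rewrite Cmod_1 in hz. lra. }
  assert (h := hdisk z hz (conj h0 hz1)).
  rewrite <- (real_binomial_series alpha z halpha hz). fold b.
  replace (F z - CSeries (dilate z (fun k => RtoC (b k))))%C
    with (CSeries (dilate z (fun j => RtoC (e j)))); [assumption|].
  assert (scb : abs_summable (fun j => RtoC (b j))).
  { unfold abs_summable. apply ex_series_ext with (2 := sb). intro; now rewrite Cmod_R. }
  replace (dilate z (fun j => RtoC (e j))) with
    (sadd (dilate z (fun j => RtoC (omega j))) (sscal (- (1))%C (dilate z (fun j => RtoC (b j))))).
  - assert (hz' : Cmod z <= 1) by lra.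
    assert (q1 := abs_summable_dilate _ z hz' omega_abs_summable).
    assert (q2 := abs_summable_dilate _ z hz' scb).
    rewrite CSeries_sadd, CSeries_sscal; auto using abs_summable_sscal.
    unfold F. ring.
  - apply functional_extensionality. intro j. unfold sadd, sscal, dilate, e.
    rewrite RtoC_minus. ring.
Qed.

Lemma omega_1_neg : omega 1%nat < 0.
Proof.
  assert (hpos := scheme_weights_positive alpha omega a halpha hscheme).
  destruct hscheme as [_ [hinv _]].
  assert (e0 := hinv 0%nat). assert (e1 := hinv 1%nat). unfold conv in e0, e1.
  rewrite sum_O in e0. rewrite sum_n_Rsucc, sum_O in e1. simpl in e0, e1.
  assert (p0 := hpos 0%nat). assert (p1 := hpos 1%nat). nra.
Qed.

(** [Re F (z) = sum |omega_j| (1 - Re z ^ j)] is at least its term [j = 1]. *)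
Lemma Re_F_omega_lower (z : C) :
  Cmod z <= 1 -> - omega 1%nat * (Cmod (1 - z) ^ 2 / 2) <= Re (F z).
Proof.
  intro hz.
  assert (ho := omega_kaluza). assert (so := kaluza_abs_summable _ ho).
  assert (hs := abs_summable_Re _ (abs_summable_dilate _ z hz omega_abs_summable)).
  assert (er : forall j, Re (dilate z (fun j => RtoC (omega j)) j) = omega j * Re (z ^ j)).
  { intro j. unfold dilate, Re. simpl. ring. }
  assert (hrj : forall j, -1 <= Re (z ^ j) <= 1).
  { intro j. apply Rabs_le_between. apply Rle_trans with (1 := re_le_Cmod _).
    rewrite Cmod_pow. apply pow_le_1. split; [apply Cmod_ge_0|assumption]. }
  set (t := fun j => omega j * Re (z ^ j) - omega j).
  assert (eF : Re (F z) = Series t).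
  { unfold t. rewrite Series_minus; [| |now apply ex_series_Rabs].
    - rewrite omega_Series_0, Rminus_0_r. unfold F, CSeries, Re at 1. simpl fst.
      apply Series_ext. exact er.
    - now apply ex_series_ext with (1 := er). }
  assert (ht0 : forall j, 0 <= t j).
  { intros [|j]; unfold t; [simpl; lra|].
    assert (h1 := proj1 ho j). assert (h2 := hrj (S j)). nra. }
  assert (hts : ex_series t).
  { unfold t. apply (ex_series_minus (fun j => omega j * Re (z ^ j)) omega).
    - now apply ex_series_ext with (1 := er).
    - now apply ex_series_Rabs. }
  rewrite eF. apply Rle_trans with (sum_n t 1); [|now apply sum_n_le_Series].
  rewrite sum_n_Rsucc, sum_O. apply Rle_trans with (t 1%nat); [|generalize (ht0 0%nat); lra].
  unfold t. rewrite Cpow_1_r.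
  replace (omega 1%nat * Re z - omega 1%nat) with (- omega 1%nat * (1 - Re z)) by ring.
  apply Rmult_le_compat_l; [generalize omega_1_neg; lra|].
  rewrite Cmod2_alt. assert (h := Cmod2_alt z).
  assert (hm := pow_le_1 (Cmod z) 2 (conj (Cmod_ge_0 z) hz)).
  destruct z as [x y]. unfold Re, Im in *. simpl in *. nra.
Qed.

Lemma Cmod_F_omega_upper (z : C) : Cmod z <= 1 -> Cmod (F z) <= 2 * omega 0%nat.
Proof.
  intro hz. assert (hs := abs_summable_dilate _ z hz omega_abs_summable).
  apply Rle_trans with (1 := Cmod_CSeries_le _ hs).
  apply Series_le_of_bound; [exact hs|]. intro n.
  apply Rle_trans with (2 := kaluza_abs_sum omega n omega_kaluza).
  apply sum_n_le_loc. intros k _. unfold dilate.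
  rewrite Cmod_mult, Cmod_R, Cmod_pow.
  apply Rle_trans with (Rabs (omega k) * 1); [|lra].
  apply Rmult_le_compat_l; [apply Rabs_pos|]. apply pow_le_1.
  split; [apply Cmod_ge_0|assumption].
Qed.

(** Near [1] the argument of [F (z)] is close to [alpha arg (1 - z)], and
    [|arg (1 - z)| < PI / 2] in the disk. *)
Lemma F_omega_sector_near_1 (th : R) :
  PI * alpha / 2 < th < PI / 2 ->
  exists r, 0 < r /\ forall z, Cmod z < 1 -> Cmod (1 - z) < r ->
    sector_height th (F z) <= 0.
Proof.
  intro hth. assert (hp := PI_RGT_0). set (th1 := PI * alpha / 2) in *.
  assert (h1 : 0 < th1) by (unfold th1; nra).
  assert (hc : 0 < cos th) by (apply cos_gt_0; lra).
  assert (hs : 0 < sin th) by (apply sin_gt_0; lra).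
  assert (hd : 0 < sin (th - th1)) by (apply sin_gt_0; lra).
  destruct (F_omega_near_1 (sin (th - th1)) hd) as [r [hr hF]].
  exists r. split; [assumption|]. intros z hz hz1. assert (h := hF z hz hz1).
  set (p := Rpower (Cmod (1 - z)) alpha) in *. assert (hp0 : 0 < p) by apply exp_pos.
  set (x := Im (1 - z) / Re (1 - z)) in *.
  destruct (atan_half_plane_bound alpha x halpha) as [bs bc]. fold th1 in bs, bc.
  set (y := (p * cis (alpha * atan x))%C) in *.
  assert (hl := sector_height_lipschitz th (F z) y ltac:(lra) ltac:(lra)).
  assert (hy : sector_height th y <= - (p * sin (th - th1))).
  { unfold sector_height, y, cis.
    replace (Im _) with (p * sin (alpha * atan x)) by (unfold Im; simpl; ring).
    replace (Re _) with (p * cos (alpha * atan x)) by (unfold Re; simpl; ring).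
    rewrite Rabs_mult, (Rabs_pos_eq p), sin_minus by lra.
    apply Rle_trans with (p * (sin th1 * cos th - cos th1 * sin th)); [|right; ring].
    rewrite !Rmult_assoc, <- Rmult_minus_distr_l. apply Rmult_le_compat_l; [lra|].
    apply Rplus_le_compat; [apply Rmult_le_compat_r; lra|].
    apply Ropp_le_contravar, Rmult_le_compat_r; lra. }
  lra.
Qed.

(** Near [1] the angle is governed by [PI alpha / 2]; elsewhere [F] is bounded
    with real part bounded below, which bounds the slope. *)
Lemma F_omega_sector :
  exists th0, PI * alpha / 2 < th0 < PI / 2 /\
    forall z, Cmod z < 1 -> sector_height th0 (F z) <= 0.
Proof.
  assert (hp := PI_RGT_0).
  set (th1 := PI * alpha / 2). assert (h1 : 0 < th1 < PI / 2) by (unfold th1; nra).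
  set (th2 := (th1 + PI / 2) / 2). assert (h2 : th1 < th2 < PI / 2) by (unfold th2; lra).
  destruct (F_omega_sector_near_1 th2) as [r [hr hnear]].
  { exact h2. }
  assert (hw1 := omega_1_neg).
  set (m := - omega 1%nat * (r ^ 2 / 2)).
  assert (hm : 0 < m) by (apply Rmult_lt_0_compat; [lra|apply Rdiv_lt_0_compat; [now apply pow_lt|lra]]).
  assert (hw0 : 0 <= 2 * omega 0%nat).
  { apply Rle_trans with (Cmod (F 0)); [apply Cmod_ge_0|].
    apply Cmod_F_omega_upper. rewrite Cmod_0. lra. }
  set (th3 := atan (2 * omega 0%nat / m)).
  assert (hb3 := atan_bound (2 * omega 0%nat / m)). fold th3 in hb3.
  exists (Rmax th2 th3).
  assert (l2 := Rmax_l th2 th3). assert (l3 := Rmax_r th2 th3).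
  assert (hlt : Rmax th2 th3 < PI / 2) by (apply Rmax_lub_lt; lra).
  split; [split; [lra|assumption]|].
  intros z hz. destruct (Rlt_or_le (Cmod (1 - z)) r) as [h|h].
  - apply sector_height_mono with th2; [lra|assumption|assumption|].
    now apply hnear.
  - assert (hre : m <= Re (F z)).
    { apply Rle_trans with (2 := Re_F_omega_lower z ltac:(lra)).
      unfold m. apply Rmult_le_compat_l; [lra|].
      assert (r ^ 2 <= Cmod (1 - z) ^ 2) by (apply pow_incr; lra). lra. }
    assert (him : Rabs (Im (F z)) <= 2 * omega 0%nat).
    { apply Rle_trans with (1 := im_le_Cmod _). apply Cmod_F_omega_upper. lra. }
    set (th := Rmax th2 th3) in *.
    assert (hc : 0 < cos th) by (apply cos_gt_0; lra).
    assert (hs : 0 < sin th) by (apply sin_gt_0; lra).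
    assert (hc3 : 0 < cos th3) by (apply cos_gt_0; lra).
    (* tan th >= tan th3 = 2 omega_0 / m *)
    assert (ht3 : 2 * omega 0%nat * cos th3 = m * sin th3).
    { assert (e := tan_atan (2 * omega 0%nat / m)). fold th3 in e. unfold tan in e.
      assert (e' : sin th3 = 2 * omega 0%nat / m * cos th3) by (rewrite <- e; field; lra).
      rewrite e'. field. lra. }
    assert (hd : 0 <= sin (th - th3)) by (apply sin_ge_0; lra).
    rewrite sin_minus in hd.
    assert (k : 2 * omega 0%nat * cos th <= m * sin th).
    { apply Rmult_le_reg_r with (cos th3); [assumption|].
      replace (2 * omega 0%nat * cos th * cos th3) with (m * sin th3 * cos th) by (rewrite <- ht3; ring).
      nra. }
    unfold sector_height. nra.
Qed.

Lemma F_omega_avoids_outside_sector (th0 : R) (zeta : C) :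
  0 < th0 < PI / 2 -> (forall z, Cmod z < 1 -> sector_height th0 (F z) <= 0) ->
  zeta <> RtoC 0 -> th0 < acos (Re zeta / Cmod zeta) ->
  exists d, 0 < d /\ forall z, Cmod z < 1 -> d <= Cmod (F z - zeta).
Proof.
  intros hth hF hz ha. assert (hp := PI_RGT_0).
  assert (hb := acos_bound (Re zeta / Cmod zeta)).
  exists (sector_height th0 zeta). rewrite sector_height_polar by assumption. split.
  - apply Rmult_lt_0_compat; [now apply Cmod_gt_0|apply sin_gt_0; lra].
  - intros z hz1. rewrite <- sector_height_polar by assumption.
    assert (hl := sector_height_lipschitz th0 zeta (F z)
      ltac:(left; apply cos_gt_0; lra) ltac:(left; apply sin_gt_0; lra)).
    assert (hs := hF z hz1).
    replace (F z - zeta)%C with (- (zeta - F z))%C by ring. rewrite Cmod_opp. lra.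
Qed.

(** Small values of [F] are attained only near [1], hence in a sector whose
    angle is arbitrarily close to [PI alpha / 2]. *)
Lemma F_omega_avoids_small (lambda : C) :
  lambda <> RtoC 0 -> PI * alpha / 2 < acos (Re lambda / Cmod lambda) ->
  exists rho, 0 < rho /\ forall s, 0 < s < rho ->
    exists d, 0 < d /\ forall z, Cmod z < 1 -> d <= Cmod (F z - lambda * s).
Proof.
  intros hl ha. assert (hp := PI_RGT_0).
  set (A := acos (Re lambda / Cmod lambda)) in *.
  assert (hb := acos_bound (Re lambda / Cmod lambda)). fold A in hb.
  set (th1 := PI * alpha / 2) in *. assert (h1 : 0 < th1 < PI / 2) by (unfold th1; nra).
  set (th := (th1 + Rmin A (PI / 2)) / 2).
  assert (m1 := Rmin_l A (PI / 2)). assert (m2 := Rmin_r A (PI / 2)).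
  assert (m3 : th1 < Rmin A (PI / 2)) by (apply Rmin_glb_lt; lra).
  destruct (F_omega_sector_near_1 th) as [r [hr hnear]].
  { fold th1. unfold th. lra. }
  assert (hw1 := omega_1_neg).
  set (m := - omega 1%nat * (r ^ 2 / 2)).
  assert (hm : 0 < m) by (apply Rmult_lt_0_compat; [lra|apply Rdiv_lt_0_compat; [now apply pow_lt|lra]]).
  assert (hL : 0 < Cmod lambda) by now apply Cmod_gt_0.
  exists (m / (2 * Cmod lambda)). split; [apply Rdiv_lt_0_compat; lra|].
  intros s hs.
  assert (hls : Cmod (lambda * s) <= m / 2).
  { rewrite Cmod_mult, Cmod_R, Rabs_pos_eq by lra.
    apply Rle_trans with (Cmod lambda * (m / (2 * Cmod lambda))).
    - apply Rmult_le_compat_l; lra.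
    - right. field. lra. }
  assert (hz : (lambda * s)%C <> RtoC 0).
  { intro e. assert (h0 : Cmod (lambda * s) = 0) by (rewrite e; apply Cmod_0).
    rewrite Cmod_mult, Cmod_R, Rabs_pos_eq in h0 by lra. nra. }
  assert (eA : acos (Re (lambda * s) / Cmod (lambda * s)) = A).
  { unfold A. f_equal. rewrite Cmod_mult, Cmod_R, Rabs_pos_eq by lra.
    replace (Re (lambda * s)) with (Re lambda * s) by (unfold Re; simpl; ring).
    field. lra. }
  assert (hpos : 0 < sector_height th (lambda * s)).
  { rewrite sector_height_polar, eA by assumption.
    apply Rmult_lt_0_compat; [now apply Cmod_gt_0|apply sin_gt_0; unfold th; lra]. }
  exists (Rmin (sector_height th (lambda * s)) (m / 2)).
  split; [apply Rmin_glb_lt; lra|]. intros z hz1.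
  destruct (Rlt_or_le (Cmod (1 - z)) r) as [h|h].
  - apply Rle_trans with (1 := Rmin_l _ _).
    assert (hlip := sector_height_lipschitz th (lambda * s) (F z)
      ltac:(left; apply cos_gt_0; unfold th; lra) ltac:(left; apply sin_gt_0; unfold th; lra)).
    assert (hsec := hnear z hz1 h).
    replace (F z - lambda * s)%C with (- (lambda * s - F z))%C by ring. rewrite Cmod_opp. lra.
  - apply Rle_trans with (1 := Rmin_r _ _).
    assert (hre : m <= Cmod (F z)).
    { apply Rle_trans with (Re (F z)).
      - apply Rle_trans with (2 := Re_F_omega_lower z ltac:(lra)).
        unfold m. apply Rmult_le_compat_l; [lra|].
        assert (r ^ 2 <= Cmod (1 - z) ^ 2) by (apply pow_incr; lra). lra.
      - apply Rle_trans with (2 := re_le_Cmod _). apply Rle_abs. }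
    assert (ht := Cmod_triangle (F z - lambda * s) (lambda * s)).
    replace (F z - lambda * s + lambda * s)%C with (F z) in ht by ring. lra.
Qed.

End Sector.

(** * The schemes as convolution equations *)

Definition tends_to_0 (u : nat -> C) : Prop :=
  forall eps, 0 < eps -> exists N, forall n, (N <= n)%nat -> Cmod (u n) <= eps.

Lemma tends_to_0_filterlim (u : nat -> C) :
  tends_to_0 u -> filterlim u eventually (locally (RtoC 0)).
Proof.
  intro hu. apply filterlim_locally. intro eps.
  destruct (hu (eps / 2) ltac:(generalize (cond_pos eps); lra)) as [N hN].
  exists N. intros n hn. assert (h := hN n hn). assert (he := cond_pos eps).
  assert (h1 := re_le_Cmod (u n)). assert (h2 := im_le_Cmod (u n)).
  split; unfold ball; simpl; unfold AbsRing_ball, abs, minus, plus, opp; simpl;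
    rewrite Ropp_0, Rplus_0_r; unfold Re, Im in *; lra.
Qed.

Lemma abs_summable_tends_to_0 (g : nat -> C) : abs_summable g -> tends_to_0 g.
Proof.
  intros hg eps he. assert (h := ex_series_lim_0 _ hg).
  apply is_lim_seq_spec in h. destruct (h (mkposreal eps he)) as [N hN].
  exists N. intros n hn. assert (b := hN n hn). simpl in b.
  rewrite Rminus_0_r, Rabs_pos_eq in b by apply Cmod_ge_0. lra.
Qed.

Lemma tends_to_0_sadd (u v : nat -> C) :
  tends_to_0 u -> tends_to_0 v -> tends_to_0 (sadd u v).
Proof.
  intros hu hv eps he.
  destruct (hu (eps / 2) ltac:(lra)) as [N1 h1]. destruct (hv (eps / 2) ltac:(lra)) as [N2 h2].
  exists (Nat.max N1 N2). intros n hn. apply Rle_trans with (1 := Cmod_triangle _ _).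
  assert (a1 := h1 n ltac:(lia)). assert (a2 := h2 n ltac:(lia)). lra.
Qed.

Lemma tends_to_0_sscal (c : C) (u : nat -> C) : tends_to_0 u -> tends_to_0 (sscal c u).
Proof.
  intros hu eps he. assert (hc := Cmod_ge_0 c).
  destruct (hu (eps / (Cmod c + 1)) ltac:(apply Rdiv_lt_0_compat; lra)) as [N h].
  exists N. intros n hn. unfold sscal. rewrite Cmod_mult.
  apply Rle_trans with ((Cmod c + 1) * (eps / (Cmod c + 1))).
  - apply Rmult_le_compat; [assumption|apply Cmod_ge_0|lra|now apply h].
  - right. field. lra.
Qed.

(** Few terms of [g] carry most of its norm, and these meet late terms of
    [v]. *)
Lemma tends_to_0_sconv (g v : nat -> C) (M : R) :
  abs_summable g -> (forall n, Cmod (v n) <= M) -> tends_to_0 v ->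
  tends_to_0 (sconv g v).
Proof.
  intros hg hM hv eps he.
  assert (hM0 : 0 <= M) by (apply Rle_trans with (2 := hM 0%nat); apply Cmod_ge_0).
  set (G := Series (fun k => Cmod (g k))).
  assert (hG : 0 <= G) by (apply Series_nonneg; [intro; apply Cmod_ge_0|exact hg]).
  assert (htail : exists K, G - norm_upto g K <= eps / (2 * (M + 1))).
  { assert (hl : is_lim_seq (norm_upto g) G) by exact (Series_correct _ hg).
    apply is_lim_seq_spec in hl.
    assert (hp : 0 < eps / (2 * (M + 1))) by (apply Rdiv_lt_0_compat; lra).
    destruct (hl (mkposreal _ hp)) as [K hK]. exists K.
    assert (h := hK K (Nat.le_refl K)). simpl in h. apply Rabs_lt_between in h. lra. }
  destruct htail as [K hK].
  assert (hc : 0 < eps / (2 * (G + 1))) by (apply Rdiv_lt_0_compat; lra).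
  set (c := eps / (2 * (G + 1))) in *.
  destruct (hv c hc) as [N hN].
  exists (K + N)%nat. intros n hn.
  apply Rle_trans with (1 := Cmod_sum_n_le _ _).
  set (t := fun j => if Nat.leb j K then 0 else Cmod (g j)).
  apply Rle_trans with (sum_n (fun j => c * Cmod (g j) + M * t j) n).
  - apply sum_n_le_loc. intros j hj. rewrite Cmod_mult. unfold t.
    assert (hgj := Cmod_ge_0 (g j)).
    destruct (Nat.leb j K) eqn:ej.
    + apply Nat.leb_le in ej. assert (h := hN (n - j)%nat ltac:(lia)). nra.
    + assert (h := hM (n - j)%nat). nra.
  - rewrite sum_n_Rplus, !sum_n_Rmult_l.
    assert (et : forall m, (K <= m)%nat -> sum_n t m = norm_upto g m - norm_upto g K :> R).
    { intros m hm. induction hm as [|m hm IH].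
      - rewrite (sum_n_Rext t (fun _ => 0)).
        + rewrite sum_n_const. ring.
        + intros k hk. unfold t. now rewrite (proj2 (Nat.leb_le k K)).
      - unfold norm_upto in *. rewrite !sum_n_Rsucc, IH. unfold t.
        rewrite (proj2 (Nat.leb_gt (S m) K)) by lia. ring. }
    rewrite et by lia. assert (hn' := norm_upto_le_Series g n hg). fold G in hn'.
    change (sum_n (fun k => Cmod (g k)) n) with (norm_upto g n).
    assert (b1 : c * norm_upto g n <= c * (G + 1)) by (apply Rmult_le_compat_l; lra).
    assert (b2 : M * (norm_upto g n - norm_upto g K) <= M * (eps / (2 * (M + 1))))
      by (apply Rmult_le_compat_l; lra).
    assert (b3 : M * (eps / (2 * (M + 1))) <= (M + 1) * (eps / (2 * (M + 1)))).
    { apply Rmult_le_compat_r; [left; apply Rdiv_lt_0_compat; lra|lra]. }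
    replace (c * (G + 1)) with (eps / 2) in b1 by (unfold c; field; lra).
    replace ((M + 1) * (eps / (2 * (M + 1)))) with (eps / 2) in b3 by (field; lra).
    lra.
Qed.

Definition ones : nat -> C := fun _ => RtoC 1.

Lemma sconv_RtoC (x y : nat -> R) (n : nat) :
  sconv (fun j => RtoC (x j)) (fun j => RtoC (y j)) n = RtoC (conv x y n).
Proof.
  assert (e : forall (t : nat -> R) m, sum_n (fun j => RtoC (t j)) m = RtoC (sum_n t m) :> C).
  { intros t m. induction m as [|m IH]; [now rewrite !sum_O|].
    rewrite sum_n_Csucc, IH, sum_n_Rsucc, RtoC_plus. reflexivity. }
  unfold sconv, conv. rewrite <- e. apply sum_n_Cext. intros j _. now rewrite RtoC_mult.
Qed.

Lemma sconv_ones (v : nat -> R) (n : nat) :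
  sconv (fun j => RtoC (v j)) ones n = RtoC (sum_n v n).
Proof.
  unfold ones. rewrite (sconv_RtoC v (fun _ => 1)). unfold conv. f_equal.
  apply sum_n_Rext. intros. ring.
Qed.

Section Scheme.

Variables (alpha : R) (omega a : nat -> R).
Hypothesis (halpha : 0 < alpha < 1) (hscheme : CM_preserving alpha omega a).

Let om : nat -> C := fun j => RtoC (omega j).
Let am : nat -> C := fun j => RtoC (a j).

(** Its generating function is [F - zeta]. *)
Definition symbol (zeta : C) : nat -> C := sadd om (sscal (- zeta)%C sone).

(** Convolution with [ones] produces the partial sums [W_n] of [omega]. *)
Definition forcing (zeta u0 : C) : nat -> C :=
  sscal u0 (sadd (sconv om ones) (sscal (- zeta)%C sone)).

Lemma symbol_sconv (zeta : C) (u : nat -> C) (n : nat) :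
  sconv (symbol zeta) u n = (sconv om u n - zeta * u n)%C.
Proof.
  unfold symbol. rewrite sconv_addl, sconv_scall, sconv_1l. unfold sadd, sscal. ring.
Qed.

Lemma forcing_value (zeta u0 : C) (n : nat) :
  forcing zeta u0 n = (u0 * (sconv om ones n - zeta * sone n))%C.
Proof. unfold forcing, sscal, sadd. ring. Qed.

Lemma abs_summable_sone : abs_summable sone.
Proof. apply abs_summable_of_bound with 1. intro. rewrite norm_upto_sone. lra. Qed.

(** Once the symbol [F_omega - zeta] stays away from [0], Wiener's lemma makes
    its inverse [g] absolutely summable, and [u = g * (u_0 (W - zeta delta))]
    where the partial sums [W_n] of [omega] tend to [F_omega (1) = 0]. *)
Lemma well_defined_vanishing_of_symbol (zeta u0 : C) (sol : (nat -> C) -> Prop) (d : R) :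
  0 < d ->
  (forall z, Cmod z < 1 -> d <= Cmod (CSeries (dilate z om) - zeta)) ->
  (omega 0%nat - zeta <> 0 ->
   forall u, sol u <-> sconv (symbol zeta) u = forcing zeta u0)%C ->
  well_defined_vanishing sol.
Proof.
  intros hd hlow hsol.
  assert (hk := scheme_kaluza alpha omega a halpha hscheme).
  assert (hom : abs_summable om) by exact (omega_abs_summable alpha omega a halpha hscheme).
  assert (hf : abs_summable (symbol zeta)).
  { apply abs_summable_sadd; [assumption|]. apply abs_summable_sscal, abs_summable_sone. }
  assert (hF : forall z, Cmod z < 1 -> d <= Cmod (CSeries (dilate z (symbol zeta)))).
  { intros z hz. assert (h := hlow z hz).
    replace (dilate z (symbol zeta)) with (sadd (dilate z om) (sscal (- zeta)%C sone)).
    - rewrite CSeries_sadd, CSeries_sscal, CSeries_sone;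
        auto using abs_summable_sone, abs_summable_sscal.
      + replace (CSeries (dilate z om) + - zeta * 1)%C with (CSeries (dilate z om) - zeta)%C by ring.
        assumption.
      + apply abs_summable_dilate; [lra|assumption].
    - rewrite <- (dilate_sone z) at 1. apply functional_extensionality. intro j.
      unfold symbol, dilate, sadd, sscal. ring. }
  assert (h0 : (omega 0%nat - zeta)%C <> RtoC 0).
  { intro e. assert (h := hlow (RtoC 0) ltac:(rewrite Cmod_0; lra)).
    replace (CSeries (dilate 0 om)) with (RtoC (omega 0%nat)) in h.
    - rewrite e, Cmod_0 in h. lra.
    - unfold om. rewrite CSeries_RtoC_real, PSeries_0. reflexivity. }
  destruct (sconv_inverse_exists (symbol zeta)) as [g hg].
  { unfold symbol, sadd, sscal, sone, om, delta_d. intro e. apply h0. rewrite <- e. ring. }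
  assert (hgs := Wiener_power_series (symbol zeta) g d hf hg hd hF).
  assert (hsol' := hsol h0).
  exists (sconv g (forcing zeta u0)). split; [|split].
  - apply hsol'. transitivity (sconv (sconv (symbol zeta) g) (forcing zeta u0)); [ring|].
    rewrite hg. ring.
  - intros v hv n. apply hsol' in hv. rewrite <- hv.
    assert (e : v = sconv g (sconv (symbol zeta) v)).
    { transitivity (sconv (sconv (symbol zeta) g) v); [rewrite hg|]; ring. }
    now rewrite <- e.
  - apply tends_to_0_filterlim.
    replace (sconv g (forcing zeta u0))
      with (sscal u0 (sadd (sconv g (sconv om ones)) (sscal (- zeta)%C g))).
    + apply tends_to_0_sscal, tends_to_0_sadd.
      * assert (hlim : is_lim_seq (sum_n omega) 0).
        { rewrite <- (omega_Series_0 alpha omega a halpha hscheme).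
          apply Series_correct, ex_series_Rabs, kaluza_abs_summable, hk. }
        apply tends_to_0_sconv with (2 * omega 0%nat); [assumption| |].
        -- intro n. unfold om. rewrite sconv_ones, Cmod_R.
           apply Rle_trans with (2 := kaluza_abs_sum omega n hk).
           induction n as [|n IH]; [rewrite !sum_O; lra|].
           rewrite !sum_n_Rsucc. apply Rle_trans with (1 := Rabs_triang _ _). lra.
        -- intros eps he. apply is_lim_seq_spec in hlim.
           destruct (hlim (mkposreal eps he)) as [N hN]. exists N. intros n hn.
           assert (h := hN n hn). simpl in h. rewrite Rminus_0_r in h.
           unfold om. rewrite sconv_ones, Cmod_R. lra.
      * now apply tends_to_0_sscal, abs_summable_tends_to_0.
    + unfold forcing.
      rewrite (sconv_comm g (sscal _ _)), sconv_scall, sconv_addl, sconv_scall, sconv_1l.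
      now rewrite (sconv_comm g).
Qed.

(** The convolution equation at [n = 0] reads
    [(omega_0 - zeta) (u 0 - u_0) = 0]: it encodes the initial condition as soon
    as [zeta] differs from [omega_0]. *)
Lemma scheme_solution_iff (lambda u0 : C) (h : R) (u : nat -> C) :
  let zeta := (lambda * Rpower h alpha)%C in
  0 < h -> (omega 0%nat - zeta)%C <> RtoC 0 ->
  scheme_solution alpha omega h (fun _ v => (lambda * v)%C) u0 u
  <-> sconv (symbol zeta) u = forcing zeta u0.
Proof.
  intros zeta hh h0.
  assert (hdiff : forall n, sum_n (fun j => RtoC (omega j) * (u (n - j)%nat - u0))%C n
                    = (sconv om u n - u0 * sconv om ones n)%C :> C).
  { intro n. replace (sconv om u n - u0 * sconv om ones n)%C
      with (sconv om u n + - u0 * sconv om ones n)%C by ring.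
    unfold sconv at 2. rewrite <- sum_n_Cmult_l. unfold sconv. rewrite <- sum_n_Cplus.
    apply sum_n_Cext. intros j _. unfold om, ones. ring. }
  assert (hpw : RtoC (Rpower h (- alpha)) = (/ Rpower h alpha)%C).
  { rewrite <- RtoC_inv; [now rewrite Rpower_Ropp|]. generalize (exp_pos (alpha * ln h)).
    unfold Rpower. lra. }
  assert (hnz : RtoC (Rpower h alpha) <> RtoC 0).
  { intro e. apply RtoC_inj in e. generalize (exp_pos (alpha * ln h)). unfold Rpower in e. lra. }
  assert (e0 : sconv om u 0%nat = (omega 0%nat * u 0%nat)%C) by apply sconv_0.
  assert (e1 : sconv om ones 0%nat = omega 0%nat).
  { rewrite sconv_0. unfold om, ones. ring. }
  split.
  - intros [hu0 hu]. apply functional_extensionality. intros [|n].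
    + rewrite symbol_sconv, forcing_value, e0, e1, hu0. unfold sone, delta_d. ring.
    + assert (e := hu (S n) ltac:(lia)). rewrite hdiff, hpw in e.
      rewrite symbol_sconv, forcing_value. unfold sone, delta_d.
      assert (e' : (sconv om u (S n) - u0 * sconv om ones (S n) = zeta * u (S n))%C).
      { unfold zeta. transitivity (Rpower h alpha * (lambda * u (S n)))%C; [|ring].
        rewrite <- e. now field. }
      transitivity ((sconv om u (S n) - u0 * sconv om ones (S n)) + u0 * sconv om ones (S n)
                    - zeta * u (S n))%C; [ring|]. rewrite e'. ring.
  - intro e. assert (en : forall n, (sconv om u n - zeta * u n
                              = u0 * (sconv om ones n - zeta * sone n))%C).
    { intro n. now rewrite <- symbol_sconv, e, forcing_value. }
    split.
    + assert (h1 := en 0%nat). rewrite e0, e1 in h1. unfold sone, delta_d in h1.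
      transitivity (/ (omega 0%nat - zeta) * (omega 0%nat * u 0%nat - zeta * u 0%nat))%C;
        [now field|]. rewrite h1. now field.
    + intros [|n] hn; [lia|]. rewrite hdiff, hpw.
      assert (h1 := en (S n)). unfold sone, delta_d in h1.
      transitivity (/ Rpower h alpha * ((sconv om u (S n) - zeta * u (S n)) + zeta * u (S n)
                     - u0 * sconv om ones (S n)))%C; [ring|].
      rewrite h1. unfold zeta. now field.
Qed.

(** Here the scheme is [u - u_0 = zeta a * (u - u_0 delta)]; convolving with
    [omega], the inverse of [a], gives the same equation as before. *)
Lemma test_solution_iff (zeta u0 : C) (u : nat -> C) :
  (omega 0%nat - zeta)%C <> RtoC 0 ->
  test_solution a zeta u0 u <-> sconv (symbol zeta) u = forcing zeta u0.
Proof.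
  intro h0.
  destruct hscheme as [hw0 [hinv _]].
  assert (homam : sconv om am = sone).
  { apply functional_extensionality. intro n. unfold om, am.
    now rewrite sconv_RtoC, hinv. }
  set (lhs := ssub u (sscal u0 ones)).
  set (rhs := sscal zeta (sconv am (ssub u (sscal u0 sone)))).
  assert (hlast : forall n, sconv am (ssub u (sscal u0 sone)) (S n)
      = (sum_n (fun j => RtoC (a j) * u (S n - j)%nat) n + a (S n) * (u 0%nat - u0))%C).
  { intro n. unfold sconv. rewrite sum_n_Csucc, Nat.sub_diag. f_equal.
    - apply sum_n_Cext. intros j hj. unfold ssub, sscal, sone, am.
      replace (S n - j)%nat with (S (n - j)) by lia. unfold delta_d. ring.
    - unfold ssub, sscal, sone, am, delta_d. ring. }
  assert (ha0 : (omega 0%nat * a 0%nat)%C = RtoC 1).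
  { rewrite <- RtoC_mult. f_equal. generalize (hinv 0%nat). unfold conv, delta_d. rewrite sum_O. auto. }
  assert (iff1 : test_solution a zeta u0 u <-> lhs = rhs).
  { split.
    - intros [hu0 hu]. apply functional_extensionality. intros [|n].
      + unfold lhs, rhs, sscal at 2. rewrite sconv_0.
        unfold ssub, sscal, ones, sone, delta_d. rewrite hu0. ring.
      + unfold lhs, rhs, sscal at 2. rewrite hlast. unfold ssub, sscal, ones.
        rewrite (hu (S n)) at 1 by lia. rewrite Nat.sub_succ, Nat.sub_0_r, hu0. ring.
    - intro e.
      assert (hu0 : u 0%nat = u0).
      { assert (e0 : lhs 0%nat = rhs 0%nat) by now rewrite e.
        unfold lhs, rhs, sscal at 2 in e0. rewrite sconv_0 in e0.
        unfold ssub, sscal, ones, sone, delta_d, am in e0.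
        set (D := (u 0%nat - u0 * 1)%C) in *.
        assert (e1 : ((omega 0%nat - zeta) * D)%C = RtoC 0).
        { transitivity (omega 0%nat * (zeta * (a 0%nat * D)) - zeta * D)%C;
            [rewrite <- e0; ring|].
          transitivity (omega 0%nat * a 0%nat * (zeta * D) - zeta * D)%C; [ring|].
          rewrite ha0. ring. }
        transitivity (u0 + / (omega 0%nat - zeta) * ((omega 0%nat - zeta) * D))%C;
          [unfold D; now field|]. rewrite e1. ring. }
      split; [assumption|]. intros [|n] hn; [lia|].
      assert (e1 : lhs (S n) = rhs (S n)) by now rewrite e.
      unfold lhs, rhs, sscal at 2 in e1. rewrite hlast, hu0 in e1.
      unfold ssub, sscal, ones in e1. rewrite Nat.sub_succ, Nat.sub_0_r.
      transitivity (u0 + (u (S n) - u0 * 1))%C; [ring|]. rewrite e1. ring. }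
  rewrite iff1.
  assert (sc : forall c v, sscal c v = sconv (sscal c sone) v).
  { intros c v. now rewrite sconv_scall, sconv_1l. }
  unfold lhs, rhs, symbol, forcing. 
  rewrite (sc zeta (sconv _ _)), (sc u0 ones), (sc u0 (sadd _ _)).
  assert (ez : sscal (- zeta)%C sone = sopp (sscal zeta sone)).
  { apply functional_extensionality. intro n. unfold sscal, sopp. ring. }
  rewrite ez. set (Z := sscal zeta sone). set (U := sscal u0 sone).
  split; intro e.
  - assert (e' := f_equal (sconv om) e).
    transitivity (sadd (sconv om (ssub u (sconv U ones)))
      (sadd (sconv om (sconv U ones)) (sopp (sconv Z u)))); [ring|].
    rewrite e'. transitivity (sadd (sconv (sconv om am) (sconv Z (ssub u (sconv U sone))))
      (sadd (sconv om (sconv U ones)) (sopp (sconv Z u)))); [ring|].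
    rewrite homam. ring.
  - transitivity (sconv (sconv om am) (ssub u (sconv U ones))); [rewrite homam; ring|].
    transitivity (sconv am (sadd (sconv (sadd om (sopp Z)) u)
      (ssub (sconv Z u) (sconv om (sconv U ones))))); [ring|].
    rewrite e. ring.
Qed.

End Scheme.

Theorem corollary3p1 (alpha : R) (halpha : 0 < alpha < 1)
    (omega a : nat -> R) (hscheme : CM_preserving alpha omega a) :
  exists theta0 : R,
    0 < theta0 < PI / 2 /\
    (forall z : C, z <> RtoC 0 -> Rabs (Carg (- z)%C) < PI - theta0 ->
       stability_region a z) /\
    (forall lambda : C, lambda <> RtoC 0 -> theta0 < Rabs (Carg lambda) ->
       forall h : R, 0 < h -> stable alpha omega lambda h) /\
    (forall lambda : C, lambda <> RtoC 0 -> PI * alpha / 2 < Rabs (Carg lambda) ->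
       exists h0 : R, 0 < h0 /\
         forall h : R, 0 < h < h0 -> stable alpha omega lambda h).
Proof.
  assert (hp := PI_RGT_0).
  destruct (F_omega_sector alpha omega a halpha hscheme) as [th0 [hth hsec]].
  assert (hth0 : 0 < th0 < PI / 2) by nra.
  exists th0. split; [assumption|split; [|split]].
  - intros z hz harg u0 _. rewrite Rabs_Carg_opp in harg.
    destruct (F_omega_avoids_outside_sector omega th0 z hth0 hsec hz ltac:(lra)) as [d [hd hlow]].
    apply (well_defined_vanishing_of_symbol alpha omega a halpha hscheme z u0 _ d hd hlow).
    intros h0 u. now apply (test_solution_iff alpha omega a hscheme).
  - intros lambda hl harg h hh u0. rewrite Rabs_Carg in harg.
    assert (hpw : 0 < Rpower h alpha) by apply exp_pos.
    set (zeta := (lambda * Rpower h alpha)%C).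
    assert (hz : zeta <> RtoC 0).
    { intro e. assert (e0 : Cmod zeta = 0) by (rewrite e; apply Cmod_0).
      unfold zeta in e0. rewrite Cmod_mult, Cmod_R, Rabs_pos_eq in e0 by lra.
      assert (h1 := proj1 (Cmod_gt_0 lambda) hl). nra. }
    assert (hr : Re zeta / Cmod zeta = Re lambda / Cmod lambda).
    { unfold zeta. rewrite Cmod_mult, Cmod_R, Rabs_pos_eq by lra.
      replace (Re (lambda * Rpower h alpha)) with (Re lambda * Rpower h alpha)
        by (unfold Re; simpl; ring).
      assert (h1 := proj1 (Cmod_gt_0 lambda) hl). field. lra. }
    rewrite <- hr in harg.
    destruct (F_omega_avoids_outside_sector omega th0 zeta hth0 hsec hz harg) as [d [hd hlow]].
    apply (well_defined_vanishing_of_symbol alpha omega a halpha hscheme zeta u0 _ d hd hlow).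
    intros h0 u. now apply scheme_solution_iff.
  - intros lambda hl harg. rewrite Rabs_Carg in harg.
    destruct (F_omega_avoids_small alpha omega a halpha hscheme lambda hl harg) as [rho [hrho hav]].
    destruct (Rpower_small alpha (rho / 2) ltac:(lra) ltac:(lra)) as [h0 [hh0 hsmall]].
    exists h0. split; [assumption|]. intros h hh u0.
    assert (hpw : 0 < Rpower h alpha) by apply exp_pos.
    assert (hs := hsmall h hh).
    destruct (hav (Rpower h alpha) ltac:(lra)) as [d [hd hlow]].
    apply (well_defined_vanishing_of_symbol alpha omega a halpha hscheme
             (lambda * Rpower h alpha) u0 _ d hd hlow).
    intros hne u. apply scheme_solution_iff; [lra|assumption].
Qed.
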